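(* Let $\gamma$ be an admissible function (with parameters $\alpha_0\in(\frac{\pi}{2},\pi]$ and $c>0$). Then, for any $\delta>0$, \[ K(z)=\bigl(1+o(1)\bigr)\sqrt{\frac{L(s)}{2\pi L'(s)}}\,\exp\left(-s^2\,\frac{L'(s)}{L(s)}\right),\qquad z\to\infty, \] uniformly in $z\in\Omega(\alpha_0-\delta)$. Here $s=s_z$ is the solution of the saddle-point equation corresponding to $z$, and the branch of the square root is the one that is positive on the positive half-line.
   Context: Let $\frac{\pi}{2}<\alpha_0\le\pi$ and $c>0$. Let $\gamma$ be analytic and non-vanishing in the angle $\{s:|\arg(s+c)|<\alpha_0\}$ and positive on $(-c,+\infty)$. Using the branch of $\log\gamma$ that is real on $(-c,+\infty)$, put $\log L(s)=\frac1s\log\gamma(s)$, i.e. $L(s)=\gamma(s)^{1/s}$, and $\varepsilon(s)=s\,\frac{L'(s)}{L(s)}$. The function $\gamma$ is called admissible if $\varepsilon$ is positive and bounded on $\mathbb{R}_+$ and (A) $\int^\infty \frac{\varepsilon(\rho)}{\rho}\,d\rho=\infty$; (B) $\rho|\varepsilon'(\rho)|=o(\varepsilon(\rho))$ as $\rho\to\infty$; (C) for $s=\rho e^{i\theta}$, $\rho\to\infty$, one has $\varepsilon(s)=(1+o(1))\varepsilon(\rho)$, uniformly in any angle $|\theta|\le\alpha_0-\delta$, $\delta>0$. The function $K$ is defined on the Riemann surface of $\log z$ by \[ K(z)=\frac{1}{2\pi i}\int_{\mathcal{L}_\alpha}z^{-s}\gamma(s)\,ds,\qquad z^{-s}=e^{-s\log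 z}, \] where $\alpha\in(\frac{\pi}{2},\alpha_0)$ and $\mathcal{L}_\alpha=\{s:|\arg s|=\alpha\}$ is the union of two rays from the origin, traversed so that $\operatorname{Im}s$ increases along $\mathcal{L}_\alpha$. Put $\Phi(s)=\log L(s)+s\,\frac{L'(s)}{L(s)}$. For $0<\alpha<\alpha_0$ and $\rho_0>0$ put $S(\alpha,\rho_0)=\{s:|\arg s|<\alpha,\ |s|>\rho_0\}$. For $\rho_0$ sufficiently large $\Phi$ is univalent in $S(\alpha,\rho_0)$; such a $\rho_0$ is fixed, and $\Omega(\alpha)=\Omega(\alpha,\rho_0)$ denotes the domain on the Riemann surface of $\log z$ consisting of the points $z$ with $\log z=\Phi(s)$, $s\in S(\alpha,\rho_0)$. For $z\in\Omega(\alpha)$, $s_z\in S(\alpha,\rho_0)$ is the unique solution of the saddle-point equation $\log L(s)+s\frac{L'(s)}{L(s)}=\log z$. The limit $z\to\infty$ means $|z|\to\infty$. *)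

(* Defs.v *)
(* Stdlib's real numbers, with Coquelicot's complex numbers, derivatives and
   integrals. *)
From Stdlib Require Import Reals.
From Coquelicot Require Export Coquelicot.

Open Scope R_scope.

Definition polar (r t : R) : C := (r * cos t, r * sin t).

Definition Cexp (z : C) : C := polar (exp (Re z)) (Im z).

(* {s : |arg s| < alpha, |s| > rho0}.  The argument is meant to be the principal
   one, so alpha <= PI is the intended range; for alpha <= 0 the set is empty. *)
Definition sector (alpha rho0 : R) (s : C) : Prop :=
  exists r t : R, rho0 < r /\ Rabs t < alpha /\ s = polar r t.

(* {s : |arg (s + c)| < alpha0} *)
Definition angle (alpha0 c : R) (s : C) : Prop :=
  sector alpha0 0 (s + RtoC c)%C.

Definition Cpositive (w : C) : Prop := Im w = 0 /\ 0 < Re w.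

(* For use on open sets D only. *)
Definition analytic_on (D : C -> Prop) (f : C -> C) : Prop :=
  forall s, D s -> ex_derive (K := C_AbsRing) (V := C_NormedModule) f s.

Definition univalent_on (D : C -> Prop) (f : C -> C) : Prop :=
  analytic_on D f /\ forall s1 s2, D s1 -> D s2 -> f s1 = f s2 -> s1 = s2.

(* Since the angle is connected, these conditions determine [lg] on it. *)
Definition real_log_branch (alpha0 c : R) (gamma lg : C -> C) : Prop :=
  (forall s, angle alpha0 c s ->
     continuous (T := C_UniformSpace) (U := C_UniformSpace) lg s) /\
  (forall s, angle alpha0 c s -> Cexp (lg s) = gamma s) /\
  (forall x : R, - c < x -> Im (lg (RtoC x)) = 0).

(* In the next four definitions [lg] is the chosen branch of log gamma.  They
   are meaningful at the non-zero points of the angle; [C_derive] is a total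
   function that agrees with the complex derivative where the latter exists. *)
Definition logL (lg : C -> C) (s : C) : C := (lg s / s)%C.

Definition L (lg : C -> C) (s : C) : C := Cexp (logL lg s).

Definition epsilon (lg : C -> C) (s : C) : C :=
  (s * (C_derive (L lg) s / L lg s))%C.

Definition Phi (lg : C -> C) (s : C) : C :=
  (logL lg s + s * (C_derive (L lg) s / L lg s))%C.

Record admissible (alpha0 c : R) (gamma lg : C -> C) : Prop := {
  adm_analytic : analytic_on (angle alpha0 c) gamma;
  adm_nonzero : forall s, angle alpha0 c s -> gamma s <> RtoC 0;
  adm_positive : forall x : R, - c < x -> Cpositive (gamma (RtoC x));
  adm_log : real_log_branch alpha0 c gamma lg;
  adm_eps_positive :
    forall rho : R, 0 < rho -> Cpositive (epsilon lg (RtoC rho));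
  adm_eps_bounded :
    exists M : R, forall rho : R, 0 < rho -> Cmod (epsilon lg (RtoC rho)) <= M;
  adm_A :
    is_lim (fun X : R => RInt (fun rho => Re (epsilon lg (RtoC rho)) / rho) 1 X)
      p_infty p_infty;
  adm_B :
    forall eta : R, 0 < eta ->
    exists R0 : R, forall rho : R, 0 < rho -> R0 < rho ->
      rho * Cmod (C_derive (epsilon lg) (RtoC rho))
        <= eta * Cmod (epsilon lg (RtoC rho));
  adm_C :
    forall delta : R, 0 < delta ->
    forall eta : R, 0 < eta ->
    exists R0 : R, forall rho theta : R,
      0 < rho -> R0 < rho -> Rabs theta <= alpha0 - delta ->
      Cmod (epsilon lg (polar rho theta) - epsilon lg (RtoC rho))%C
        <= eta * Cmod (epsilon lg (RtoC rho))
}.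

(* A point z of the Riemann surface of the logarithm is given by the value of
   log z, an arbitrary complex number. *)
Record log_surface : Set := Exp_point { Log : C }.

Definition modulus (z : log_surface) : R := exp (Re (Log z)).

(* z ^ (-s) *)
Definition pow_opp (z : log_surface) (s : C) : C := Cexp (- (s * Log z))%C.

(* The integral of f along the ray arg s = alpha, oriented away from 0. *)
Definition ray_integral (f : C -> C) (alpha : R) : C :=
  RInt_gen (V := C_R_CompleteNormedModule)
    (fun r : R => (f (polar r alpha) * polar 1 alpha)%C)
    (at_point 0) (Rbar_locally p_infty).

(* Im s increases along the contour: it comes in from infinity along
   arg s = - alpha and leaves along arg s = alpha. *)
Definition K (gamma : C -> C) (alpha : R) (z : log_surface) : C :=
  (/ (RtoC (2 * PI) * Ci) *
   (ray_integral (fun s => pow_opp z s * gamma s) alpha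
    - ray_integral (fun s => pow_opp z s * gamma s) (- alpha)))%C.

Definition saddle_point (lg : C -> C) (alpha rho0 : R) (z : log_surface) (s : C)
  : Prop :=
  sector alpha rho0 s /\ Phi lg s = Log z.

Definition Omega (lg : C -> C) (alpha rho0 : R) (z : log_surface) : Prop :=
  exists s, saddle_point lg alpha rho0 z s.

(* [q] is a branch on D of the square root of f, positive at the positive
   points of D.  For use on open sets D only. *)
Definition sqrt_branch (D : C -> Prop) (f q : C -> C) : Prop :=
  (forall s, D s ->
     continuous (T := C_UniformSpace) (U := C_UniformSpace) q s) /\
  (forall s, D s -> (q s * q s)%C = f s) /\
  (forall x : R, 0 < x -> D (RtoC x) -> Cpositive (q (RtoC x))).

Definition main_term (lg q : C -> C) (s : C) : C :=
  (q s * Cexp (- (s * s * (C_derive (L lg) s / L lg s))))%C.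

(* Main.v *)
(** Put g = log gamma.  Then Phi = g', so that z^(-s) gamma(s) = exp(h(s)) with
    h(s) = g(s) - s log z and h' = Phi - Phi(s_z): the point s_z is a critical point
    of h, with critical value - s_z epsilon(s_z).

    The integrand has a primitive F on the angle, which is star-shaped about 0.
    As F has the same limit along all the rays arg s = t with t > pi/2 in the
    angle, K(z) is the difference of the two limits of F divided by 2 pi i, and any
    path to infinity through s_z may be used to compute it.

    Let rho = |s_z|, th = arg s_z and lam = rho epsilon(rho), which tends to
    infinity.  By (B), epsilon varies slowly on the half-line; by (C) and Cauchy's
    estimate, s epsilon'(s) = o(epsilon(|s|)) in smaller angles.  Hence
    Phi(s) - Phi(s_z) = (1 + o(1)) epsilon(rho) log(s / s_z) as long as s / s_z stays
    in a compact set, i.e. h behaves like lam u (log u - 1 - i th), u = s / rho.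
    The path leaves s_z in the direction of steepest descent, which gives a Gaussian
    integral with real exponent, uniformly in th.  It then proceeds to the rays
    arg s = +-a1 along segments parallel to the axes of the (log |s|, arg s)-plane
    on which the real part of the model decreases; along the rays Re h decreases
    because Re Phi increases.  All of this is exponentially small with respect to
    the contribution of s_z. *)

Require Import Defs.
From Stdlib Require Import Reals.
From Coquelicot Require Import Coquelicot.
From Stdlib Require Import Lra Psatz Classical IndefiniteDescription Ranalysis5 List.
Open Scope R_scope.

(** * Complex derivatives and paths *)

(** The obstacle is uniformity: epsilon may tend to 0, and (B) and (C) control errors only relative
    to epsilon, so no fixed Taylor expansion of log gamma is available. Dividing h by lam and Phi by
    epsilon(rho) reduces everything to functions whose derivative is eta-close to that of one model,
    and a single eta and a single lower bound for lam then serve all z. In the coordinate zeta = log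
    s sectors become strips. Cauchy discs have constant radius there, and (B) says that log epsilon
    has a small Lipschitz constant far out on the real line; this also gives lam -> infinity when
    epsilon tends to 0. Condition (A) enters through log L -> infinity, which makes the integrand
    decay on the rays. The auxiliary angle a1 exceeds both alpha and alpha0 - delta, because |arg
    s_z| may be larger than alpha. The function exp h is never integrated numerically along the
    path: increments of its primitive F are bounded by a mean value inequality with explicit real
    majorants. *)

Definition is_Cder (f : C -> C) (z l : C) : Prop :=
  is_derive (K := C_AbsRing) (V := C_NormedModule) f z l.

Definition is_Cpath (f : R -> C) (t : R) (v : C) : Prop :=
  is_derive (K := R_AbsRing) (V := C_R_NormedModule) f t v.

Lemma Cder_eps (f : C -> C) (z l : C) :
  is_Cder f z l <->
  forall e, 0 < e -> exists d, 0 < d /\ forall w, Cmod (w - z) < d ->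
    Cmod (f w - f z - l * (w - z)) <= e * Cmod (w - z).
Proof.
  assert (E : forall w, minus (minus (f w) (f z)) (scal (minus w z) l)
     = (f w - f z - l * (w - z))%C).
  { intros w; unfold minus, plus, opp, scal; simpl; unfold mult; simpl; ring. }
  split.
  - intros [_ H] e He.
    destruct (H z (fun P HP => HP) (mkposreal e He)) as [d Hd]; simpl in Hd.
    exists d; split; [apply cond_pos|]; intros w Hw.
    specialize (Hd w Hw). rewrite <- E. exact Hd.
  - intros H; split.
    + apply is_linear_scal_l.
    + intros y Hy e.
      assert (Hz : z = y) by now apply (is_filter_lim_locally_unique (K := C_AbsRing) (V := AbsRing_NormedModule C_AbsRing)).
      subst y.
      destruct (H e (cond_pos e)) as [d [Hd Hd']].
      exists (mkposreal d Hd); intros w Hw; specialize (Hd' w Hw).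
      rewrite <- E in Hd'. exact Hd'.
Qed.

Lemma Cpath_eps (f : R -> C) (t : R) (v : C) :
  is_Cpath f t v <->
  forall e, 0 < e -> exists d, 0 < d /\ forall u, Rabs (u - t) < d ->
    Cmod (f u - f t - RtoC (u - t) * v) <= e * Rabs (u - t).
Proof.
  assert (E : forall u, minus (minus (f u) (f t)) (scal (minus u t) v)
     = (f u - f t - RtoC (u - t) * v)%C).
  { intros u; destruct v as [v1 v2]; destruct (f u), (f t).
    unfold minus, plus, opp, scal; simpl; unfold prod_plus, prod_opp, prod_scal, Cminus, Cplus, Cmult, Copp, scal, minus, plus, opp; simpl.
    unfold mult; simpl. f_equal; ring. }
  split.
  - intros [_ H] e He.
    destruct (H t (fun P HP => HP) (mkposreal e He)) as [d Hd]; simpl in Hd.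
    exists d; split; [apply cond_pos|]; intros w Hw.
    specialize (Hd w Hw). rewrite <- E, Cmod_norm. exact Hd.
  - intros H; split.
    + apply is_linear_scal_l.
    + intros y Hy e.
      assert (Hz : t = y) by now apply (is_filter_lim_locally_unique (K := R_AbsRing) (V := R_NormedModule)).
      subst y.
      destruct (H e (cond_pos e)) as [d [Hd Hd']].
      exists (mkposreal d Hd); intros w Hw; specialize (Hd' w Hw).
      rewrite <- E, Cmod_norm in Hd'. exact Hd'.
Qed.

(** C carries two distinct normed module structures over itself; the rules for products, for the
    identity and for inner functions speak of the one attached to absolute rings. *)
Lemma Cder_AbsRing (f : C -> C) (z l : C) :
  is_derive (K := C_AbsRing) (V := AbsRing_NormedModule C_AbsRing) f z l
  <-> is_Cder f z l.
Proof.
split; intros [_ H]; (split; [apply is_linear_scal_l | exact H]).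
Qed.

Lemma Cder_const (a z : C) : is_Cder (fun _ => a) z 0.
Proof. apply (is_derive_const (K := C_AbsRing) (V := C_NormedModule)). Qed.

Lemma Cder_id (z : C) : is_Cder (fun w => w) z 1.
Proof. apply Cder_AbsRing. apply (is_derive_id (K := C_AbsRing)). Qed.

Lemma Cder_plus (f g : C -> C) (z a b : C) :
  is_Cder f z a -> is_Cder g z b -> is_Cder (fun w => f w + g w)%C z (a + b).
Proof. apply (is_derive_plus (K := C_AbsRing) (V := C_NormedModule)). Qed.

Lemma Cder_minus (f g : C -> C) (z a b : C) :
  is_Cder f z a -> is_Cder g z b -> is_Cder (fun w => f w - g w)%C z (a - b).
Proof. apply (is_derive_minus (K := C_AbsRing) (V := C_NormedModule)). Qed.

Lemma Cder_mult (f g : C -> C) (z a b : C) :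
  is_Cder f z a -> is_Cder g z b ->
  is_Cder (fun w => f w * g w)%C z (a * g z + f z * b).
Proof.
intros Ha%Cder_AbsRing Hb%Cder_AbsRing; apply Cder_AbsRing.
apply (is_derive_mult (K := C_AbsRing)); [exact Ha|exact Hb|].
intros; apply Cmult_comm.
Qed.

Lemma Cder_comp (f g : C -> C) (z a b : C) :
  is_Cder f (g z) a -> is_Cder g z b -> is_Cder (fun w => f (g w)) z (a * b)%C.
Proof.
intros Ha Hb%Cder_AbsRing. rewrite Cmult_comm.
apply (is_derive_comp (K := C_AbsRing) (V := C_NormedModule)); [exact Ha|exact Hb].
Qed.

Lemma Cder_unique (f : C -> C) (z a : C) : is_Cder f z a -> C_derive f z = a.
Proof. apply is_C_derive_unique. Qed.

Lemma Cmod_le_abs (z : C) : Cmod z <= Rabs (Re z) + Rabs (Im z).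
Proof.
assert (E : z = (RtoC (Re z) + RtoC (Im z) * Ci)%C).
{ destruct z as [x y]; unfold Cplus, Cmult, RtoC, Ci, Re, Im; simpl; f_equal; ring. }
rewrite E at 1.
eapply Rle_trans; [apply Cmod_triangle|].
rewrite Cmod_mult, !Cmod_R, Cmod_Ci; lra.
Qed.

Lemma Cmod_sub_ge (a b : C) : Cmod a - Cmod b <= Cmod (a - b).
Proof.
assert (H := Cmod_triangle (a - b) b).
replace (a - b + b)%C with a in H by ring. lra.
Qed.

Lemma Cmod_sub_sym (a b : C) : Cmod (a - b) = Cmod (b - a).
Proof. rewrite <- Cmod_opp; f_equal; ring. Qed.

Lemma Cmod_triangle3 (a b c : C) : Cmod (a - c) <= Cmod (a - b) + Cmod (b - c).
Proof. replace (a - c)%C with (a - b + (b - c))%C by ring. apply Cmod_triangle. Qed.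

Lemma Im_le_Cmod (z : C) : Rabs (Im z) <= Cmod z.
Proof.
apply Rle_trans with (2 := Rmax_Cmod z). apply Rmax_r.
Qed.

(** Continuity in terms of [Cmod]. The balls of the uniform structure on C are squares in (Re, Im),
    whence the factor 2 in [Cball_elim]. *)
Definition Ccont (f : C -> C) (z : C) : Prop :=
  forall e, 0 < e -> exists d, 0 < d /\
    forall w, Cmod (w - z) < d -> Cmod (f w - f z) < e.

Lemma Cder_cont (f : C -> C) (z l : C) : is_Cder f z l -> Ccont f z.
Proof.
intros H e He. apply Cder_eps with (e := 1) in H; [|lra].
destruct H as [d [Hd H]].
assert (Hl := Cmod_ge_0 l).
assert (Hk : 0 < e / (2 + Cmod l)) by (apply Rdiv_lt_0_compat; lra).
exists (Rmin d (e / (2 + Cmod l))); split; [now apply Rmin_glb_lt|].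
intros w Hw.
assert (H1 := H w (Rlt_le_trans _ _ _ Hw (Rmin_l _ _))).
assert (H2 := Rlt_le_trans _ _ _ Hw (Rmin_r _ _)).
assert (H3 : Cmod (f w - f z) <= Cmod (f w - f z - l * (w - z)) + Cmod (l * (w - z))).
{ replace (f w - f z)%C with (f w - f z - l * (w - z) + l * (w - z))%C at 1 by ring.
  apply Cmod_triangle. }
rewrite Cmod_mult in H3.
assert (H0 := Cmod_ge_0 (w - z)).
apply Rle_lt_trans with ((1 + Cmod l) * Cmod (w - z)); [lra|].
apply Rle_lt_trans with ((1 + Cmod l) * (e / (2 + Cmod l))).
- apply Rmult_le_compat_l; lra.
- replace e with ((2 + Cmod l) * (e / (2 + Cmod l))) at 2 by (field; lra).
  apply Rmult_lt_compat_r; lra.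
Qed.

Lemma Cball_iff (z w : C) (e : posreal) :
  ball (M := C_UniformSpace) z e w <->
  Rabs (Re w - Re z) < e /\ Rabs (Im w - Im z) < e.
Proof.
reflexivity.
Qed.

Lemma Cball_intro (z w : C) (e : posreal) :
  Cmod (w - z) < e -> ball (M := C_UniformSpace) z e w.
Proof.
intros H; apply Cball_iff; split.
- apply Rle_lt_trans with (2 := H). apply (re_le_Cmod (w - z)).
- apply Rle_lt_trans with (2 := H). apply (Im_le_Cmod (w - z)).
Qed.

Lemma Cball_elim (z w : C) (e : posreal) :
  ball (M := C_UniformSpace) z e w -> Cmod (w - z) < 2 * e.
Proof.
intros H; destruct (proj1 (Cball_iff z w e) H) as [H1 H2].
apply Rle_lt_trans with (1 := Cmod_le_abs _).
change (Rabs (Re w - Re z) + Rabs (Im w - Im z) < 2 * e). lra.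
Qed.

Lemma Ccont_of_continuous (f : C -> C) (z : C) :
  continuous (T := C_UniformSpace) (U := C_UniformSpace) f z -> Ccont f z.
Proof.
intros H e He.
assert (He2 : 0 < e / 2) by lra.
destruct (H (ball (M := C_UniformSpace) (f z) (mkposreal _ He2))) as [d Hd].
{ now exists (mkposreal _ He2). }
exists d; split; [apply cond_pos|]. intros w Hw.
replace e with (2 * mkposreal _ He2) by (simpl; field).
apply Cball_elim, Hd, Cball_intro, Hw.
Qed.

Definition Rcont (f : R -> C) (t : R) : Prop :=
  forall e, 0 < e -> exists d, 0 < d /\
    forall u, Rabs (u - t) < d -> Cmod (f u - f t) < e.

Lemma Rcont_continuous (f : R -> C) (t : R) :
  Rcont f t -> continuous (T := R_UniformSpace) (U := C_UniformSpace) f t.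
Proof.
intros H P [e He].
destruct (H e (cond_pos e)) as [d [Hd Hd']].
exists (mkposreal d Hd); intros u Hu. apply He, Cball_intro, Hd', Hu.
Qed.

Lemma Cpath_Rcont (f : R -> C) (t : R) (l : C) : is_Cpath f t l -> Rcont f t.
Proof.
intros H e He. apply Cpath_eps with (e := 1) in H; [|lra].
destruct H as [d [Hd H]].
assert (Hl := Cmod_ge_0 l).
assert (Hk : 0 < e / (2 + Cmod l)) by (apply Rdiv_lt_0_compat; lra).
exists (Rmin d (e / (2 + Cmod l))); split; [now apply Rmin_glb_lt|].
intros w Hw.
assert (H1 := H w (Rlt_le_trans _ _ _ Hw (Rmin_l _ _))).
assert (H2 := Rlt_le_trans _ _ _ Hw (Rmin_r _ _)).
assert (H3 : Cmod (f w - f t) <= Cmod (f w - f t - RtoC (w - t) * l) + Cmod (RtoC (w - t) * l)).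
{ replace (f w - f t)%C with (f w - f t - RtoC (w - t) * l + RtoC (w - t) * l)%C at 1 by ring.
  apply Cmod_triangle. }
rewrite Cmod_mult, Cmod_R in H3.
assert (H0 := Rabs_pos (w - t)).
apply Rle_lt_trans with ((1 + Cmod l) * Rabs (w - t)); [lra|].
apply Rle_lt_trans with ((1 + Cmod l) * (e / (2 + Cmod l))).
- apply Rmult_le_compat_l; lra.
- replace e with ((2 + Cmod l) * (e / (2 + Cmod l))) at 2 by (field; lra).
  apply Rmult_lt_compat_r; lra.
Qed.

Lemma Rcont_comp (f : C -> C) (g : R -> C) (t : R) :
  Ccont f (g t) -> Rcont g t -> Rcont (fun u => f (g u)) t.
Proof.
intros Hf Hg e He. destruct (Hf e He) as [d [Hd H]].
destruct (Hg d Hd) as [d' [Hd' H']].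
exists d'; split; [easy|]; auto.
Qed.

Lemma Cpath_comp (f : C -> C) (g : R -> C) (t : R) (l v : C) :
  is_Cder f (g t) l -> is_Cpath g t v -> is_Cpath (fun u => f (g u)) t (l * v)%C.
Proof.
intros Hf Hg. apply Cpath_eps; intros e He.
assert (Hl := Cmod_ge_0 l). assert (Hv := Cmod_ge_0 v).
set (e1 := e / (2 * (2 + Cmod v))).
assert (He1 : 0 < e1) by (apply Rdiv_lt_0_compat; lra).
set (e2 := Rmin 1 (e / (2 * (1 + Cmod l)))).
assert (He2 : 0 < e2).
{ apply Rmin_glb_lt; [lra|]. apply Rdiv_lt_0_compat; lra. }
destruct (proj1 (Cder_eps _ _ _) Hf e1 He1) as [d1 [Hd1 H1]].
destruct (proj1 (Cpath_eps _ _ _) Hg e2 He2) as [d2 [Hd2 H2]].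
destruct (Cpath_Rcont _ _ _ Hg d1 Hd1) as [d3 [Hd3 H3]].
exists (Rmin d2 d3); split; [now apply Rmin_glb_lt|]. intros u Hu.
assert (Hu2 := Rlt_le_trans _ _ _ Hu (Rmin_l _ _)).
assert (Hu3 := Rlt_le_trans _ _ _ Hu (Rmin_r _ _)).
specialize (H1 _ (H3 u Hu3)). specialize (H2 u Hu2).
assert (A := Rabs_pos (u - t)).
assert (B : Cmod (g u - g t) <= (1 + Cmod v) * Rabs (u - t)).
{ replace (g u - g t)%C with (g u - g t - RtoC (u - t) * v + RtoC (u - t) * v)%C by ring.
  eapply Rle_trans; [apply Cmod_triangle|]. rewrite Cmod_mult, Cmod_R.
  assert (e2 <= 1) by apply Rmin_l.
  assert (e2 * Rabs (u - t) <= 1 * Rabs (u - t)) by (apply Rmult_le_compat_r; lra).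
  lra. }
replace (f (g u) - f (g t) - RtoC (u - t) * (l * v))%C
  with (f (g u) - f (g t) - l * (g u - g t) + l * (g u - g t - RtoC (u - t) * v))%C by ring.
eapply Rle_trans; [apply Cmod_triangle|]. rewrite Cmod_mult.
apply Rle_trans with (e1 * ((2 + Cmod v) * Rabs (u - t)) + (1 + Cmod l) * (e / (2 * (1 + Cmod l)) * Rabs (u - t))).
- apply Rplus_le_compat.
  + eapply Rle_trans; [exact H1|]. apply Rmult_le_compat_l; lra.
  + apply Rmult_le_compat; [lra|apply Cmod_ge_0|lra|].
    eapply Rle_trans; [exact H2|]. apply Rmult_le_compat_r; [lra|apply Rmin_r].
- unfold e1. apply Req_le. field; lra.
Qed.

Lemma Cpath_iff (f : R -> C) (t : R) (v : C) :
  is_Cpath f t v <->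
  is_derive (fun u => Re (f u)) t (Re v) /\ is_derive (fun u => Im (f u)) t (Im v).
Proof.
assert (E : forall u, (f u - f t - RtoC (u - t) * v)%C =
  (Re (f u) - Re (f t) - (u - t) * Re v, Im (f u) - Im (f t) - (u - t) * Im v)).
{ intros u; destruct (f u), (f t), v; unfold Cminus, Cplus, Copp, Cmult, RtoC, Re, Im; simpl.
  f_equal; ring. }
assert (D : forall (g : R -> R) l, is_derive g t l <->
  forall e, 0 < e -> exists d, 0 < d /\ forall u, Rabs (u - t) < d ->
    Rabs (g u - g t - (u - t) * l) <= e * Rabs (u - t)).
{ intros g l; split.
  - intros [_ H] e He.
    destruct (H t (fun P HP => HP) (mkposreal e He)) as [d Hd]; simpl in Hd.
    exists d; split; [apply cond_pos|]; intros w Hw. exact (Hd w Hw).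
  - intros H; split.
    + apply is_linear_scal_l.
    + intros y Hy e.
      assert (Hz : t = y) by now apply (is_filter_lim_locally_unique (K := R_AbsRing) (V := R_NormedModule)).
      subst y.
      destruct (H e (cond_pos e)) as [d [Hd Hd']].
      exists (mkposreal d Hd); intros w Hw. exact (Hd' w Hw). }
rewrite Cpath_eps, !D. split.
- intros H; split; intros e He; destruct (H e He) as [d [Hd Hd']];
    exists d; (split; [easy|]); intros u Hu; specialize (Hd' u Hu); rewrite E in Hd';
    apply Rle_trans with (2 := Hd').
  + apply (re_le_Cmod (_, _)).
  + apply (Im_le_Cmod (_, _)).
- intros [H1 H2] e He.
  destruct (H1 (e / 2)) as [d1 [Hd1 Hd1']]; [lra|].
  destruct (H2 (e / 2)) as [d2 [Hd2 Hd2']]; [lra|].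
  exists (Rmin d1 d2); split; [now apply Rmin_glb_lt|]. intros u Hu.
  specialize (Hd1' u (Rlt_le_trans _ _ _ Hu (Rmin_l _ _))).
  specialize (Hd2' u (Rlt_le_trans _ _ _ Hu (Rmin_r _ _))).
  rewrite E. eapply Rle_trans; [apply Cmod_le_abs|]. unfold Re at 1, Im at 3; simpl. lra.
Qed.

(** For a unit number u the real function g - Re (u f) is nondecreasing by the real mean value
    theorem; u is then chosen to align with f b - f a. Nearly all later estimates of contour
    integrals have this form, with f a primitive along the path and g an explicit primitive of a
    majorant. *)
Lemma path_dominated (f f' : R -> C) (g g' : R -> R) (a b : R) :
  a <= b ->
  (forall t, a <= t <= b ->
     is_Cpath f t (f' t) /\ is_derive g t (g' t) /\ Cmod (f' t) <= g' t) ->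
  Cmod (f b - f a) <= g b - g a.
Proof.
intros Hab H.
assert (P : forall u, Cmod u = 1 -> Re (u * (f b - f a)) <= g b - g a).
{ intros u Hu.
  set (k := fun t => g t - (Re u * Re (f t) - Im u * Im (f t))).
  destruct (MVT_gen k a b (fun t => g' t - (Re u * Re (f' t) - Im u * Im (f' t)))) as [c [Hc E]].
  - intros t Ht. rewrite Rmin_left, Rmax_right in Ht by lra.
    destruct (H t) as [H1 [H2 _]]; [lra|].
    apply Cpath_iff in H1 as [H11 H12].
    apply (is_derive_minus (V := R_NormedModule)); [exact H2|].
    apply (is_derive_minus (V := R_NormedModule)); apply is_derive_scal; assumption.
  - intros t Ht. rewrite Rmin_left, Rmax_right in Ht by lra.
    destruct (H t) as [H1 [H2 _]]; [lra|].
    apply Cpath_iff in H1 as [H11 H12].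
    apply continuity_pt_filterlim.
    apply (ex_derive_continuous (V := R_NormedModule)). eexists.
    apply (is_derive_minus (V := R_NormedModule)); [exact H2|].
    apply (is_derive_minus (V := R_NormedModule)); apply is_derive_scal; eassumption.
  - rewrite Rmin_left, Rmax_right in Hc by lra.
    destruct (H c Hc) as [_ [_ H3]].
    assert (H4 : Re (u * f' c) <= Cmod (f' c)).
    { eapply Rle_trans; [apply Rle_abs|]. eapply Rle_trans; [apply re_le_Cmod|].
      rewrite Cmod_mult, Hu. lra. }
    assert (H5 : 0 <= k b - k a).
    { rewrite E. apply Rmult_le_pos; [|lra]. unfold Cmult, Re, Im in *; simpl in *. lra. }
    unfold k in H5. unfold Cminus, Cplus, Copp, Cmult, Re, Im in *; simpl in *. lra. }
destruct (Ceq_dec (f b - f a) 0) as [E|E].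
- specialize (P 1%C Cmod_1). rewrite E in *. rewrite Cmod_0.
  rewrite Cmult_0_r in P. exact P.
- set (D := (f b - f a)%C) in *.
  assert (HD : 0 < Cmod D) by now apply Cmod_gt_0.
  (* This unit factor turns D into the positive number |D|. *)
  specialize (P (Cconj D / RtoC (Cmod D))%C).
  assert (HN : RtoC (Cmod D) <> 0) by (intros HN; apply RtoC_inj in HN; lra).
  rewrite Cmod_div, Cmod_conj, Cmod_R, Rabs_pos_eq in P by (assumption || lra).
  replace (Cconj D / RtoC (Cmod D) * D)%C with (RtoC (Cmod D)) in P.
  + apply P. field. lra.
  + replace (Cconj D / RtoC (Cmod D) * D)%C with (D * Cconj D / RtoC (Cmod D))%C by (field; assumption).
    rewrite <- Cmod2_conj, RtoC_pow; field; assumption.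
Qed.

(** * The complex exponential *)

Lemma Cpath_line (a v : C) (t : R) : is_Cpath (fun u => a + RtoC u * v)%C t v.
Proof.
apply Cpath_eps. intros e He. exists 1; split; [lra|]. intros u _.
replace (a + RtoC u * v - (a + RtoC t * v) - RtoC (u - t) * v)%C with (RtoC 0).
- rewrite Cmod_0. apply Rmult_le_pos; [lra|apply Rabs_pos].
- rewrite RtoC_minus. ring.
Qed.

Lemma Cexp_plus (a b : C) : Cexp (a + b) = (Cexp a * Cexp b)%C.
Proof.
destruct a as [a1 a2], b as [b1 b2]. unfold Cexp, polar, Cplus, Cmult, Re, Im; simpl.
rewrite exp_plus, cos_plus, sin_plus. f_equal; ring.
Qed.

Lemma Cexp_0 : Cexp 0 = 1%C.
Proof.
unfold Cexp, polar, Re, Im; simpl. rewrite exp_0, cos_0, sin_0. unfold RtoC; f_equal; ring.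
Qed.

Lemma Cmod_polar (r t : R) : 0 <= r -> Cmod (polar r t) = r.
Proof.
intros H. unfold polar, Cmod; simpl.
replace (r * cos t * (r * cos t * 1) + r * sin t * (r * sin t * 1)) with (r * r * (Rsqr (sin t) + Rsqr (cos t)))
  by (unfold Rsqr; ring).
rewrite sin2_cos2, Rmult_1_r. now apply sqrt_square.
Qed.

Lemma Cmod_Cexp (a : C) : Cmod (Cexp a) = exp (Re a).
Proof. apply Cmod_polar. left; apply exp_pos. Qed.

Lemma Cexp_neq_0 (a : C) : Cexp a <> 0.
Proof. intros H. assert (E := Cmod_Cexp a). rewrite H, Cmod_0 in E. assert (h := exp_pos (Re a)). lra. Qed.

Lemma Cexp_opp (a : C) : Cexp (- a) = (/ Cexp a)%C.
Proof.
assert (E : (Cexp (- a) * Cexp a = 1)%C).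
{ rewrite <- Cexp_plus, <- Cexp_0. f_equal; ring. }
assert (H := Cexp_neq_0 a).
rewrite <- (Cmult_1_r (Cexp (- a))), <- (Cinv_r (Cexp a)) by assumption.
rewrite Cmult_assoc, E. ring.
Qed.

Lemma Cexp_line_path (w : C) (t : R) :
  is_Cpath (fun u => Cexp (RtoC u * w)) t (w * Cexp (RtoC t * w))%C.
Proof.
destruct w as [a b]. apply Cpath_iff.
unfold Cexp, polar, Cmult, RtoC, Re, Im; simpl. split.
- auto_derive; [easy|]. unfold Rminus. ring.
- auto_derive; [easy|]. unfold Rminus. ring.
Qed.

Lemma exp_Re_line (w : C) (t : R) : 0 <= t <= 1 -> exp (Re (RtoC t * w)) <= exp (Cmod w).
Proof.
intros Ht. assert (Re (RtoC t * w) <= Cmod w).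
{ eapply Rle_trans; [apply Rle_abs|]. eapply Rle_trans; [apply re_le_Cmod|].
  rewrite Cmod_mult, Cmod_R, Rabs_pos_eq by lra.
  assert (H := Cmod_ge_0 w). nra. }
destruct H as [H|H]; [left; now apply exp_increasing|right; now rewrite H].
Qed.

(** The derivative w exp(u w) of u |-> exp(u w) is bounded on [0, 1]; the next lemma repeats this
    with the linear term subtracted. *)
Lemma Cexp_sub_1 (w : C) : Cmod (Cexp w - 1) <= Cmod w * exp (Cmod w).
Proof.
assert (H := path_dominated (fun u => Cexp (RtoC u * w)) (fun t => w * Cexp (RtoC t * w))%C
  (fun t => t * (Cmod w * exp (Cmod w))) (fun _ => Cmod w * exp (Cmod w)) 0 1).
cbv beta in H. rewrite !Cmult_1_l, Cmult_0_l, Cexp_0, Rmult_0_l, Rmult_1_l, Rminus_0_r in H.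
apply H; [lra|]. intros t Ht; split; [|split].
- apply Cexp_line_path.
- auto_derive; [easy|ring].
- rewrite Cmod_mult, Cmod_Cexp. apply Rmult_le_compat_l; [apply Cmod_ge_0|].
  now apply exp_Re_line.
Qed.

Lemma Cexp_sub_1_sub (w : C) : Cmod (Cexp w - 1 - w) <= Cmod w ^ 2 * exp (Cmod w).
Proof.
assert (H := path_dominated (fun u => Cexp (RtoC u * w) - RtoC u * w)%C (fun t => w * (Cexp (RtoC t * w) - 1))%C
  (fun t => t * (Cmod w ^ 2 * exp (Cmod w))) (fun _ => Cmod w ^ 2 * exp (Cmod w)) 0 1).
cbv beta in H. rewrite !Cmult_1_l, Cmult_0_l, Cexp_0, Rmult_0_l, Rmult_1_l, Rminus_0_r in H.
replace (Cexp w - 1 - w)%C with (Cexp w - w - (1 - 0))%C by ring.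
apply H; [lra|]. intros t Ht; split; [|split].
- apply Cpath_iff.
  destruct (proj1 (Cpath_iff _ _ _) (Cexp_line_path w t)) as [A B].
  destruct (proj1 (Cpath_iff _ _ _) (Cpath_line 0 w t)) as [A' B'].
  split.
  + apply is_derive_ext with (f := fun u => minus (Re (Cexp (RtoC u * w))) (Re (0 + RtoC u * w)%C)).
    * intros u. rewrite Cplus_0_l. reflexivity.
    * replace (Re (w * (Cexp (RtoC t * w) - 1))) with (minus (Re (w * Cexp (RtoC t * w))) (Re w)).
      now apply (is_derive_minus (V := R_NormedModule)).
      unfold minus, plus, opp, Cmult, Cminus, Cplus, Copp, RtoC, Re, Im; simpl; ring.
  + apply is_derive_ext with (f := fun u => minus (Im (Cexp (RtoC u * w))) (Im (0 + RtoC u * w)%C)).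
    * intros u. rewrite Cplus_0_l. reflexivity.
    * replace (Im (w * (Cexp (RtoC t * w) - 1))) with (minus (Im (w * Cexp (RtoC t * w))) (Im w)).
      now apply (is_derive_minus (V := R_NormedModule)).
      unfold minus, plus, opp, Cmult, Cminus, Cplus, Copp, RtoC, Re, Im; simpl; ring.
- auto_derive; [easy|ring].
- rewrite Cmod_mult.
  assert (H1 := Cexp_sub_1 (RtoC t * w)).
  assert (H0 := Cmod_ge_0 w). assert (H2 := Cmod_ge_0 (RtoC t * w)).
  assert (H3 : Cmod (RtoC t * w) <= Cmod w).
  { rewrite Cmod_mult, Cmod_R, Rabs_pos_eq by lra. nra. }
  replace (Cmod w ^ 2 * exp (Cmod w)) with (Cmod w * (Cmod w * exp (Cmod w))) by ring.
  apply Rmult_le_compat_l; [lra|].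
  eapply Rle_trans; [exact H1|]. apply Rmult_le_compat; [lra|left; apply exp_pos|lra|].
  destruct H3 as [H3|H3]; [left; now apply exp_increasing|right; now rewrite H3].
Qed.

Lemma Cder_Cexp (z : C) : is_Cder Cexp z (Cexp z).
Proof.
apply Cder_eps. intros e He.
assert (Hz : 0 < exp (Re z)) by apply exp_pos.
assert (H3 : 0 < exp (Re z) * exp 1) by (apply Rmult_lt_0_compat; [easy|apply exp_pos]).
exists (Rmin 1 (e / (exp (Re z) * exp 1))); split.
{ apply Rmin_glb_lt; [lra|]. now apply Rdiv_lt_0_compat. }
intros w Hw.
destruct (Rmin_Rgt_l _ _ _ Hw) as [W1 W2].
replace (Cexp w) with (Cexp z * Cexp (w - z))%C by (rewrite <- Cexp_plus; f_equal; ring).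
replace (Cexp z * Cexp (w - z) - Cexp z - Cexp z * (w - z))%C
  with (Cexp z * (Cexp (w - z) - 1 - (w - z)))%C by ring.
rewrite Cmod_mult, Cmod_Cexp.
eapply Rle_trans; [apply Rmult_le_compat_l; [lra|apply Cexp_sub_1_sub]|].
set (x := Cmod (w - z)) in *. assert (H0 : 0 <= x) by apply Cmod_ge_0.
assert (H1 : exp x <= exp 1) by (left; apply exp_increasing; lra).
apply Rle_trans with (exp (Re z) * (x ^ 2 * exp 1)).
{ apply Rmult_le_compat_l; [lra|]. apply Rmult_le_compat_l; [nra|lra]. }
replace (exp (Re z) * (x ^ 2 * exp 1)) with (exp (Re z) * exp 1 * x * x) by ring.
apply Rmult_le_compat_r; [lra|].
rewrite Rmult_comm. apply Rlt_div_r in W2; [lra|easy].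
Qed.

Lemma Cder_inv (z : C) : z <> 0 -> is_Cder (fun w => / w)%C z (- / (z * z))%C.
Proof.
intros Hz. apply Cder_eps. intros e He.
assert (P : 0 < Cmod z) by now apply Cmod_gt_0.
exists (Rmin (Cmod z / 2) (e * (Cmod z) ^ 3 / 2)); split.
{ apply Rmin_glb_lt; [lra|]. apply Rdiv_lt_0_compat; [|lra].
  apply Rmult_lt_0_compat; [easy|now apply pow_lt]. }
intros w Hw.
destruct (Rmin_Rgt_l _ _ _ Hw) as [W1 W2].
assert (W3 : Cmod z / 2 <= Cmod w).
{ assert (H := Cmod_sub_ge z w). rewrite Cmod_sub_sym in H. lra. }
assert (Hw0 : w <> 0) by (intros E; rewrite E, Cmod_0 in W3; lra).
replace (/ w - / z - - / (z * z) * (w - z))%C with ((w - z) * (w - z) / (z * z * w))%C.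
2:{ field; auto. }
rewrite Cmod_div, !Cmod_mult by (repeat apply Cmult_neq_0; assumption).
set (x := Cmod (w - z)) in *. assert (H0 : 0 <= x) by apply Cmod_ge_0.
assert (Q : 0 < Cmod z * Cmod z * Cmod w) by (apply Rmult_lt_0_compat; nra).
apply Rle_div_l; [easy|].
apply Rle_trans with (e * x * (Cmod z * Cmod z * (Cmod z / 2))).
- replace (e * x * (Cmod z * Cmod z * (Cmod z / 2))) with (x * (e * Cmod z ^ 3 / 2)) by field.
  apply Rmult_le_compat_l; lra.
- apply Rmult_le_compat_l; [nra|]. apply Rmult_le_compat_l; [nra|lra].
Qed.

Lemma Cder_div (f g : C -> C) (z a b : C) :
  is_Cder f z a -> is_Cder g z b -> g z <> 0 ->
  is_Cder (fun w => f w / g w)%C z ((a - f z / g z * b) / g z)%C.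
Proof.
intros Ha Hb Hg.
replace ((a - f z / g z * b) / g z)%C with (a * / g z + f z * (- / (g z * g z) * b))%C by (field; auto).
apply (Cder_mult f (fun w => (/ g w)%C)); [exact Ha|]. apply (Cder_comp (fun w => (/ w)%C)); [now apply Cder_inv|exact Hb].
Qed.

Lemma Cder_ext_loc (f g : C -> C) (z l : C) :
  (exists d, 0 < d /\ forall w, Cmod (w - z) < d -> f w = g w) ->
  is_Cder f z l -> is_Cder g z l.
Proof.
intros [d [Hd E]] H. apply Cder_eps. intros e He.
destruct (proj1 (Cder_eps _ _ _) H e He) as [d' [Hd' H']].
exists (Rmin d d'); split; [now apply Rmin_glb_lt|]. intros w Hw.
destruct (Rmin_Rgt_l _ _ _ Hw) as [W1 W2].
rewrite <- E, <- E; auto.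
replace (z - z)%C with (RtoC 0) by ring. now rewrite Cmod_0.
Qed.

(** * Integrals along segments *)

Definition CInt (f : R -> C) (a b : R) : C :=
  RInt (V := C_R_CompleteNormedModule) f a b.

Lemma ex_CInt (f : R -> C) (a b : R) :
  a <= b -> (forall t, a <= t <= b -> Rcont f t) ->
  ex_RInt (V := C_R_CompleteNormedModule) f a b.
Proof.
intros Hab H. apply (ex_RInt_continuous (V := C_R_CompleteNormedModule)).
intros t Ht. rewrite Rmin_left, Rmax_right in Ht by lra.
apply Rcont_continuous, H, Ht.
Qed.

Lemma CInt_Chasles (f : R -> C) (a b c : R) :
  a <= b <= c -> (forall t, a <= t <= c -> Rcont f t) ->
  CInt f a c = (CInt f a b + CInt f b c)%C.
Proof.
intros Habc H. symmetry.
apply (RInt_Chasles (V := C_R_CompleteNormedModule)); apply ex_CInt; try lra;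
  intros t Ht; apply H; lra.
Qed.

Lemma CInt_FTC (F f : R -> C) (a b : R) :
  a <= b -> (forall t, a <= t <= b -> is_Cpath F t (f t)) ->
  (forall t, a <= t <= b -> Rcont f t) -> CInt f a b = (F b - F a)%C.
Proof.
intros Hab H1 H2. apply (is_RInt_unique (V := C_R_CompleteNormedModule)).
apply (is_RInt_derive (V := C_R_CompleteNormedModule) F f);
  intros t Ht; rewrite Rmin_left, Rmax_right in Ht by lra.
- apply H1, Ht.
- apply Rcont_continuous, H2, Ht.
Qed.

Lemma CInt_bound (f : R -> C) (a b M : R) :
  a <= b -> (forall t, a <= t <= b -> Rcont f t) ->
  (forall t, a <= t <= b -> Cmod (f t) <= M) -> Cmod (CInt f a b) <= M * (b - a).
Proof.
intros Hab H1 H2.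
rewrite Cmod_norm.
rewrite Rmult_comm.
apply (norm_RInt_le_const (V := C_R_CompleteNormedModule) f a b); [easy| |].
- intros t Ht. rewrite <- Cmod_norm. now apply H2.
- apply (RInt_correct (V := C_R_CompleteNormedModule)), ex_CInt; easy.
Qed.

Lemma CInt_minus (f g : R -> C) (a b : R) :
  a <= b -> (forall t, a <= t <= b -> Rcont f t) ->
  (forall t, a <= t <= b -> Rcont g t) ->
  CInt (fun t => f t - g t)%C a b = (CInt f a b - CInt g a b)%C.
Proof.
intros Hab H1 H2. apply (RInt_minus (V := C_R_CompleteNormedModule)); now apply ex_CInt.
Qed.

Lemma CInt_ext (f g : R -> C) (a b : R) :
  a <= b -> (forall t, a <= t <= b -> f t = g t) -> CInt f a b = CInt g a b.
Proof.
intros Hab H. apply (RInt_ext (V := C_R_CompleteNormedModule)).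
intros t Ht. rewrite Rmin_left, Rmax_right in Ht by lra. apply H; lra.
Qed.

Definition Cdiff (f : C -> C) (z : C) : Prop := exists l, is_Cder f z l.

Lemma Cdiff_cont (f : C -> C) (z : C) : Cdiff f z -> Ccont f z.
Proof. intros [l H]. exact (Cder_cont _ _ _ H). Qed.

(** The integral of f dz along the segment A + t V, p <= t <= q. Keeping A and V fixed while p and q
    vary makes subdivision a case of Chasles' relation. *)
Definition edge (f : C -> C) (A V : C) (p q : R) : C :=
  CInt (fun t => f (A + RtoC t * V) * V)%C p q.

Lemma Rcont_edge (f : C -> C) (A V : C) (t : R) :
  Cdiff f (A + RtoC t * V) -> Rcont (fun u => f (A + RtoC u * V) * V)%C t.
Proof.
intros [l H]. apply (Rcont_comp (fun w => f w * V)%C).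
- eapply Cder_cont, Cder_mult; [exact H|apply Cder_const].
- eapply Cpath_Rcont, Cpath_line.
Qed.

Lemma edge_Chasles (f : C -> C) (A V : C) (p m q : R) :
  p <= m <= q -> (forall t, p <= t <= q -> Cdiff f (A + RtoC t * V)) ->
  edge f A V p q = (edge f A V p m + edge f A V m q)%C.
Proof.
intros Hm H. apply CInt_Chasles; [easy|].
intros t Ht. now apply Rcont_edge, H.
Qed.

Lemma edge_primitive (f F : C -> C) (A V : C) (p q : R) :
  p <= q ->
  (forall t, p <= t <= q -> is_Cder F (A + RtoC t * V) (f (A + RtoC t * V)%C)) ->
  (forall t, p <= t <= q -> Cdiff f (A + RtoC t * V)) ->
  edge f A V p q = (F (A + RtoC q * V) - F (A + RtoC p * V))%C.
Proof.
intros Hpq H1 H2.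
apply (CInt_FTC (fun t => F (A + RtoC t * V)%C)); [easy| |].
- intros t Ht. apply Cpath_comp; [now apply H1|apply Cpath_line].
- intros t Ht. now apply Rcont_edge, H2.
Qed.

Definition quad (b0 b1 : C) (w : C) : C := (b0 * w + b1 / 2 * (w * w))%C.

Lemma Cder_quad (b0 b1 w : C) : is_Cder (quad b0 b1) w (b0 + b1 * w).
Proof.
replace (b0 + b1 * w)%C with (0 * w + b0 * 1 + (0 * (w * w) + b1 / 2 * (1 * w + w * 1)))%C.
- apply (Cder_plus (fun w => b0 * w)%C (fun w => b1 / 2 * (w * w))%C).
  + apply (Cder_mult (fun _ => b0) (fun w => w)); [apply Cder_const|apply Cder_id].
  + apply (Cder_mult (fun _ => b1 / 2)%C (fun w => w * w)%C); [apply Cder_const|].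
    apply (Cder_mult (fun w => w) (fun w => w)); apply Cder_id.
- field.
Qed.

(** The affine function has the primitive [quad], so only the deviation from it has to be
    integrated. It serves with the first-order expansion in Goursat's theorem, with a constant for
    primitives, and with 0 as a plain length bound in Cauchy's estimate. *)
Lemma edge_near_affine (f : C -> C) (A V b0 b1 : C) (p q K : R) :
  p <= q -> (forall t, p <= t <= q -> Cdiff f (A + RtoC t * V)) ->
  (forall t, p <= t <= q ->
     Cmod (f (A + RtoC t * V) - (b0 + b1 * (A + RtoC t * V)))%C <= K) ->
  Cmod (edge f A V p q - (quad b0 b1 (A + RtoC q * V) - quad b0 b1 (A + RtoC p * V)))
    <= K * Cmod V * (q - p).
Proof.
intros Hpq H1 H2.
assert (Haff : forall w, Cdiff (fun w => b0 + b1 * w)%C w).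
{ intros w; eexists. apply Cder_plus; [apply Cder_const|].
  apply Cder_mult; [apply Cder_const|apply Cder_id]. }
rewrite <- (edge_primitive (fun w => b0 + b1 * w)%C (quad b0 b1)); auto.
2:{ intros; apply Cder_quad. }
unfold edge. rewrite <- CInt_minus; auto.
- apply CInt_bound; [easy| |].
  + intros t Ht.
    destruct (H1 t Ht) as [l Hl].
    apply (Rcont_comp (fun w => f w * V - (b0 + b1 * w) * V)%C).
    * destruct (Haff (A + RtoC t * V)%C) as [l' Hl'].
      eapply Cder_cont, Cder_minus; apply Cder_mult;
        [exact Hl|apply Cder_const|exact Hl'|apply Cder_const].
    * eapply Cpath_Rcont, Cpath_line.
  + intros t Ht.
    replace (f (A + RtoC t * V) * V - (b0 + b1 * (A + RtoC t * V)) * V)%C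
      with ((f (A + RtoC t * V) - (b0 + b1 * (A + RtoC t * V))) * V)%C by ring.
    rewrite Cmod_mult. apply Rmult_le_compat_r; [apply Cmod_ge_0|auto].
- intros t Ht. now apply Rcont_edge, H1.
- intros t Ht. apply (Rcont_edge (fun w => b0 + b1 * w)%C), Haff.
Qed.

Lemma nested_intervals (a b : nat -> R) :
  (forall n, a n <= a (S n) /\ b (S n) <= b n /\ a n <= b n) ->
  exists u, forall n, a n <= u <= b n.
Proof.
intros H.
assert (Ha : forall n k, a n <= a (n + k)%nat).
{ intros n k; induction k as [|k IH]; [rewrite Nat.add_0_r; lra|].
  rewrite Nat.add_succ_r. destruct (H (n + k)%nat) as [H1 _]. lra. }
assert (Hb : forall n k, b (n + k)%nat <= b n).
{ intros n k; induction k as [|k IH]; [rewrite Nat.add_0_r; lra|].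
  rewrite Nat.add_succ_r. destruct (H (n + k)%nat) as [_ [H1 _]]. lra. }
assert (Hab : forall n m, a n <= b m).
{ intros n m. specialize (Ha n m). specialize (Hb m n).
  destruct (H (n + m)%nat) as [_ [_ H1]]. rewrite (Nat.add_comm m n) in Hb. lra. }
destruct (completeness (fun x => exists n, x = a n)) as [u [Hu1 Hu2]].
- exists (b 0%nat). intros x [n ->]. apply Hab.
- now exists (a 0%nat), 0%nat.
- exists u. intros n; split.
  + apply Hu1. now exists n.
  + apply Hu2. intros x [m ->]. apply Hab.
Qed.

(* Integral of f dz along the image of the boundary of [a, b] x [c, d] under
   (x, t) |-> z0 + x (s + t h), a map of the unit square onto the triangle with
   vertices z0, z0 + s, z0 + s + h. *)
Definition bdry (f : C -> C) (z0 s h : C) (a b c d : R) : C :=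
  (edge f (z0 + RtoC b * s) (RtoC b * h) c d
   - edge f (z0 + RtoC a * s) (RtoC a * h) c d
   - edge f z0 (s + RtoC d * h) a b + edge f z0 (s + RtoC c * h) a b)%C.

Lemma bdry_split (f : C -> C) (z0 s h : C) (a m b c n d : R) :
  (forall x t, 0 <= x <= 1 -> 0 <= t <= 1 ->
     Cdiff f (z0 + RtoC x * (s + RtoC t * h))) ->
  0 <= a <= m -> m <= b <= 1 -> 0 <= c <= n -> n <= d <= 1 ->
  bdry f z0 s h a b c d =
    (bdry f z0 s h a m c n + bdry f z0 s h m b c n
     + bdry f z0 s h a m n d + bdry f z0 s h m b n d)%C.
Proof.
intros H Ha Hb Hc Hd. unfold bdry.
assert (H' : forall x t, 0 <= x <= 1 -> 0 <= t <= 1 ->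
     Cdiff f (z0 + RtoC x * s + RtoC t * (RtoC x * h))).
{ intros x t Hx Ht.
  replace (z0 + RtoC x * s + RtoC t * (RtoC x * h))%C
    with (z0 + RtoC x * (s + RtoC t * h))%C by ring. auto. }
rewrite (edge_Chasles f (z0 + RtoC b * s) (RtoC b * h) c n d),
  (edge_Chasles f (z0 + RtoC a * s) (RtoC a * h) c n d),
  (edge_Chasles f z0 (s + RtoC d * h) a m b),
  (edge_Chasles f z0 (s + RtoC c * h) a m b); try lra.
- ring.
- intros; apply H; lra.
- intros; apply H; lra.
- intros; apply H'; lra.
- intros; apply H'; lra.
Qed.

(** The first-order expansion of f at the image of (u, v) has a primitive and contributes nothing to
    a closed contour. The remainder is at most a small multiple of l, on edges of length O(l). *)
Lemma bdry_near_point (f : C -> C) (z0 s h : C) (u v : R) :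
  (forall x t, 0 <= x <= 1 -> 0 <= t <= 1 ->
     Cdiff f (z0 + RtoC x * (s + RtoC t * h))) ->
  0 <= u <= 1 -> 0 <= v <= 1 ->
  forall e, 0 < e -> exists d, 0 < d /\ forall a c l, 0 < l < d ->
    0 <= a -> a <= u <= a + l -> a + l <= 1 ->
    0 <= c -> c <= v <= c + l -> c + l <= 1 ->
    Cmod (bdry f z0 s h a (a + l) c (c + l)) <= e * (l * l).
Proof.
intros H Hu Hv e He.
set (w0 := (z0 + RtoC u * (s + RtoC v * h))%C).
destruct (H u v Hu Hv) as [f' Hf']. fold w0 in Hf'.
set (M := Cmod s + Cmod h + 1).
assert (Hs := Cmod_ge_0 s). assert (Hh := Cmod_ge_0 h).
assert (HM : 1 <= M) by (unfold M; lra).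
(* There are four edges, each of length at most M l, with a deviation of at most e1 * (2 M l). *)
set (e1 := e / (8 * (M * M))).
assert (He1 : 0 < e1) by (apply Rdiv_lt_0_compat; nra).
destruct (proj1 (Cder_eps _ _ _) Hf' e1 He1) as [d [Hd Hd']].
exists (d / (2 * M)); split; [apply Rdiv_lt_0_compat; lra|].
intros a c l Hl Ha Hau Hal Hc Hcv Hcl.
assert (Hlt : l * (2 * M) < d) by (apply Rlt_div_r; lra).
set (b0 := (f w0 - f' * w0)%C).
assert (Hfac : forall t, 0 <= t <= 1 -> Cmod (s + RtoC t * h) <= M).
{ intros t Ht. eapply Rle_trans; [apply Cmod_triangle|].
  rewrite Cmod_mult, Cmod_R, Rabs_pos_eq by lra. unfold M.
  assert (t * Cmod h <= 1 * Cmod h) by (apply Rmult_le_compat_r; lra). lra. }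
assert (Hfac' : forall x, 0 <= x <= 1 -> Cmod (RtoC x * h) <= M).
{ intros x Hx.
  rewrite Cmod_mult, Cmod_R, Rabs_pos_eq by lra. unfold M.
  assert (x * Cmod h <= 1 * Cmod h) by (apply Rmult_le_compat_r; lra). lra. }
assert (Hnear : forall x t, a <= x <= a + l -> c <= t <= c + l ->
  Cmod (f (z0 + RtoC x * (s + RtoC t * h)) - (b0 + f' * (z0 + RtoC x * (s + RtoC t * h))))%C
    <= e1 * (2 * M * l)).
{ intros x t Hx Ht. set (w := (z0 + RtoC x * (s + RtoC t * h))%C).
  assert (Hw : Cmod (w - w0) <= 2 * M * l).
  { replace (w - w0)%C with (RtoC (x - u) * (s + RtoC t * h) + RtoC (t - v) * (RtoC u * h))%C.
    - eapply Rle_trans; [apply Cmod_triangle|].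
      rewrite (Cmod_mult (RtoC (x - u))), (Cmod_mult (RtoC (t - v))), (Cmod_R (x - u)), (Cmod_R (t - v)).
      assert (A1 : Rabs (x - u) <= l) by (apply Rabs_le; lra).
      assert (A2 : Rabs (t - v) <= l) by (apply Rabs_le; lra).
      assert (B1 := Hfac t). assert (B2 := Hfac' u).
      assert (C1 := Cmod_ge_0 (s + RtoC t * h)). assert (C2 := Cmod_ge_0 (RtoC u * h)).
      assert (D1 := Rabs_pos (x - u)). assert (D2 := Rabs_pos (t - v)).
      assert (Rabs (x - u) * Cmod (s + RtoC t * h) <= l * M) by (apply Rmult_le_compat; try lra; apply B1; lra).
      assert (Rabs (t - v) * Cmod (RtoC u * h) <= l * M) by (apply Rmult_le_compat; try lra; apply B2; lra).
      lra.
    - unfold w, w0. rewrite !RtoC_minus. ring. }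
  assert (Hw' : Cmod (w - w0) < d) by lra.
  replace (f w - (b0 + f' * w))%C with (f w - f w0 - f' * (w - w0))%C by (unfold b0; ring).
  eapply Rle_trans; [apply Hd', Hw'|]. apply Rmult_le_compat_l; lra. }
set (K := e1 * (2 * M * l)) in *.
assert (HK : 0 <= K) by (apply Rmult_le_pos; nra).
assert (Q : forall x, 0 <= x <= 1 -> a <= x <= a + l ->
  Cmod (edge f (z0 + RtoC x * s) (RtoC x * h) c (c + l)
    - (quad b0 f' (z0 + RtoC x * (s + RtoC (c + l) * h)) - quad b0 f' (z0 + RtoC x * (s + RtoC c * h)))) <= K * M * l).
{ intros x Hx Hx'.
  assert (X : forall t, (z0 + RtoC x * s + RtoC t * (RtoC x * h))%C = (z0 + RtoC x * (s + RtoC t * h))%C) by (intros; ring).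
  rewrite <- !X.
  eapply Rle_trans; [apply (edge_near_affine f _ _ b0 f' c (c + l) K)|].
  - lra.
  - intros t Ht. rewrite X. apply H; lra.
  - intros t Ht. rewrite X. apply Hnear; lra.
  - replace (c + l - c) with l by ring. apply Rmult_le_compat_r; [lra|].
    apply Rmult_le_compat_l; [lra|now apply Hfac']. }
assert (P : forall t, 0 <= t <= 1 -> c <= t <= c + l ->
  Cmod (edge f z0 (s + RtoC t * h) a (a + l)
    - (quad b0 f' (z0 + RtoC (a + l) * (s + RtoC t * h)) - quad b0 f' (z0 + RtoC a * (s + RtoC t * h)))) <= K * M * l).
{ intros t Ht Ht'.
  eapply Rle_trans; [apply (edge_near_affine f _ _ b0 f' a (a + l) K)|].
  - lra.
  - intros x Hx. apply H; lra.
  - intros x Hx. apply Hnear; lra.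
  - replace (a + l - a) with l by ring. apply Rmult_le_compat_r; [lra|].
    apply Rmult_le_compat_l; [lra|now apply Hfac]. }
assert (Q1 := Q (a + l) ltac:(lra) ltac:(lra)). assert (Q0 := Q a ltac:(lra) ltac:(lra)).
assert (P1 := P (c + l) ltac:(lra) ltac:(lra)). assert (P0 := P c ltac:(lra) ltac:(lra)).
unfold bdry.
match type of Q1 with Cmod ?x <= _ => set (q1 := x) in * end.
match type of Q0 with Cmod ?x <= _ => set (q0 := x) in * end.
match type of P1 with Cmod ?x <= _ => set (p1 := x) in * end.
match type of P0 with Cmod ?x <= _ => set (p0 := x) in * end.
(* The values of [quad] at the four corners cancel. *)
match goal with |- Cmod ?x <= _ => replace x with (q1 - q0 - p1 + p0)%C by (unfold q1, q0, p1, p0; ring) end.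
apply Rle_trans with (4 * (K * M * l)).
- eapply Rle_trans; [apply Cmod_triangle|].
  assert (T := Cmod_triangle (q1 - q0) (- p1)). assert (T' := Cmod_triangle q1 (- q0)).
  rewrite Cmod_opp in T, T'. unfold Cminus in *. lra.
- unfold K, e1. apply Req_le. field. lra.
Qed.

(** * Goursat's theorem and primitives on star-shaped sets *)

(** The four quarters add up to the whole, so one of them carries at least a quarter of its
    modulus. *)
Lemma bdry_quarter (f : C -> C) (z0 s h : C) (K a c l : R) :
  (forall x t, 0 <= x <= 1 -> 0 <= t <= 1 ->
     Cdiff f (z0 + RtoC x * (s + RtoC t * h))) ->
  0 < l -> 0 <= a -> a + l <= 1 -> 0 <= c -> c + l <= 1 ->
  K * (l * l) <= Cmod (bdry f z0 s h a (a + l) c (c + l)) ->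
  exists a' c', a <= a' <= a + l / 2 /\ c <= c' <= c + l / 2 /\
    K * (l / 2 * (l / 2)) <= Cmod (bdry f z0 s h a' (a' + l / 2) c' (c' + l / 2)).
Proof.
intros H Hl Ha Hal Hc Hcl HK.
assert (N : forall x y, K * (l / 2 * (l / 2)) <= Cmod (bdry f z0 s h x (x + l / 2) y (y + l / 2))
  \/ Cmod (bdry f z0 s h x (x + l / 2) y (y + l / 2)) < K * (l / 2 * (l / 2))).
{ intros x y. destruct (Rle_lt_dec (K * (l / 2 * (l / 2))) (Cmod (bdry f z0 s h x (x + l / 2) y (y + l / 2)))); auto. }
destruct (N a c) as [A|A]; [exists a, c; repeat split; lra|].
destruct (N (a + l / 2) c) as [B|B]; [exists (a + l / 2), c; repeat split; lra|].
destruct (N a (c + l / 2)) as [D|D]; [exists a, (c + l / 2); repeat split; lra|].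
destruct (N (a + l / 2) (c + l / 2)) as [E|E]; [exists (a + l / 2), (c + l / 2); repeat split; lra|].
exfalso.
rewrite (bdry_split f z0 s h a (a + l / 2) (a + l) c (c + l / 2) (c + l)) in HK by (auto; lra).
replace (a + l / 2 + l / 2) with (a + l) in * by field.
replace (c + l / 2 + l / 2) with (c + l) in * by field.
match type of HK with _ <= Cmod (?p + ?q + ?r + ?t) =>
  assert (T1 := Cmod_triangle (p + q + r) t); assert (T2 := Cmod_triangle (p + q) r);
  assert (T3 := Cmod_triangle p q) end.
replace (K * (l / 2 * (l / 2))) with (K * (l * l) / 4) in * by field. lra.
Qed.

(** Dependent choice; the invariant travels with the values in a sigma type. *)
Lemma dependent_sequence {A : Type} (P : nat -> A -> Prop) (Q : A -> A -> Prop) (x0 : A) :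
  P 0%nat x0 -> (forall n x, P n x -> exists y, P (S n) y /\ Q x y) ->
  exists u : nat -> A, forall n, P n (u n) /\ Q (u n) (u (S n)).
Proof.
intros H0 H.
assert (F : forall n (x : {x | P n x}), {y : {y | P (S n) y} | Q (proj1_sig x) (proj1_sig y)}).
{ intros n [x Hx]. apply constructive_indefinite_description.
  destruct (H n x Hx) as [y [Hy1 Hy2]]. now exists (exist _ y Hy1). }
exists (fun n => proj1_sig (nat_rect (fun n => {x | P n x}) (exist _ x0 H0)
  (fun n x => proj1_sig (F n x)) n)).
intros n. simpl. set (r := nat_rect _ _ _ n). split.
- exact (proj2_sig r).
- exact (proj2_sig (F n r)).
Qed.

(** The bisection takes place in the parameter square, where quarters are again squares, so no
    geometry of triangles is needed. The edge over x = 0 collapses to z0 and needs no special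
    care. *)
Lemma goursat (f : C -> C) (z0 s h : C) :
  (forall x t, 0 <= x <= 1 -> 0 <= t <= 1 ->
     Cdiff f (z0 + RtoC x * (s + RtoC t * h))) ->
  bdry f z0 s h 0 1 0 1 = RtoC 0.
Proof.
intros H. apply Cmod_eq_0.
set (K := Cmod (bdry f z0 s h 0 1 0 1)).
destruct (Rle_lt_or_eq_dec 0 K (Cmod_ge_0 _)) as [HK|HK]; [exfalso|easy].
set (l := fun n : nat => (/ 2) ^ n).
assert (Hl : forall n, 0 < l n) by (intros n; apply pow_lt; lra).
assert (HlS : forall n, l (S n) = l n / 2) by (intros n; unfold l; simpl; field).
set (P := fun n (p : R * R) => 0 <= fst p /\ fst p + l n <= 1 /\ 0 <= snd p /\ snd p + l n <= 1 /\
  K * (l n * l n) <= Cmod (bdry f z0 s h (fst p) (fst p + l n) (snd p) (snd p + l n))).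
(* The state contains the step number, since the relation between consecutive states must know the
   current side length. *)
destruct (dependent_sequence (fun n x => P (fst x) (snd x) /\ fst x = n)
  (fun x y => fst (snd x) <= fst (snd y) <= fst (snd x) + l (fst x) / 2
    /\ snd (snd x) <= snd (snd y) <= snd (snd x) + l (fst x) / 2) (0%nat, (0, 0))) as [u Hu].
- split; [|easy]. unfold P, l; simpl. rewrite Rplus_0_l, !Rmult_1_r. unfold K; repeat split; lra.
- intros n [m [a c]]; simpl. intros [[H1 [H2 [H3 [H4 H5]]]] ->]. simpl in *.
  destruct (bdry_quarter f z0 s h K a c (l n) H (Hl n) H1 H2 H3 H4 H5) as [a' [c' [A1 [A2 A3]]]].
  exists (S n, (a', c')); simpl. rewrite <- HlS in *. specialize (HlS n).
  unfold P; simpl. repeat split; try lra.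
- assert (Hu1 : forall n, fst (u n) = n) by (intros n; apply (Hu n)).
  set (a := fun n => fst (snd (u n))). set (c := fun n => snd (snd (u n))).
  assert (HP : forall n, P n (a n, c n)).
  { intros n. destruct (Hu n) as [[H1 H2] _]. rewrite H2 in H1. exact H1. }
  assert (HQ : forall n, a n <= a (S n) <= a n + l n / 2 /\ c n <= c (S n) <= c n + l n / 2).
  { intros n. destruct (Hu n) as [[_ H2] H1]. rewrite H2 in H1. exact H1. }
  destruct (nested_intervals a (fun n => a n + l n)) as [x Hx].
  { intros n. specialize (HQ n). specialize (Hl n). specialize (HlS n). lra. }
  destruct (nested_intervals c (fun n => c n + l n)) as [t Ht].
  { intros n. specialize (HQ n). specialize (Hl n). specialize (HlS n). lra. }
  assert (Hx0 : 0 <= x <= 1).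
  { destruct (HP 0%nat) as [H1 [H2 _]]; simpl in *. specialize (Hx 0%nat). lra. }
  assert (Ht0 : 0 <= t <= 1).
  { destruct (HP 0%nat) as [_ [_ [H1 [H2 _]]]]; simpl in *. specialize (Ht 0%nat). lra. }
  (* Small squares around the common point have integral at most (K / 2) l^2, against the lower
     bound K l^2 kept by the bisection. *)
  destruct (bdry_near_point f z0 s h x t H Hx0 Ht0 (K / 2)) as [d [Hd Hd']]; [lra|].
  destruct (pow_lt_1_zero (/ 2) (ltac:(rewrite Rabs_pos_eq; lra)) d Hd) as [N HN].
  specialize (HN N (Nat.le_refl N)). fold (l N) in HN. rewrite Rabs_pos_eq in HN by (left; apply Hl).
  destruct (HP N) as [H1 [H2 [H3 [H4 H5]]]]; simpl in *.
  assert (L := Hl N).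
  specialize (Hd' (a N) (c N) (l N) (conj L HN) H1 (Hx N) H2 H3 (Ht N) H4).
  assert (0 < l N * l N) by now apply Rmult_lt_0_compat.
  nra.
Qed.

Definition Copen (D : C -> Prop) : Prop :=
  forall z, D z -> exists d, 0 < d /\ forall w, Cmod (w - z) < d -> D w.

Definition star (D : C -> Prop) (z0 : C) : Prop :=
  forall z x, D z -> 0 <= x <= 1 -> D (z0 + RtoC x * (z - z0))%C.

(** The primitive is the integral along the segment from the centre. By Goursat's theorem on the
    triangle z0, z, w its increment is the integral from z to w, which is close to f z (w - z). *)
Lemma star_primitive (D : C -> Prop) (f : C -> C) (z0 : C) :
  Copen D -> star D z0 -> (forall z, D z -> Cdiff f z) ->
  exists F, forall z, D z -> is_Cder F z (f z).
Proof.
intros HO HS Hf.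
exists (fun z => edge f z0 (z - z0) 0 1).
intros z Hz. apply Cder_eps. intros e He.
destruct (HO z Hz) as [d1 [Hd1 Hd1']].
destruct (Cdiff_cont _ _ (Hf z Hz) e He) as [d2 [Hd2 Hd2']].
exists (Rmin d1 d2); split; [now apply Rmin_glb_lt|]. intros w Hw.
destruct (Rmin_Rgt_l _ _ _ Hw) as [W1 W2].
set (s := (z - z0)%C). set (h := (w - z)%C).
assert (Hseg : forall t, 0 <= t <= 1 -> Cmod (z + RtoC t * h - z) <= Cmod h).
{ intros t Ht. replace (z + RtoC t * h - z)%C with (RtoC t * h)%C by ring.
  rewrite Cmod_mult, Cmod_R, Rabs_pos_eq by lra.
  assert (A := Cmod_ge_0 h). nra. }
assert (HD : forall t, 0 <= t <= 1 -> D (z + RtoC t * h)%C).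
{ intros t Ht. apply Hd1'. eapply Rle_lt_trans; [now apply Hseg|exact W1]. }
assert (G : bdry f z0 s h 0 1 0 1 = RtoC 0).
{ apply goursat. intros x t Hx Ht. apply Hf.
  replace (z0 + RtoC x * (s + RtoC t * h))%C with (z0 + RtoC x * (z + RtoC t * h - z0))%C by (unfold s; ring).
  apply HS; auto. }
(* The side of the square over x = 0 is mapped to the single point z0. *)
assert (E0 : edge f (z0 + 0 * s) (0 * h) 0 1 = RtoC 0).
{ unfold edge. rewrite (CInt_ext _ (fun _ => RtoC 0)); [|lra|intros; ring].
  rewrite (CInt_FTC (fun _ => RtoC 0)); [ring|lra| |].
  - intros t _. apply Cpath_eps. intros; exists 1; split; [lra|]. intros.
    replace (0 - 0 - RtoC (u - t) * 0)%C with (RtoC 0) by ring. rewrite Cmod_0.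
    apply Rmult_le_pos; [lra|apply Rabs_pos].
  - intros t _ e' He'. exists 1; split; [lra|]. intros.
    replace (0 - 0)%C with (RtoC 0) by ring. now rewrite Cmod_0. }
unfold bdry in G. rewrite E0, Cmult_0_l, !Cmult_1_l, Cplus_0_r in G.
replace (z0 + s)%C with z in G by (unfold s; ring).
replace (w - z0)%C with (s + h)%C by (unfold s, h; ring).
replace (edge f z0 (s + h) 0 1 - edge f z0 s 0 1 - f z * h)%C
  with (edge f z h 0 1 - f z * h)%C.
2:{ replace (edge f z h 0 1) with (edge f z h 0 1 - (edge f z h 0 1 - 0 - edge f z0 (s + h) 0 1 + edge f z0 s 0 1))%C.
    ring. rewrite G. ring. }
assert (A := edge_near_affine f z h (f z) 0 0 1 e).
unfold quad in A.
replace (edge f z h 0 1 - f z * h)%C with (edge f z h 0 1 -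
    (f z * (z + 1 * h) + 0 / 2 * ((z + 1 * h) * (z + 1 * h)) -
     (f z * (z + 0 * h) + 0 / 2 * ((z + 0 * h) * (z + 0 * h)))))%C by field.
replace (e * Cmod h) with (e * Cmod h * (1 - 0)) by ring.
apply A; [lra| |].
- intros t Ht. apply Hf, HD, Ht.
- intros t Ht. replace (f (z + RtoC t * h) - (f z + 0 * (z + RtoC t * h)))%C with (f (z + RtoC t * h) - f z)%C by ring.
  left. apply Hd2'. eapply Rle_lt_trans; [now apply Hseg|exact W2].
Qed.

(** * Cauchy's estimate *)

Lemma Cder_shift (f : C -> C) (z h l : C) :
  is_Cder f (z + h) l -> is_Cder (fun w => f (w + h)%C) z l.
Proof.
intros H. replace l with (l * (1 + 0))%C by ring.
apply (Cder_comp f (fun w => w + h)%C); [exact H|].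
apply Cder_plus; [apply Cder_id|apply Cder_const].
Qed.

Lemma Cder_opp (f : C -> C) (z l : C) : is_Cder f z l -> is_Cder (fun w => - f w)%C z (- l).
Proof. apply (is_derive_opp (K := C_AbsRing) (V := C_NormedModule)). Qed.

(** With w = b + e^z the form f(w) / (w - b)^2 dw becomes f(b + e^z) e^(-z) dz, and a circle around
    b becomes a vertical segment of length 2 pi. *)
Lemma Cdiff_polar_kernel (f : C -> C) (b z : C) :
  Cdiff f (b + Cexp z) -> Cdiff (fun w => f (b + Cexp w) * Cexp (- w))%C z.
Proof.
intros [l H]. eexists. apply (Cder_mult (fun w => f (b + Cexp w))%C (fun w => Cexp (- w))).
- apply (Cder_comp f (fun w => b + Cexp w)%C); [exact H|].
  apply Cder_plus; [apply Cder_const|apply Cder_Cexp].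
- apply (Cder_comp Cexp (fun w => - w)%C); [apply Cder_Cexp|].
  apply Cder_opp, Cder_id.
Qed.

Lemma Cexp_2PI (z : C) : Cexp (z + RtoC (2 * PI) * Ci) = Cexp z.
Proof.
destruct z as [x y]. unfold Cexp, polar, RtoC, Ci, Cmult, Cplus, Re, Im; simpl.
replace (y + (2 * PI * 1 + 0 * 0)) with (y + 2 * PI) by ring.
rewrite cos_plus, sin_plus, cos_2PI, sin_2PI.
replace (x + (2 * PI * 0 - 0 * 1)) with x by ring. f_equal; ring.
Qed.

Lemma Re_plus_I (x t : R) : Re (RtoC x + RtoC t * Ci) = x.
Proof. unfold RtoC, Ci, Cmult, Cplus, Re; simpl; ring. Qed.

Lemma half_plane_open (a : R) : Copen (fun z => Re z < a).
Proof.
intros z Hz. exists (a - Re z). split; [lra|]. intros w Hw.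
assert (H := re_le_Cmod (w - z)). assert (H' := Rle_abs (Re (w - z))).
change (Re (w - z)) with (Re w - Re z) in *. lra.
Qed.

Lemma half_plane_star (a : R) (z0 : C) : Re z0 < a -> star (fun z => Re z < a) z0.
Proof.
intros H0 z x Hz Hx.
replace (Re (z0 + RtoC x * (z - z0))) with (x * Re z + (1 - x) * Re z0)
  by (unfold RtoC, Cmult, Cplus, Cminus, Copp, Re; simpl; ring).
destruct (Req_dec x 0) as [->|Hx0]; [lra|].
assert (0 < x * (a - Re z)) by (apply Rmult_lt_0_compat; lra).
assert (0 <= (1 - x) * (a - Re z0)) by (apply Rmult_le_pos; lra).
lra.
Qed.

(* In the coordinate w = b + e^z the kernel has period 2 pi i, so the increment of
   a primitive over a period does not depend on Re z; let Re z tend to -infinity. *)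
Lemma cauchy_derivative (f : C -> C) (b l : C) (r R : R) :
  (forall w, Cmod (w - b) < R -> Cdiff f w) -> 0 < r < R -> is_Cder f b l ->
  edge (fun z => f (b + Cexp z) * Cexp (- z))%C (RtoC (ln r)) Ci 0 (2 * PI)
    = (RtoC (2 * PI) * Ci * l)%C.
Proof.
intros Hf Hr Hl.
set (phi := (fun z => f (b + Cexp z) * Cexp (- z))%C).
assert (HPI := PI_RGT_0).
assert (Hphi : forall z, Re z < ln R -> Cdiff phi z).
{ intros z Hz. apply Cdiff_polar_kernel, Hf.
  replace (b + Cexp z - b)%C with (Cexp z) by ring.
  rewrite Cmod_Cexp, <- (exp_ln R) by lra. now apply exp_increasing. }
assert (Hln : ln r < ln R) by (apply ln_increasing; lra).
destruct (star_primitive _ phi (RtoC (ln r)) (half_plane_open (ln R))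
  (half_plane_star (ln R) (RtoC (ln r)) Hln) Hphi) as [Psi HPsi].
assert (Hedge : forall x, x < ln R -> edge phi (RtoC x) Ci 0 (2 * PI)
   = (Psi (RtoC x + RtoC (2 * PI) * Ci) - Psi (RtoC x))%C).
{ intros x Hx. rewrite (edge_primitive phi Psi); [|lra| |].
  - rewrite Cmult_0_l, Cplus_0_r. reflexivity.
  - intros t _. apply HPsi. now rewrite Re_plus_I.
  - intros t _. apply Hphi. now rewrite Re_plus_I. }
assert (Hconst : forall x, x <= ln r -> edge phi (RtoC x) Ci 0 (2 * PI) = edge phi (RtoC (ln r)) Ci 0 (2 * PI)).
{ intros x Hx. rewrite !Hedge by lra.
  (* D is the increment of the primitive over one period; its derivative is a difference of two
     equal values of [phi]. *)
  set (D := fun y => (Psi (RtoC (2 * PI) * Ci + (0 + RtoC y * 1)) - Psi (0 + RtoC y * 1))%C).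
  assert (E : Cmod (D (ln r) - D x) <= 0 - 0).
  { apply (path_dominated D (fun _ => RtoC 0) (fun _ => 0) (fun _ => 0)); [easy|].
    intros t Ht. split; [|split].
    - replace (RtoC 0) with ((phi (RtoC (2 * PI) * Ci + (0 + RtoC t * 1)) - phi (0 + RtoC t * 1)) * 1)%C.
      2:{ unfold phi. replace (RtoC (2 * PI) * Ci + (0 + RtoC t * 1))%C with (0 + RtoC t * 1 + RtoC (2 * PI) * Ci)%C by ring.
          rewrite Cexp_opp, Cexp_2PI, <- Cexp_opp. ring. }
      apply (Cpath_comp (fun w => Psi (RtoC (2 * PI) * Ci + w) - Psi w)%C (fun u => 0 + RtoC u * 1)%C).
      2:{ apply Cpath_line. }
      apply Cder_minus.
      + replace (phi (RtoC (2 * PI) * Ci + (0 + RtoC t * 1))%C)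
          with (phi (0 + RtoC t * 1 + RtoC (2 * PI) * Ci)%C) by (f_equal; ring).
        apply Cder_ext_loc with (f := fun w => Psi (w + RtoC (2 * PI) * Ci)%C).
        { exists 1; split; [lra|]; intros; f_equal; ring. }
        apply Cder_shift, HPsi.
        replace (0 + RtoC t * 1 + RtoC (2 * PI) * Ci)%C with (RtoC t + RtoC (2 * PI) * Ci)%C by ring.
        rewrite Re_plus_I. lra.
      + apply HPsi. replace (0 + RtoC t * 1)%C with (RtoC t + RtoC 0 * Ci)%C by ring.
        rewrite Re_plus_I. lra.
    - apply (is_derive_const (V := R_NormedModule)).
    - rewrite Cmod_0; lra. }
  assert (E' : D (ln r) = D x).
  { assert (E0 := Cmod_ge_0 (D (ln r) - D x)).
    assert (E1 : (D (ln r) - D x)%C = 0) by (apply Cmod_eq_0; lra).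
    replace (D (ln r)) with (D (ln r) - D x + D x)%C by ring. rewrite E1. ring. }
  assert (DE : forall y, (Psi (RtoC y + RtoC (2 * PI) * Ci) - Psi (RtoC y))%C = D y).
  { intros y. unfold D. f_equal; [f_equal|f_equal; f_equal]; ring. }
  now rewrite !DE. }
set (T := edge phi (RtoC (ln r)) Ci 0 (2 * PI)) in *.
set (S := (RtoC (2 * PI) * Ci * l)%C).
assert (B : forall e, 0 < e -> Cmod (T - S) <= e * (2 * PI)).
{ intros e He.
  destruct (proj1 (Cder_eps _ _ _) Hl e He) as [d [Hd Hd']].
  set (x := Rmin (ln r) (ln (d / 2))).
  assert (Hx1 : x <= ln r) by apply Rmin_l.
  assert (Hx2 : exp x < d).
  { apply Rle_lt_trans with (d / 2); [|lra]. rewrite <- (exp_ln (d / 2)) by lra.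
    destruct (Rmin_r (ln r) (ln (d / 2))) as [H|H]; fold x in H;
      [left; now apply exp_increasing|right; now rewrite H]. }
  rewrite <- (Hconst x Hx1).
  (* This is the kernel with f replaced by its first-order expansion at b. The integral over a
     period is exactly S, as e^(-z) is periodic, and on a small circle the error e * exp x is
     divided by exp x. *)
  set (psi := (fun z => f b * Cexp (- z) + l)%C).
  assert (Hpsi : forall z, Cdiff psi z).
  { intros z. eexists. apply Cder_plus; [|apply Cder_const].
    apply Cder_mult; [apply Cder_const|].
    apply (Cder_comp Cexp (fun w => - w)%C); [apply Cder_Cexp|apply Cder_opp, Cder_id]. }
  assert (HS : edge psi (RtoC x) Ci 0 (2 * PI) = S).
  { rewrite (edge_primitive psi (fun z => - f b * Cexp (- z) + l * z)%C); [|lra| |].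
    - rewrite Cmult_0_l, Cplus_0_r, !Cexp_opp, Cexp_2PI. unfold S. ring.
    - intros t _. unfold psi.
      set (z := (RtoC x + RtoC t * Ci)%C).
      replace (f b * Cexp (- z) + l)%C with (0 * Cexp (- z) + - f b * (Cexp (- z) * - (1)) + (0 * z + l * 1))%C by ring.
      apply (Cder_plus (fun z => - f b * Cexp (- z))%C (fun z => l * z)%C).
      + apply (Cder_mult (fun _ => - f b)%C (fun z => Cexp (- z))); [apply Cder_const|].
        apply (Cder_comp Cexp (fun w => - w)%C); [apply Cder_Cexp|apply Cder_opp, Cder_id].
      + apply (Cder_mult (fun _ => l) (fun z => z)); [apply Cder_const|apply Cder_id].
    - intros; apply Hpsi. }
  rewrite <- HS. unfold edge.
  rewrite <- CInt_minus; [|lra| |].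
  2:{ intros t _. apply Rcont_edge, Hphi. rewrite Re_plus_I; lra. }
  2:{ intros t _. apply (Rcont_edge psi), Hpsi. }
  replace (e * (2 * PI)) with (e * (2 * PI - 0)) by ring.
  apply CInt_bound; [lra| |].
  - intros t _. 
    destruct (Hphi (RtoC x + RtoC t * Ci)%C) as [k1 Hk1]; [rewrite Re_plus_I; lra|].
    destruct (Hpsi (RtoC x + RtoC t * Ci)%C) as [k2 Hk2].
    apply (Rcont_comp (fun w => phi w * Ci - psi w * Ci)%C (fun u => RtoC x + RtoC u * Ci)%C).
    + eapply Cder_cont, Cder_minus; apply Cder_mult; [exact Hk1|apply Cder_const|exact Hk2|apply Cder_const].
    + eapply Cpath_Rcont, Cpath_line.
  - intros t _. set (z := (RtoC x + RtoC t * Ci)%C).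
    assert (Hz : Cmod (Cexp z) = exp x) by (rewrite Cmod_Cexp; unfold z; now rewrite Re_plus_I).
    assert (H := Hd' (b + Cexp z)%C).
    replace (b + Cexp z - b)%C with (Cexp z) in H by ring. rewrite Hz in H. specialize (H Hx2).
    replace (phi z * Ci - psi z * Ci)%C with ((f (b + Cexp z) - f b - l * Cexp z) * Cexp (- z) * Ci)%C.
    + rewrite !Cmod_mult, Cmod_Ci, Rmult_1_r, Cexp_opp, Cmod_inv by apply Cexp_neq_0. rewrite Hz.
      apply Rle_div_l; [apply Rlt_gt, exp_pos|exact H].
    + unfold phi, psi. rewrite Cexp_opp. field. apply Cexp_neq_0. }
assert (E : Cmod (T - S) = 0).
{ destruct (Rle_lt_or_eq_dec 0 _ (Cmod_ge_0 (T - S))) as [H|H]; [|now symmetry].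
  assert (P : 0 < Cmod (T - S) / (4 * PI)) by (apply Rdiv_lt_0_compat; lra).
  specialize (B _ P).
  replace (Cmod (T - S) / (4 * PI) * (2 * PI)) with (Cmod (T - S) / 2) in B by (field; lra). lra. }
apply Cmod_eq_0 in E. replace T with (T - S + S)%C by ring. rewrite E. ring.
Qed.

(** Subtracting the constant a does not change the derivative, so only the deviation of f from a on
    the circle counts. That is how closeness to a real value will give smallness of the
    derivative. *)
Lemma cauchy_estimate (f : C -> C) (b l a : C) (r R M : R) :
  (forall w, Cmod (w - b) < R -> Cdiff f w) -> 0 < r < R -> is_Cder f b l ->
  (forall w, Cmod (w - b) = r -> Cmod (f w - a) <= M) -> Cmod l <= M / r.
Proof.
intros Hf Hr Hl HM. assert (HPI := PI_RGT_0).
set (g := fun w => (f w - a)%C).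
assert (Hg : forall w, Cmod (w - b) < R -> Cdiff g w).
{ intros w Hw. destruct (Hf w Hw) as [k Hk]. eexists. apply Cder_minus; [exact Hk|apply Cder_const]. }
assert (Hgl : is_Cder g b l).
{ replace l with (l - 0)%C by ring. apply Cder_minus; [exact Hl|apply Cder_const]. }
assert (E := cauchy_derivative g b l r R Hg Hr Hgl).
assert (B := edge_near_affine (fun z => g (b + Cexp z) * Cexp (- z))%C (RtoC (ln r)) Ci 0 0 0 (2 * PI) (M / r)).
assert (Hmod : forall t, Cmod (Cexp (RtoC (ln r) + RtoC t * Ci)) = r).
{ intros t. rewrite Cmod_Cexp, Re_plus_I. apply exp_ln; lra. }
rewrite E in B. unfold quad in B.
replace (RtoC (2 * PI) * Ci * l - (0 * (RtoC (ln r) + RtoC (2 * PI) * Ci) +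
           0 / 2 * ((RtoC (ln r) + RtoC (2 * PI) * Ci) * (RtoC (ln r) + RtoC (2 * PI) * Ci)) -
           (0 * (RtoC (ln r) + 0 * Ci) + 0 / 2 * ((RtoC (ln r) + 0 * Ci) * (RtoC (ln r) + 0 * Ci)))))%C
  with (RtoC (2 * PI) * Ci * l)%C in B by field.
rewrite !Cmod_mult, Cmod_Ci, Cmod_R, Rabs_pos_eq, !Rmult_1_r, Rminus_0_r in B by lra.
apply Rmult_le_reg_l with (2 * PI); [lra|]. rewrite (Rmult_comm _ (M / r)). apply B; [lra| |].
- intros t Ht. apply Cdiff_polar_kernel, Hg.
  replace (b + Cexp (RtoC (ln r) + RtoC t * Ci) - b)%C with (Cexp (RtoC (ln r) + RtoC t * Ci)) by ring.
  rewrite Hmod; lra.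
- intros t Ht. set (z := (RtoC (ln r) + RtoC t * Ci)%C).
  replace (g (b + Cexp z) * Cexp (- z) - (0 + 0 * z))%C with (g (b + Cexp z)%C * Cexp (- z))%C by ring.
  rewrite Cmod_mult, Cexp_opp, Cmod_inv by apply Cexp_neq_0. unfold z; rewrite Hmod.
  apply Rmult_le_compat_r; [left; apply Rinv_0_lt_compat; lra|].
  apply HM. fold z. replace (b + Cexp z - b)%C with (Cexp z) by ring. apply Hmod.
Qed.

(** * Mean value bounds and differentiability of the derivative *)

Lemma Cder_segment (f f1 : C -> C) (z h c : C) (M : R) :
  (forall t, 0 <= t <= 1 -> is_Cder f (z + RtoC t * h) (f1 (z + RtoC t * h)%C)) ->
  (forall t, 0 <= t <= 1 -> Cmod (f1 (z + RtoC t * h) - c)%C <= M) ->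
  Cmod (f (z + h) - f z - c * h)%C <= M * Cmod h.
Proof.
intros H1 H2.
assert (H := path_dominated (fun t => f (z + RtoC t * h) - c * (z + RtoC t * h))%C
  (fun t => (f1 (z + RtoC t * h) - c) * h)%C (fun t => t * (M * Cmod h)) (fun _ => M * Cmod h) 0 1).
replace (f (z + h) - f z - c * h)%C with (f (z + 1 * h) - c * (z + 1 * h) - (f (z + 0 * h) - c * (z + 0 * h)))%C.
2:{ replace (z + 1 * h)%C with (z + h)%C by ring. replace (z + 0 * h)%C with z by ring. ring. }
replace (M * Cmod h) with (1 * (M * Cmod h) - 0 * (M * Cmod h)) by ring.
apply H; [lra|]. intros t Ht. split; [|split].
- apply (Cpath_comp (fun w => f w - c * w)%C (fun t => z + RtoC t * h)%C); [|apply Cpath_line].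
  apply Cder_minus; [now apply H1|].
  replace c with (0 * (z + RtoC t * h) + c * 1)%C at 2 by ring.
  apply (Cder_mult (fun _ => c) (fun w => w)); [apply Cder_const|apply Cder_id].
- auto_derive; [easy|ring].
- rewrite Cmod_mult. apply Rmult_le_compat_r; [apply Cmod_ge_0|now apply H2].
Qed.

Lemma Rcont_mult (f g : R -> C) (t : R) :
  Rcont f t -> Rcont g t -> Rcont (fun u => f u * g u)%C t.
Proof.
intros Hf Hg e He.
set (F := Cmod (f t)). set (G := Cmod (g t)).
assert (HF : 0 <= F) by apply Cmod_ge_0. assert (HG : 0 <= G) by apply Cmod_ge_0.
set (k := e / (2 * (1 + F + G))).
assert (Hk : 0 < k) by (apply Rdiv_lt_0_compat; lra).
destruct (Hf (Rmin 1 k)) as [d1 [Hd1 H1]]; [now apply Rmin_glb_lt; [lra|]|].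
destruct (Hg k Hk) as [d2 [Hd2 H2]].
exists (Rmin d1 d2); split; [now apply Rmin_glb_lt|]. intros u Hu.
specialize (H1 u (Rlt_le_trans _ _ _ Hu (Rmin_l _ _))).
specialize (H2 u (Rlt_le_trans _ _ _ Hu (Rmin_r _ _))).
assert (A1 := Rlt_le_trans _ _ _ H1 (Rmin_l _ _)).
assert (A2 := Rlt_le_trans _ _ _ H1 (Rmin_r _ _)).
replace (f u * g u - f t * g t)%C with ((f u - f t) * (g u - g t) + (f u - f t) * g t + f t * (g u - g t))%C by ring.
eapply Rle_lt_trans; [eapply Rle_trans; [apply Cmod_triangle|]; apply Rplus_le_compat_r, Cmod_triangle|].
rewrite !Cmod_mult. fold F G.
set (x := Cmod (f u - f t)) in *. set (y := Cmod (g u - g t)) in *.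
assert (0 <= x) by apply Cmod_ge_0. assert (0 <= y) by apply Cmod_ge_0.
assert (x * y <= 1 * k) by (apply Rmult_le_compat; lra).
assert (x * G <= k * G) by (apply Rmult_le_compat_r; lra).
assert (F * y <= F * k) by (apply Rmult_le_compat_l; lra).
assert (E : k * (1 + F + G) = e / 2) by (unfold k; field; lra).
lra.
Qed.

(** The integral is that of a real vector space, so a complex factor has to be moved through the two
    components. *)
Lemma CInt_mult_r (G : R -> C) (h : C) (a b : R) :
  a <= b -> (forall t, a <= t <= b -> Rcont G t) ->
  (CInt G a b * h)%C = CInt (fun t => G t * h)%C a b.
Proof.
intros Hab HG. symmetry.
apply (is_RInt_unique (V := C_R_CompleteNormedModule)).
assert (I := RInt_correct (V := C_R_CompleteNormedModule) _ _ _ (ex_CInt G a b Hab HG)).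
fold (CInt G a b) in I. set (J := CInt G a b) in *.
destruct h as [h1 h2].
assert (I1 := is_RInt_fct_extend_fst (U := R_NormedModule) (V := R_NormedModule) G a b J I).
assert (I2 := is_RInt_fct_extend_snd (U := R_NormedModule) (V := R_NormedModule) G a b J I).
apply (is_RInt_fct_extend_pair (U := R_NormedModule) (V := R_NormedModule) (fun t => G t * (h1, h2))%C).
- assert (K := is_RInt_minus (V := R_NormedModule) _ _ a b _ _
    (is_RInt_scal (V := R_NormedModule) _ a b h1 _ I1) (is_RInt_scal (V := R_NormedModule) _ a b h2 _ I2)).
  match goal with |- is_RInt _ _ _ ?v => replace v with (minus (scal h1 (fst J)) (scal h2 (snd J))) end.
  2:{ unfold minus, plus, opp, scal; simpl; unfold mult; simpl; ring. }
  refine (is_RInt_ext (V := R_NormedModule) _ _ a b _ _ K).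
  intros t _. unfold Cmult, minus, plus, opp, scal; simpl; unfold mult; simpl; ring.
- assert (K := is_RInt_plus (V := R_NormedModule) _ _ a b _ _
    (is_RInt_scal (V := R_NormedModule) _ a b h2 _ I1) (is_RInt_scal (V := R_NormedModule) _ a b h1 _ I2)).
  match goal with |- is_RInt _ _ _ ?v => replace v with (plus (scal h2 (fst J)) (scal h1 (snd J))) end.
  2:{ unfold minus, plus, opp, scal; simpl; unfold mult; simpl; ring. }
  refine (is_RInt_ext (V := R_NormedModule) _ _ a b _ _ K).
  intros t _. unfold Cmult, minus, plus, opp, scal; simpl; unfold mult; simpl; ring.
Qed.

(* Cauchy's estimate for f(. + h) - f shows that f1 is locally Lipschitz; then
   Cauchy's formula can be differentiated under the integral sign. *)
Lemma Cdiff_derivative (D : C -> Prop) (f f1 : C -> C) :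
  Copen D -> (forall z, D z -> is_Cder f z (f1 z)) -> forall a, D a -> Cdiff f1 a.
Proof.
intros HO Hf a Ha. assert (HPI := PI_RGT_0).
destruct (HO a Ha) as [R1 [HR1 HD]].
destruct (Cder_cont _ _ _ (Hf a Ha) 1) as [R2 [HR2 Hb]]; [lra|].
set (R := Rmin R1 R2). assert (HR : 0 < R) by now apply Rmin_glb_lt.
assert (HfR : forall w, Cmod (w - a) < R -> is_Cder f w (f1 w)).
{ intros w Hw. apply Hf, HD. eapply Rlt_le_trans; [exact Hw|apply Rmin_l]. }
assert (HbR : forall w, Cmod (w - a) < R -> Cmod (f w - f a) <= 1).
{ intros w Hw. left. apply Hb. eapply Rlt_le_trans; [exact Hw|apply Rmin_r]. }
clearbody R. clear R1 HR1 R2 HR2 HD Hb.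
(* The deviation |f - f a| <= 1 on the disc of radius R and circles of radius R / 4 give this
   bound. *)
assert (B1 : forall w, Cmod (w - a) < R / 2 -> Cmod (f1 w) <= 4 / R).
{ intros w Hw. replace (4 / R) with (1 / (R / 4)) by (field; lra).
  apply (cauchy_estimate f w (f1 w) (f a) (R / 4) (R / 2)).
  - intros v Hv. eexists. apply HfR. eapply Rle_lt_trans; [apply (Cmod_triangle3 v w a)|lra].
  - lra.
  - apply HfR; lra.
  - intros v Hv. apply HbR. eapply Rle_lt_trans; [apply (Cmod_triangle3 v w a)|lra]. }
assert (Hseg : forall v h t, 0 <= t <= 1 -> Cmod (v + RtoC t * h - v) <= Cmod h).
{ intros v h t Ht. replace (v + RtoC t * h - v)%C with (RtoC t * h)%C by ring.
  rewrite Cmod_mult, Cmod_R, Rabs_pos_eq by lra. assert (A := Cmod_ge_0 h). nra. }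
(* By [B1], |f(u + h) - f(u)| <= 4 |h| / R, and Cauchy's estimate on circles of radius R / 8 gives
   the constant (4 / R) / (R / 8). *)
set (Lc := 32 / (R * R)).
assert (HLc : 0 < Lc) by (apply Rdiv_lt_0_compat; nra).
assert (B2 : forall v h, Cmod (v - a) < R / 4 -> Cmod h < R / 8 -> Cmod (f1 (v + h) - f1 v)%C <= Lc * Cmod h).
{ intros v h Hv Hh.
  replace (Lc * Cmod h) with (4 / R * Cmod h / (R / 8)) by (unfold Lc; field; lra).
  assert (K : forall w, Cmod (w - v) <= R / 8 -> is_Cder (fun u => f (u + h) - f u)%C w (f1 (w + h) - f1 w)%C).
  { intros w Hw. apply Cder_minus; [apply Cder_shift|]; apply HfR.
    - replace (w + h - a)%C with (w - v + h + (v - a))%C by ring.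
      eapply Rle_lt_trans; [apply Cmod_triangle|].
      assert (T := Cmod_triangle (w - v) h). lra.
    - eapply Rle_lt_trans; [apply (Cmod_triangle3 w v a)|lra]. }
  assert (K' : exists r', R / 8 < r' /\ forall w, Cmod (w - v) < r' -> Cdiff (fun u => f (u + h) - f u)%C w).
  { exists (R / 4); split; [lra|]. intros w Hw. eexists. apply Cder_minus; [apply Cder_shift|]; apply HfR.
    - replace (w + h - a)%C with (w - v + h + (v - a))%C by ring.
      eapply Rle_lt_trans; [apply Cmod_triangle|].
      assert (T := Cmod_triangle (w - v) h). lra.
    - eapply Rle_lt_trans; [apply (Cmod_triangle3 w v a)|lra]. }
  destruct K' as [r' [Hr' K']].
  apply (cauchy_estimate (fun u => f (u + h) - f u)%C v (f1 (v + h) - f1 v)%C 0 (R / 8) r'); [exact K'|lra| |].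
  - apply K. replace (v - v)%C with (RtoC 0) by ring. rewrite Cmod_0; lra.
  - intros w Hw. replace (f (w + h) - f w - 0)%C with (f (w + h) - f w - 0 * h)%C by ring.
    apply (Cder_segment f f1).
    + intros t Ht. apply HfR.
      replace (w + RtoC t * h - a)%C with (w + RtoC t * h - w + (w - v) + (v - a))%C by ring.
      eapply Rle_lt_trans; [apply Cmod_triangle|].
      assert (T := Cmod_triangle (w + RtoC t * h - w) (w - v)). assert (T' := Hseg w h t Ht). lra.
    + intros t Ht. replace (f1 (w + RtoC t * h) - 0)%C with (f1 (w + RtoC t * h)%C) by ring.
      apply B1.
      replace (w + RtoC t * h - a)%C with (w + RtoC t * h - w + (w - v) + (v - a))%C by ring.
      eapply Rle_lt_trans; [apply Cmod_triangle|].
      assert (T := Cmod_triangle (w + RtoC t * h - w) (w - v)). assert (T' := Hseg w h t Ht). lra. }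
(* The constant is the same for all v, which is what differentiation under the integral sign
   requires. *)
assert (B3 : forall v h, Cmod (v - a) < R / 4 -> Cmod h < R / 8 ->
  Cmod (f (v + h) - f v - f1 v * h)%C <= Lc * Cmod h * Cmod h).
{ intros v h Hv Hh. assert (P := Cmod_ge_0 h). apply (Cder_segment f f1).
  - intros t Ht. apply HfR. eapply Rle_lt_trans; [apply (Cmod_triangle3 _ v a)|].
    specialize (Hseg v h t Ht). lra.
  - intros t Ht.
    assert (E : Cmod (RtoC t * h) <= Cmod h).
    { rewrite Cmod_mult, Cmod_R, Rabs_pos_eq by lra. nra. }
    eapply Rle_trans; [apply B2; lra|]. apply Rmult_le_compat_l; lra. }
set (r := R / 16). assert (Hr : 0 < r) by (unfold r; lra).
set (E := fun t => Cexp (RtoC (ln r) + RtoC t * Ci)).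
assert (HE : forall t, Cmod (E t) = r).
{ intros t. unfold E. rewrite Cmod_Cexp, Re_plus_I. apply exp_ln; lra. }
set (k := fun t => (Cexp (- (RtoC (ln r) + RtoC t * Ci)) * Ci)%C).
assert (Hk : forall t, Cmod (k t) = / r).
{ intros t. unfold k. rewrite Cmod_mult, Cmod_Ci, Rmult_1_r, Cexp_opp, Cmod_inv by apply Cexp_neq_0.
  fold (E t). now rewrite HE. }
assert (Hcontf1 : forall v, Cmod (v - a) < R / 4 -> Ccont f1 v).
{ intros v Hv e He. exists (Rmin (R / 8) (e / Lc)); split.
  - apply Rmin_glb_lt; [lra|now apply Rdiv_lt_0_compat].
  - intros w Hw.
    destruct (Rmin_Rgt_l _ _ _ Hw) as [W1 W2].
    replace w with (v + (w - v))%C at 1 by ring.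
    eapply Rle_lt_trans; [apply B2; lra|]. apply Rlt_div_r in W2; lra. }
assert (Hline : forall t, Rcont (fun u => RtoC (ln r) + RtoC u * Ci)%C t).
{ intros t. eapply Cpath_Rcont, Cpath_line. }
assert (HEc : forall c t, Rcont (fun u => c + E u)%C t).
{ intros c t. apply (Rcont_comp (fun z => c + Cexp z)%C (fun u => RtoC (ln r) + RtoC u * Ci)%C); [|apply Hline].
  eapply Cder_cont, Cder_plus; [apply Cder_const|apply Cder_Cexp]. }
assert (Hkc : forall t, Rcont k t).
{ intros t. apply (Rcont_comp (fun z => Cexp (- z) * Ci)%C (fun u => RtoC (ln r) + RtoC u * Ci)%C); [|apply Hline].
  eapply Cder_cont, Cder_mult; [|apply Cder_const].
  apply (Cder_comp Cexp (fun w => - w)%C); [apply Cder_Cexp|apply Cder_opp, Cder_id]. }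
assert (HEa : forall t, Cmod (a + E t - a) < R / 4).
{ intros t. replace (a + E t - a)%C with (E t) by ring. rewrite HE. unfold r; lra. }
(* Cauchy's formula on a circle that moves with b: the kernel [k] does not depend on b, so only f is
   differentiated. *)
set (J0 := fun b => CInt (fun t => f (b + E t) * k t)%C 0 (2 * PI)).
assert (HJ0 : forall b, Cmod (b - a) < R / 8 -> J0 b = (RtoC (2 * PI) * Ci * f1 b)%C).
{ intros b Hb. rewrite <- (cauchy_derivative f b (f1 b) r (R / 8)).
  - unfold J0, edge. apply CInt_ext; [lra|]. intros t _. unfold k, E. ring.
  - intros w Hw. eexists. apply HfR. eapply Rle_lt_trans; [apply (Cmod_triangle3 w b a)|lra].
  - unfold r; lra.
  - apply HfR. lra. }
set (J1 := CInt (fun t => f1 (a + E t) * k t)%C 0 (2 * PI)).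
assert (H2pi : (RtoC (2 * PI) * Ci)%C <> 0).
{ intros H0. assert (H1 := f_equal Cmod H0).
  rewrite Cmod_mult, Cmod_Ci, Cmod_R, Cmod_0, Rabs_pos_eq in H1; lra. }
exists (J1 / (RtoC (2 * PI) * Ci))%C.
apply Cder_eps. intros e He.
exists (Rmin (R / 8) (e * r / Lc)); split.
{ apply Rmin_glb_lt; [lra|]. apply Rdiv_lt_0_compat; nra. }
intros w Hw.
destruct (Rmin_Rgt_l _ _ _ Hw) as [W1 W2].
set (h := (w - a)%C) in *.
replace (f1 w - f1 a - J1 / (RtoC (2 * PI) * Ci) * h)%C with ((J0 w - J0 a - J1 * h) / (RtoC (2 * PI) * Ci))%C.
2:{ rewrite !HJ0; [field; split; intros H0; apply H2pi; rewrite H0; ring | |exact W1].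
    replace (a - a)%C with (RtoC 0) by ring. rewrite Cmod_0; lra. }
assert (Hca : forall t, Rcont (fun t => f (a + E t) * k t)%C t).
{ intros t. apply Rcont_mult; [|apply Hkc]. apply (Rcont_comp f (fun t => a + E t)%C); [|apply HEc].
  eapply Cder_cont, HfR. specialize (HEa t). lra. }
assert (Hcw : forall t, Rcont (fun t => f (w + E t) * k t)%C t).
{ intros t. apply Rcont_mult; [|apply Hkc]. apply (Rcont_comp f (fun t => w + E t)%C); [|apply HEc].
  eapply Cder_cont, HfR. replace (w + E t - a)%C with (E t + h)%C by (unfold h; ring).
  eapply Rle_lt_trans; [apply Cmod_triangle|]. rewrite HE. unfold r; lra. }
assert (Hc1 : forall t, Rcont (fun t => f1 (a + E t) * k t)%C t).
{ intros t. apply Rcont_mult; [|apply Hkc]. apply (Rcont_comp f1 (fun t => a + E t)%C); [|apply HEc].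
  apply Hcontf1, HEa. }
assert (Hconst : forall c t, Rcont (fun _ => c) t).
{ intros c t e' He'. exists 1; split; [lra|]. intros u _. replace (c - c)%C with (RtoC 0) by ring. now rewrite Cmod_0. }
assert (Hminus : forall f g t, Rcont f t -> Rcont g t -> Rcont (fun u => f u - g u)%C t).
{ intros f' g' t H1 H2 e' He'.
  destruct (H1 (e' / 2)) as [d1 [Hd1 H1']]; [lra|]. destruct (H2 (e' / 2)) as [d2 [Hd2 H2']]; [lra|].
  exists (Rmin d1 d2); split; [now apply Rmin_glb_lt|]. intros u Hu.
  specialize (H1' u (Rlt_le_trans _ _ _ Hu (Rmin_l _ _))).
  specialize (H2' u (Rlt_le_trans _ _ _ Hu (Rmin_r _ _))).
  replace (f' u - g' u - (f' t - g' t))%C with (f' u - f' t + - (g' u - g' t))%C by ring.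
  eapply Rle_lt_trans; [apply Cmod_triangle|]. rewrite Cmod_opp. lra. }
assert (HJ1h : (J1 * h)%C = CInt (fun t => f1 (a + E t) * k t * h)%C 0 (2 * PI)).
{ apply CInt_mult_r; [lra|auto]. }
rewrite HJ1h. unfold J0. rewrite <- !CInt_minus; try lra; auto.
2:{ intros t _. apply Rcont_mult; [apply Hc1|apply Hconst]. }
rewrite Cmod_div by exact H2pi.
rewrite Cmod_mult, Cmod_Ci, Cmod_R, Rabs_pos_eq, Rmult_1_r by lra.
apply Rle_div_l; [lra|].
replace (e * Cmod h * (2 * PI)) with (e * Cmod h * (2 * PI - 0)) by ring.
apply CInt_bound; [lra| |].
{ intros t _. apply Hminus; [apply Hminus; auto|]. apply Rcont_mult; [apply Hc1|apply Hconst]. }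
intros t _.
replace (f (w + E t) * k t - f (a + E t) * k t - f1 (a + E t) * k t * h)%C
  with ((f (a + E t + h) - f (a + E t) - f1 (a + E t) * h) * k t)%C.
2:{ replace (a + E t + h)%C with (w + E t)%C by (unfold h; ring). ring. }
rewrite Cmod_mult, Hk.
apply Rle_div_l; [exact Hr|].
eapply Rle_trans; [apply B3; [apply HEa|lra]|].
apply Rlt_div_r in W2; [|lra].
assert (P := Cmod_ge_0 h).
replace (Lc * Cmod h * Cmod h) with (Cmod h * Lc * Cmod h) by ring.
replace (e * Cmod h * r) with (e * r * Cmod h) by ring.
apply Rmult_le_compat_r; lra.
Qed.

(** * The Gaussian integral *)

Definition gauss (x : R) : R := RInt (fun v => exp (- (v * v))) 0 x.

Lemma is_derive_gauss (x : R) : is_derive gauss x (exp (- (x * x))).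
Proof.
assert (Hc : forall v, continuous (fun v => exp (- (v * v))) v).
{ intros v. apply (ex_derive_continuous (V := R_NormedModule)). auto_derive. easy. }
apply (is_derive_RInt (V := R_NormedModule) (fun v => exp (- (v * v))) _ 0); [|apply Hc].
apply filter_forall. intros y. apply (RInt_correct (V := R_CompleteNormedModule)).
apply (ex_RInt_continuous (V := R_CompleteNormedModule)). intros z _. apply Hc.
Qed.

Lemma gauss_0 : gauss 0 = 0.
Proof. apply (RInt_point (V := R_CompleteNormedModule)). Qed.

(** The classical companion of the Gaussian integral: the derivatives of [gauss]^2 and of [gaussc]
    cancel, and [gaussc] 0 is the arctangent integral PI / 4. *)
Definition gaussc (x : R) : R := RInt (fun t => exp (- (x * x) * (1 + t * t)) / (1 + t * t)) 0 1.

Lemma ex_gaussc (x : R) : ex_RInt (fun t => exp (- (x * x) * (1 + t * t)) / (1 + t * t)) 0 1.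
Proof.
apply (ex_RInt_continuous (V := R_CompleteNormedModule)). intros z _.
apply (ex_derive_continuous (V := R_NormedModule)). auto_derive. nra.
Qed.

(** Differentiation under the integral sign cancels the denominator 1 + t^2; the substitution v = x
    t recovers [gauss]. *)
Lemma is_derive_gaussc (x : R) : is_derive gaussc x (- 2 * exp (- (x * x)) * gauss x).
Proof.
set (f := fun x t => exp (- (x * x) * (1 + t * t)) / (1 + t * t)).
assert (D : forall x t, is_derive (fun u => f u t) x (- 2 * x * exp (- (x * x) * (1 + t * t)))).
{ intros y t. unfold f. auto_derive; [nra|]. field. nra. }
replace (- 2 * exp (- (x * x)) * gauss x) with (RInt (fun t => Derive (fun u => f u t) x) 0 1).
- apply (is_derive_RInt_param f 0 1 x).
  + apply filter_forall. intros y t _. eexists. apply D.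
  + intros t _.
    apply continuity_2d_pt_ext with (f := fun u v => - 2 * u * exp (- (u * u) * (1 + v * v))).
    { intros u v. symmetry. apply is_derive_unique, D. }
    assert (Hid1 : continuity_2d_pt (fun u v : R => u) x t) by apply continuity_2d_pt_id1.
    assert (Hid2 : continuity_2d_pt (fun u v : R => v) x t) by apply continuity_2d_pt_id2.
    apply continuity_2d_pt_mult.
    * apply continuity_2d_pt_mult; [apply continuity_2d_pt_const|exact Hid1].
    * apply (continuity_1d_2d_pt_comp exp (fun u v => - (u * u) * (1 + v * v))).
      { apply derivable_continuous_pt, derivable_pt_exp. }
      apply continuity_2d_pt_mult.
      -- apply continuity_2d_pt_opp, continuity_2d_pt_mult; exact Hid1.
      -- apply continuity_2d_pt_plus; [apply continuity_2d_pt_const|].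
         apply continuity_2d_pt_mult; exact Hid2.
  + apply filter_forall. intros y. apply ex_gaussc.
- rewrite (RInt_ext _ (fun t => scal (- 2 * exp (- (x * x))) (scal x (exp (- (x * t * (x * t))))))).
  2:{ intros t _. apply trans_eq with (1 := is_derive_unique _ _ _ (D x t)). unfold scal; simpl; unfold mult; simpl.
      replace (- (x * x) * (1 + t * t)) with (- (x * x) + - (x * t * (x * t))) by ring. rewrite exp_plus. ring. }
  assert (C : forall v, continuous (fun v => exp (- (v * v))) v).
  { intros v. apply (ex_derive_continuous (V := R_NormedModule)). auto_derive. easy. }
  rewrite (RInt_scal (V := R_CompleteNormedModule) (fun t => scal x (exp (- (x * t * (x * t)))))).
  2:{ apply (ex_RInt_continuous (V := R_CompleteNormedModule)). intros z _.
      apply (ex_derive_continuous (V := R_NormedModule)). unfold scal; simpl; unfold mult; simpl. auto_derive. easy. }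
  unfold scal at 1; simpl; unfold mult; simpl. f_equal.
  rewrite (RInt_comp (V := R_CompleteNormedModule) (fun v => exp (- (v * v))) (fun t => x * t) (fun _ => x)).
  + unfold gauss. now rewrite Rmult_0_r, Rmult_1_r.
  + intros; apply C.
  + intros t _. split; [auto_derive; [easy|ring]|apply continuous_const].
Qed.

Lemma gaussc_bound (x : R) : 0 <= gaussc x <= exp (- (x * x)).
Proof.
split.
- apply RInt_ge_0; [lra|apply ex_gaussc|]. intros t _.
  apply Rlt_le, Rdiv_lt_0_compat; [apply exp_pos|nra].
- replace (exp (- (x * x))) with (RInt (fun _ => exp (- (x * x))) 0 1).
  2:{ rewrite RInt_const. unfold scal; simpl; unfold mult; simpl. ring. }
  apply RInt_le; [lra|apply ex_gaussc|apply ex_RInt_const|].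
  intros t _. apply Rle_div_l; [nra|].
  apply Rle_trans with (exp (- (x * x)) * 1).
  + rewrite Rmult_1_r. destruct (Req_dec (- (x * x) * (1 + t * t)) (- (x * x))) as [->|N]; [lra|].
    left; apply exp_increasing. nra.
  + apply Rmult_le_compat_l; [left; apply exp_pos|nra].
Qed.

Lemma gauss_sqr (x : R) : gauss x * gauss x + gaussc x = PI / 4.
Proof.
assert (H0 : gauss 0 * gauss 0 + gaussc 0 = PI / 4).
{ rewrite gauss_0. unfold gaussc.
  rewrite (RInt_ext _ (fun t => / (1 + t²))).
  2:{ intros t _. replace (- (0 * 0) * (1 + t * t)) with 0 by ring. rewrite exp_0. apply Rmult_1_l. }
  rewrite (is_RInt_unique _ 0 1 (minus (atan 1) (atan 0))).
  - rewrite atan_1, atan_0. unfold minus, plus, opp; simpl. field.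
  - apply (is_RInt_derive (V := R_CompleteNormedModule)).
    + intros; apply is_derive_atan.
    + intros t _. apply (ex_derive_continuous (V := R_NormedModule)). unfold Rsqr. auto_derive. nra. }
rewrite <- H0.
set (k := fun x => gauss x * gauss x + gaussc x).
destruct (MVT_gen k 0 x (fun _ => 0)) as [c [_ E]].
- intros y _. unfold k.
  replace 0 with (exp (- (y * y)) * gauss y + gauss y * exp (- (y * y)) + - 2 * exp (- (y * y)) * gauss y) by ring.
  apply (is_derive_plus (V := R_NormedModule)); [|apply is_derive_gaussc].
  apply Derive.is_derive_mult; apply is_derive_gauss.
- intros y _. apply continuity_pt_filterlim, (ex_derive_continuous (V := R_NormedModule)). eexists.
  apply (is_derive_plus (V := R_NormedModule)); [|apply is_derive_gaussc].
  apply Derive.is_derive_mult; apply is_derive_gauss.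
- fold (k x) (k 0). lra.
Qed.

Lemma gauss_pos (x : R) : 0 <= x -> 0 <= gauss x.
Proof.
intros Hx. apply RInt_ge_0; [easy| |intros; left; apply exp_pos].
apply (ex_RInt_continuous (V := R_CompleteNormedModule)). intros z _.
apply (ex_derive_continuous (V := R_NormedModule)). auto_derive. easy.
Qed.

(** The product (sqrt PI / 2 - g) (sqrt PI / 2 + g) equals [gaussc] x <= exp(-x^2), and its second
    factor is at least 1 / 2. An effective rate is needed because the segment through the saddle
    point has fixed length. *)
Lemma gauss_limit (x : R) : 0 <= x -> Rabs (gauss x - sqrt PI / 2) <= 2 * exp (- (x * x)).
Proof.
intros Hx.
assert (H1 := gauss_sqr x). assert (H2 := gaussc_bound x). assert (H3 := gauss_pos x Hx).
assert (HPI := PI2_1). 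
assert (HS : 1 <= sqrt PI) by (rewrite <- sqrt_1; apply sqrt_le_1_alt; lra).
assert (HS2 : sqrt PI * sqrt PI = PI) by (apply sqrt_sqrt; lra).
set (g := gauss x) in *. set (s := sqrt PI) in *.
assert (E : (s / 2 - g) * (s / 2 + g) = gaussc x) by (rewrite <- HS2 in H1; nra).
assert (0 <= s / 2 - g) by (destruct (Rle_lt_dec 0 (s / 2 - g)); [easy|nra]).
rewrite Rabs_minus_sym, Rabs_pos_eq by easy. nra.
Qed.

Lemma gauss_le (x : R) : 0 <= x -> gauss x <= 2.
Proof.
intros Hx.
assert (H1 := gauss_sqr x). assert (H2 := gaussc_bound x). assert (H3 := gauss_pos x Hx).
assert (HPI := PI_4). nra.
Qed.

(** * The model saddle point *)

Lemma Cpath_minus (f g : R -> C) (t : R) (a b : C) :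
  is_Cpath f t a -> is_Cpath g t b -> is_Cpath (fun u => f u - g u)%C t (a - b).
Proof. apply (is_derive_minus (K := R_AbsRing) (V := C_R_NormedModule)). Qed.

Lemma Cpath_real (f : R -> R) (t l : R) :
  is_derive f t l -> is_Cpath (fun u => RtoC (f u)) t (RtoC l).
Proof.
intros H. apply Cpath_iff; split; [exact H|exact (is_derive_const (V := R_NormedModule) 0 t)].
Qed.

Lemma Cder_scal (a z : C) : is_Cder (fun w => a * w)%C z a.
Proof.
assert (H : is_Cder (fun w => a * w)%C z (0 * z + a * 1)%C).
{ apply (Cder_mult (fun _ => a) (fun w => w)); [apply Cder_const|apply Cder_id]. }
replace (0 * z + a * 1)%C with a in H by ring. exact H.
Qed.

Lemma Cpath_mult_l (a : C) (f : R -> C) (t : R) (l : C) :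
  is_Cpath f t l -> is_Cpath (fun u => a * f u)%C t (a * l).
Proof.
intros H. apply (Cpath_comp (fun w => a * w)%C f); [apply Cder_scal|exact H].
Qed.

Lemma exp_le (x y : R) : x <= y -> exp x <= exp y.
Proof. intros [H|H]; [left; now apply exp_increasing|right; now rewrite H]. Qed.

Lemma exp_1_16 : exp (/ 16) <= 2.
Proof.
assert (H := exp_le_3). apply Rle_trans with (exp (/ 2)); [apply exp_le; lra|].
assert (E : exp 1 = exp (/ 2) * exp (/ 2)) by (rewrite <- exp_plus; f_equal; lra).
assert (0 < exp (/ 2)) by apply exp_pos. nra.
Qed.

Lemma RtoC_exp (x : R) : RtoC (exp x) = Cexp (RtoC x).
Proof.
unfold Cexp, polar, RtoC, Re, Im; simpl. rewrite cos_0, sin_0. f_equal; ring.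
Qed.

(* i e^{- i th / 2}, the direction of steepest descent at e^{i th} in the
   coordinate zeta = log s. *)
Definition dir (th : R) : C := (sin (th / 2), cos (th / 2)).

Lemma dir_sqr (th : R) : (dir th * dir th * Cexp (0, th) = - (1))%C.
Proof.
unfold dir, Cexp, polar, Cmult, Copp, RtoC, Re, Im; simpl. rewrite exp_0.
set (h := th / 2). replace th with (2 * h) by (unfold h; field). clearbody h.
rewrite cos_2a, sin_2a.
assert (H := sin2_cos2 h). unfold Rsqr in H.
set (x := sin h) in *. set (y := cos h) in *.
f_equal; [|ring].
apply Rminus_diag_uniq.
match goal with |- ?l = 0 => replace l with ((x * x + y * y) * (1 - (x * x + y * y)) + (1 - (x * x + y * y))) by ring end.
rewrite H. ring.
Qed.

Lemma dir_exp (th : R) : (dir th * Cexp (0, th) = Ci * Cexp (0, (th / 2)%R))%C.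
Proof.
unfold dir, Cexp, polar, Cmult, Ci, RtoC, Re, Im; simpl. rewrite exp_0.
set (h := th / 2). replace th with (2 * h) by (unfold h; field). clearbody h.
rewrite cos_2a, sin_2a.
assert (H := sin2_cos2 h). unfold Rsqr in H.
set (x := sin h) in *. set (y := cos h) in *.
f_equal; apply Rminus_diag_uniq.
- match goal with |- ?l = 0 => replace l with (x * (1 - (x * x + y * y))) by ring end. rewrite H. ring.
- match goal with |- ?l = 0 => replace l with (y * (x * x + y * y - 1)) by ring end. rewrite H. ring.
Qed.

Lemma Cmod_dir (th : R) : Cmod (dir th) = 1.
Proof.
unfold dir, Cmod; simpl. replace (sin (th / 2) * (sin (th / 2) * 1) + cos (th / 2) * (cos (th / 2) * 1)) with 1.
apply sqrt_1. assert (H := sin2_cos2 (th / 2)). unfold Rsqr in H. lra.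
Qed.

(** On the steepest descent segment the derivative of H in t is -t up to O(t^2) + eta O(t), since
    [dir]^2 e^(i th) = -1. Thus H is close to its value at the saddle point minus t^2 / 2, and P
    grows like a real Gaussian integral times [dir] th * e^(i th) = i e^(i th / 2). The last claim
    is the drop of Re H that pays for the rest of the path. *)
Lemma local_half (th t1 eta lam : R) (H kap P : C -> C) :
  0 < t1 <= / 16 -> 0 <= eta <= / 24 -> 0 < lam ->
  (forall t, 0 <= t <= t1 ->
     is_Cder H ((0, th) + RtoC t * dir th)
       (kap ((0, th) + RtoC t * dir th) * Cexp ((0, th) + RtoC t * dir th))%C) ->
  (forall t, 0 <= t <= t1 ->
     is_Cder P ((0, th) + RtoC t * dir th)
       (Cexp (RtoC lam * H ((0, th) + RtoC t * dir th)) * Cexp ((0, th) + RtoC t * dir th))%C) ->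
  (forall t, 0 <= t <= t1 ->
     Cmod (kap ((0, th) + RtoC t * dir th) - RtoC t * dir th)%C <= eta * t) ->
  Cmod (P ((0, th) + RtoC t1 * dir th) - P (0, th)
        - Ci * Cexp (0, (th / 2)%R) * Cexp (RtoC lam * H (0%R, th)) * RtoC (sqrt PI / 2 / sqrt (lam / 2)))%C
    <= exp (lam * Re (H (0, th))) *
       (54 / lam + 72 * eta / sqrt (lam / 4) + 2 * exp (- (lam / 2 * (t1 * t1))) / sqrt (lam / 2)) /\
  Re (H ((0, th) + RtoC t1 * dir th)%C) <= Re (H (0, th)) - t1 * t1 / 4.
Proof.
intros Ht1 Heta Hlam HH HP Hkap.
set (z := fun t => ((0, th) + RtoC t * dir th)%C) in *.
assert (Hz0 : z 0 = (0, th)) by (unfold z; ring).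
set (w := dir th) in *.
assert (Hw : Cmod w = 1) by apply Cmod_dir.
set (u0 := Cexp (0, th)).
assert (Hu0 : Cmod u0 = 1) by (unfold u0; rewrite Cmod_Cexp; apply exp_0).
assert (Hzexp : forall t, Cexp (z t) = (u0 * Cexp (RtoC t * w))%C) by (intros t; unfold z; apply Cexp_plus).
assert (Htw : forall t, 0 <= t -> Cmod (RtoC t * w) = t).
{ intros t Ht. rewrite Cmod_mult, Hw, Cmod_R, Rabs_pos_eq by easy. ring. }
assert (Hexp2 : forall t, 0 <= t <= t1 -> exp t <= 2).
{ intros t Ht. eapply Rle_trans; [|apply exp_1_16]. apply exp_le. lra. }
assert (Hsq : (w * w * u0 = - (1))%C) by apply dir_sqr.
(* The expansion comes from integrating the bound on the first derivative; no second derivative of H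
   enters. *)
assert (Hm : forall s, 0 <= s <= t1 ->
  Cmod (H (z s) - H (z 0) + RtoC (s * s / 2))%C <= s * s * s + eta * (s * s)).
{ intros s Hs.
  replace (H (z s) - H (z 0) + RtoC (s * s / 2))%C
    with (H (z s) - RtoC (- (s * s / 2)) - (H (z 0) - RtoC (- (0 * 0 / 2))))%C.
  2:{ replace (- (0 * 0 / 2)) with 0 by field. rewrite RtoC_opp. ring. }
  replace (s * s * s + eta * (s * s)) with (s * s * s + eta * (s * s) - (0 * 0 * 0 + eta * (0 * 0))) by ring.
  apply (path_dominated (fun t => H (z t) - RtoC (- (t * t / 2)))%C
    (fun t => kap (z t) * Cexp (z t) * w - RtoC (- t))%C
    (fun t => t * t * t + eta * (t * t)) (fun t => 3 * t * t + 2 * eta * t)); [lra|].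
  intros t Ht. split; [|split].
  - apply Cpath_minus.
    + apply (Cpath_comp H z); [apply HH; lra|apply Cpath_line].
    + apply Cpath_real. auto_derive; [easy|field].
  - auto_derive; [easy|ring].
  - set (r := (kap (z t) - RtoC t * w)%C).
    assert (Hr : Cmod r <= eta * t) by (apply Hkap; lra).
    set (e1 := (Cexp (RtoC t * w) - 1)%C).
    assert (He1 : Cmod e1 <= 2 * t).
    { eapply Rle_trans; [apply Cexp_sub_1|]. rewrite Htw by lra.
      assert (exp t <= 2) by (apply Hexp2; lra). nra. }
    assert (He2 : Cmod (Cexp (RtoC t * w)) <= 2).
    { rewrite Cmod_Cexp. eapply Rle_trans; [|apply (Hexp2 t); lra]. apply exp_le.
      eapply Rle_trans; [apply Rle_abs|]. eapply Rle_trans; [apply re_le_Cmod|]. rewrite Htw; lra. }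
    replace (kap (z t) * Cexp (z t) * w - RtoC (- t))%C
      with (- (RtoC t * e1) + r * u0 * w * Cexp (RtoC t * w))%C.
    2:{ rewrite Hzexp, RtoC_opp. unfold e1, r.
        replace (kap (z t)) with (kap (z t) - RtoC t * w + RtoC t * w)%C at 2 by ring.
        replace ((kap (z t) - RtoC t * w + RtoC t * w) * (u0 * Cexp (RtoC t * w)) * w)%C
          with (RtoC t * (w * w * u0) * Cexp (RtoC t * w) + (kap (z t) - RtoC t * w) * u0 * w * Cexp (RtoC t * w))%C by ring.
        rewrite Hsq. ring. }
    eapply Rle_trans; [apply Cmod_triangle|]. rewrite Cmod_opp, !Cmod_mult, Hu0, Hw, Cmod_R, Rabs_pos_eq by lra.
    assert (Cmod r * Cmod (Cexp (RtoC t * w)) <= eta * t * 2).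
    { apply Rmult_le_compat; auto; apply Cmod_ge_0. }
    nra. }
assert (Hre : Re (H (z t1)) <= Re (H (z 0)) - t1 * t1 / 4).
{ assert (M := Hm t1 ltac:(lra)).
  assert (M1 := Rle_trans _ _ _ (Rle_abs _) (re_le_Cmod (H (z t1) - H (z 0) + RtoC (t1 * t1 / 2)))).
  change (Re (H (z t1) - H (z 0) + RtoC (t1 * t1 / 2))%C) with (Re (H (z t1)) - Re (H (z 0)) + t1 * t1 / 2) in M1.
  nra. }
split; [|rewrite Hz0 in Hre; exact Hre].
set (E0 := Cexp (RtoC lam * H (0%R, th))).
assert (HE0 : Cmod E0 = exp (lam * Re (H (0, th)))).
{ unfold E0. rewrite Cmod_Cexp. f_equal. unfold Cmult, RtoC, Re; simpl; ring. }
set (k := sqrt (lam / 2)). set (k2 := sqrt (lam / 4)).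
assert (Hk : 0 < k) by (apply sqrt_lt_R0; lra).
assert (Hk2 : 0 < k2) by (apply sqrt_lt_R0; lra).
assert (Hkk : k * k = lam / 2) by (apply sqrt_sqrt; lra).
assert (Hkk2 : k2 * k2 = lam / 4) by (apply sqrt_sqrt; lra).
assert (Dg : forall k t, 0 < k -> is_derive (fun t => gauss (k * t) / k) t (exp (- (k * k * (t * t))))).
{ intros k' t Hk'.
  replace (exp (- (k' * k' * (t * t)))) with (/ k' * (k' * exp (- (k' * t * (k' * t))))).
  2:{ replace (k' * t * (k' * t)) with (k' * k' * (t * t)) by ring. field. lra. }
  apply is_derive_ext with (f := fun t => / k' * gauss (k' * t)); [intros; unfold Rdiv; apply Rmult_comm|].
  apply is_derive_scal. apply (is_derive_comp (V := R_NormedModule) gauss (fun t => k' * t)); [apply is_derive_gauss|].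
  auto_derive; [easy|ring]. }
assert (Main : Cmod (P (z t1) - w * u0 * E0 * RtoC (gauss (k * t1) / k) - (P (z 0) - w * u0 * E0 * RtoC (gauss (k * 0) / k)))%C
   <= Cmod E0 * (54 / lam + 72 * eta / k2)).
(* This is a primitive of the majorant (27 t + 36 eta) exp(-lam t^2 / 4). The first part contributes
   at most 54 / lam, the second at most 72 eta / k2 because [gauss] <= 2; 27 and 36 are not
   sharp. *)
{ set (psi := fun t => Cmod E0 * (- (54 / lam) * exp (- (lam / 4 * (t * t))) + 36 * eta * (gauss (k2 * t) / k2))).
  apply Rle_trans with (psi t1 - psi 0).
  - apply (path_dominated (fun t => P (z t) - w * u0 * E0 * RtoC (gauss (k * t) / k))%C
      (fun t => Cexp (RtoC lam * H (z t)) * Cexp (z t) * w - w * u0 * E0 * RtoC (exp (- (k * k * (t * t)))))%C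
      psi (fun t => Cmod E0 * (27 * t * exp (- (lam / 4 * (t * t))) + 36 * eta * exp (- (k2 * k2 * (t * t)))))); [lra|].
    intros t Ht. split; [|split].
    + apply Cpath_minus.
      * apply (Cpath_comp P z); [apply HP; lra|apply Cpath_line].
      * apply Cpath_mult_l, Cpath_real, Dg, Hk.
    + apply is_derive_scal, (is_derive_plus (V := R_NormedModule)).
      * auto_derive; [easy|]. field. lra.
      * apply is_derive_scal, Dg, Hk2.
    + rewrite Hkk, Hkk2.
      set (m := (H (z t) - H (z 0) + RtoC (t * t / 2))%C).
      assert (Hmt : Cmod m <= t * t * t + eta * (t * t)) by (apply Hm; lra).
      (* The exact integrand is its Gaussian model times exp y: lam m is the error in the exponent,
         t w comes from the factor e^zeta. *)
      set (y := (RtoC lam * m + RtoC t * w)%C).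
      assert (Hy : Cmod y <= lam * (t * t * t + eta * (t * t)) + t).
      { eapply Rle_trans; [apply Cmod_triangle|]. rewrite Htw, Cmod_mult, Cmod_R, Rabs_pos_eq by lra.
        apply Rplus_le_compat_r, Rmult_le_compat_l; lra. }
      (* Here t + eta <= 1/16 + 1/24 <= 1/8. Hence the error costs one factor q = exp(lam t^2 / 8);
         a second one absorbs the powers of lam t^2, and half of the Gaussian exponent survives. *)
      assert (Hy2 : Cmod y <= lam / 8 * (t * t) + t).
      { eapply Rle_trans; [exact Hy|]. apply Rplus_le_compat_r.
        replace (lam / 8 * (t * t)) with (lam * (/ 8 * (t * t))) by field.
        apply Rmult_le_compat_l; [lra|]. nra. }
      replace (Cexp (RtoC lam * H (z t)) * Cexp (z t) * w - w * u0 * E0 * RtoC (exp (- (lam / 2 * (t * t)))))%C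
        with (w * u0 * E0 * RtoC (exp (- (lam / 2 * (t * t)))) * (Cexp y - 1))%C.
      2:{ replace (w * u0 * E0 * RtoC (exp (- (lam / 2 * (t * t)))) * (Cexp y - 1))%C
            with (w * u0 * (E0 * (RtoC (exp (- (lam / 2 * (t * t)))) * Cexp y)) - w * u0 * E0 * RtoC (exp (- (lam / 2 * (t * t)))))%C by ring.
          f_equal. rewrite Hzexp, RtoC_exp. unfold E0. rewrite <- !Cexp_plus.
          replace (w * u0 * Cexp (RtoC lam * H (0%R, th) + (RtoC (- (lam / 2 * (t * t))) + y)))%C
            with (Cexp (RtoC lam * H (0%R, th) + (RtoC (- (lam / 2 * (t * t))) + y)) * u0 * w)%C by ring.
          rewrite !Cmult_assoc. f_equal. rewrite (Cmult_comm _ u0), (Cmult_comm (Cexp (RtoC lam * H (z t))) u0), <- Cmult_assoc.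
          f_equal. rewrite <- Cexp_plus. f_equal. unfold y, m. rewrite Hz0.
          replace (- (lam / 2 * (t * t))) with (- (lam * (t * t / 2))) by field.
          rewrite RtoC_opp, RtoC_mult. ring. }
      rewrite !Cmod_mult, Hw, Hu0, Cmod_R, Rabs_pos_eq by (left; apply exp_pos).
      rewrite !Rmult_1_l, Rmult_assoc.
      apply Rmult_le_compat_l; [apply Cmod_ge_0|].
      set (q := exp (lam / 8 * (t * t))).
      assert (Hq : lam * (t * t) <= 8 * q).
      { unfold q. assert (X := exp_ineq1_le (lam / 8 * (t * t))). lra. }
      assert (Hq0 : 0 < q) by apply exp_pos.
      assert (Hey : exp (Cmod y) <= 2 * q).
      { eapply Rle_trans; [apply exp_le, Hy2|]. rewrite exp_plus. fold q.
        assert (exp t <= 2) by (apply Hexp2; lra). nra. }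
      assert (Hexy : Cmod (Cexp y - 1) <= (lam * (t * t * t + eta * (t * t)) + t) * (2 * q)).
      { eapply Rle_trans; [apply Cexp_sub_1|]. apply Rmult_le_compat; auto; [apply Cmod_ge_0|left; apply exp_pos]. }
      assert (Hq1 : 1 <= q) by (unfold q; rewrite <- exp_0; apply exp_le; nra).
      assert (Hfin : Cmod (Cexp y - 1) <= (18 * t + 16 * eta) * (q * q)).
      { eapply Rle_trans; [exact Hexy|].
        replace ((lam * (t * t * t + eta * (t * t)) + t) * (2 * q)) with (((lam * (t * t)) * (t + eta) + t) * (2 * q)) by ring.
        assert (lam * (t * t) * (t + eta) <= 8 * q * (t + eta)) by (apply Rmult_le_compat_r; lra).
        assert (t <= q * t) by nra.
        apply Rle_trans with ((8 * q * (t + eta) + q * t) * (2 * q)); [apply Rmult_le_compat_r; lra|].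
        right; ring. }
      assert (Eq : exp (- (lam / 2 * (t * t))) * (q * q) = exp (- (lam / 4 * (t * t)))).
      { unfold q. rewrite <- !exp_plus. f_equal. field. }
      apply Rle_trans with (exp (- (lam / 2 * (t * t))) * ((18 * t + 16 * eta) * (q * q))).
      { apply Rmult_le_compat_l; [left; apply exp_pos|exact Hfin]. }
      replace (exp (- (lam / 2 * (t * t))) * ((18 * t + 16 * eta) * (q * q)))
        with ((18 * t + 16 * eta) * (exp (- (lam / 2 * (t * t))) * (q * q))) by ring.
      rewrite Eq. assert (0 < exp (- (lam / 4 * (t * t)))) by apply exp_pos. nra.
  - unfold psi. rewrite <- Rmult_minus_distr_l. apply Rmult_le_compat_l; [apply Cmod_ge_0|].
    rewrite !Rmult_0_r, Ropp_0, exp_0, gauss_0.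
    assert (G := gauss_le (k2 * t1) ltac:(nra)).
    assert (0 < exp (- (lam / 4 * (t1 * t1)))) by apply exp_pos.
    assert (0 < 54 / lam) by (apply Rdiv_lt_0_compat; lra).
    assert (gauss (k2 * t1) / k2 <= 2 / k2).
    { apply Rmult_le_compat_r; [left; now apply Rinv_0_lt_compat|exact G]. }
    replace (72 * eta / k2) with (36 * eta * (2 / k2)) by (field; lra).
    replace (0 / k2) with 0 by (field; lra).
    assert (36 * eta * (gauss (k2 * t1) / k2) <= 36 * eta * (2 / k2)) by (apply Rmult_le_compat_l; lra).
    nra. }
rewrite Rmult_0_r, gauss_0 in Main.
replace (0 / k) with 0 in Main by (field; lra).
rewrite Hz0 in Main.
assert (Hwu : (w * u0 = Ci * Cexp (0, (th / 2)%R))%C) by apply dir_exp.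
change ((0, th) + RtoC t1 * w)%C with (z t1). rewrite <- Hwu, <- HE0.
set (B := (w * u0 * E0)%C) in *.
assert (HB : Cmod B = Cmod E0) by (unfold B; rewrite !Cmod_mult, Hw, Hu0; ring).
replace (P (z t1) - P (0%R, th) - B * RtoC (sqrt PI / 2 / k))%C
  with ((P (z t1) - B * RtoC (gauss (k * t1) / k) - (P (0%R, th) - B * 0)) + B * RtoC ((gauss (k * t1) - sqrt PI / 2) / k))%C.
2:{ replace ((gauss (k * t1) - sqrt PI / 2) / k) with (gauss (k * t1) / k - sqrt PI / 2 / k) by (field; lra).
    rewrite RtoC_minus. ring. }
eapply Rle_trans; [apply Cmod_triangle|].
rewrite (Rmult_plus_distr_l (Cmod E0)).
apply Rplus_le_compat; [exact Main|].
rewrite Cmod_mult, HB, Cmod_R. apply Rmult_le_compat_l; [apply Cmod_ge_0|].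
unfold Rdiv at 1. rewrite Rabs_mult, (Rabs_pos_eq (/ k)) by (left; now apply Rinv_0_lt_compat).
apply Rmult_le_compat_r; [left; now apply Rinv_0_lt_compat|].
replace (lam / 2 * (t1 * t1)) with (k * t1 * (k * t1)) by (rewrite <- Hkk; ring).
apply gauss_limit. nra.
Qed.

(** * Leaving the saddle point *)

Lemma Re_increment (f f' : R -> C) (g g' : R -> R) (a b : R) :
  a <= b ->
  (forall t, a <= t <= b -> is_Cpath f t (f' t) /\ is_derive g t (g' t) /\ Re (f' t) <= g' t) ->
  Re (f b) - Re (f a) <= g b - g a.
Proof.
intros Hab H.
assert (D : forall t, a <= t <= b -> is_derive (fun t => Re (f t) - g t) t (Re (f' t) - g' t)).
{ intros t Ht. destruct (H t Ht) as [H1 [H2 _]]. apply Cpath_iff in H1.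
  apply (is_derive_minus (V := R_NormedModule)); [apply H1|exact H2]. }
destruct (MVT_gen (fun t => Re (f t) - g t) a b (fun t => Re (f' t) - g' t)) as [c [Hc E]].
- intros t Ht. rewrite Rmin_left, Rmax_right in Ht by lra. apply D; lra.
- intros t Ht. rewrite Rmin_left, Rmax_right in Ht by lra.
  apply continuity_pt_filterlim, (ex_derive_continuous (V := R_NormedModule) (fun t => Re (f t) - g t)).
  exists (Re (f' t) - g' t). apply D; lra.
- rewrite Rmin_left, Rmax_right in Hc by lra.
  destruct (H c Hc) as [_ [_ H3]]. nra.
Qed.

(** On a segment along which the real part of the model does not increase, Re H gains at most the
    effect of the deviation of [kap], namely eta A times the bounds A for |e^zeta| and for the
    length. The increment of P is then bounded by length times maximum. *)
Lemma saddle_move (th eta lam A : R) (H kap P : C -> C) (za v : C) :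
  0 <= eta -> 0 <= lam -> 0 <= A ->
  (forall t, 0 <= t <= 1 -> let z := (za + RtoC t * v)%C in
     is_Cder H z (kap z * Cexp z) /\
     is_Cder P z (Cexp (RtoC lam * H z) * Cexp z) /\
     Cmod (kap z - (z - (0, th)))%C <= eta * A /\
     Cmod (Cexp z) <= A /\
     Re ((z - (0, th)) * Cexp z * v) <= 0) ->
  Cmod v <= A ->
  Re (H (za + v)%C) <= Re (H za) + eta * (A * A * A) /\
  Cmod (P (za + v) - P za)%C <= A * A * exp (lam * (Re (H za) + eta * (A * A * A))).
Proof.
intros Heta Hlam HA Hz Hv.
set (d := eta * (A * A * A)).
assert (Hd : 0 <= d) by (unfold d; repeat apply Rmult_le_pos; easy).
assert (E0 : za = (za + RtoC 0 * v)%C) by ring.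
assert (E1 : (za + v)%C = (za + RtoC 1 * v)%C) by ring.
assert (R : forall s, 0 <= s <= 1 -> Re (H (za + RtoC s * v)%C) <= Re (H za) + d).
{ intros s Hs. rewrite E0 at 2.
  assert (I := Re_increment (fun t => H (za + RtoC t * v)%C)
    (fun t => kap (za + RtoC t * v) * Cexp (za + RtoC t * v) * v)%C (fun t => t * d) (fun _ => d) 0 s).
  cbv beta in I. specialize (I (proj1 Hs)).
  assert (s * d - 0 * d <= d) by nra.
  enough (Re (H (za + RtoC s * v)%C) - Re (H (za + 0 * v)%C) <= s * d - 0 * d) by lra.
  apply I. intros t Ht. destruct (Hz t) as [H1 [H2 [H3 [H4 H5]]]]; [lra|].
  split; [|split].
  - apply Cpath_comp; [exact H1|apply Cpath_line].
  - auto_derive; [easy|ring].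
  - set (z := (za + RtoC t * v)%C) in *.
    set (r := (kap z - (z - (0, th)))%C) in *.
    replace (kap z * Cexp z * v)%C with ((z - (0, th)) * Cexp z * v + r * Cexp z * v)%C by (unfold r; ring).
    change (Re ((z - (0, th)) * Cexp z * v + r * Cexp z * v)%C) with
      (Re ((z - (0, th)) * Cexp z * v)%C + Re (r * Cexp z * v)%C).
    assert (Cmod (r * Cexp z * v) <= d).
    { rewrite !Cmod_mult. unfold d. replace (eta * (A * A * A)) with (eta * A * A * A) by ring.
      apply Rmult_le_compat; [apply Rmult_le_pos; apply Cmod_ge_0|apply Cmod_ge_0| |exact Hv].
      apply Rmult_le_compat; [apply Cmod_ge_0|apply Cmod_ge_0|exact H3|exact H4]. }
    assert (X := Rle_trans _ _ _ (Rle_abs _) (re_le_Cmod (r * Cexp z * v))). lra. }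
split; [rewrite E1; apply R; lra|].
rewrite E1. rewrite E0 at 2.
set (M := A * A * exp (lam * (Re (H za) + d))).
replace M with (1 * M - 0 * M) by ring.
apply (path_dominated (fun t => P (za + RtoC t * v)%C)
  (fun t => Cexp (RtoC lam * H (za + RtoC t * v)) * Cexp (za + RtoC t * v) * v)%C (fun t => t * M) (fun _ => M)); [lra|].
intros t Ht. destruct (Hz t) as [H1 [H2 [H3 [H4 H5]]]]; [lra|].
split; [|split].
- apply Cpath_comp; [exact H2|apply Cpath_line].
- auto_derive; [easy|ring].
- rewrite !Cmod_mult, (Cmod_Cexp (RtoC lam * _)).
  replace (Re (RtoC lam * H (za + RtoC t * v)%C)) with (lam * Re (H (za + RtoC t * v)%C))
    by (unfold Cmult, RtoC, Re; simpl; ring).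
  unfold M. rewrite (Rmult_comm (A * A)), Rmult_assoc.
  apply Rmult_le_compat; [left; apply exp_pos|apply Rmult_le_pos; apply Cmod_ge_0| |].
  + apply exp_le. apply Rmult_le_compat_l; [easy|now apply R].
  + apply Rmult_le_compat; try apply Cmod_ge_0; easy.
Qed.

(** The slope condition makes Re H fall at least like -c e^x, that is, linearly in |s|. Integrating
    the resulting exponential exactly bounds the increments of P, and x -> infinity gives the bound
    for the limit. *)
Lemma saddle_tail (a c lam b X : R) (H kap P : C -> C) (Pp : C) :
  0 < c -> 0 < lam -> 0 <= X ->
  (forall x, is_Cder H (x, a) (kap (x, a) * Cexp (x, a))%C) ->
  (forall x, is_Cder P (x, a) (Cexp (RtoC lam * H (x, a)) * Cexp (x, a))%C) ->
  (forall x, 0 <= x -> Re (Cexp (0, a) * kap (x, a))%C <= - c) ->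
  (forall e, 0 < e -> exists X', forall x, X' <= x -> Cmod (P (x, a) - Pp)%C <= e) ->
  Re (H (X, a)) <= b ->
  Cmod (Pp - P (X, a))%C <= exp (lam * b) / (lam * c).
Proof.
intros Hc Hlam HX HH HP Ht Hlim Hb.
assert (EL : forall x, (x, a) = ((0, a) + RtoC x * 1)%C).
{ intros x. unfold RtoC, Cplus, Cmult; simpl. f_equal; ring. }
assert (Dline : forall f l x, is_Cder f (x, a) l -> is_Cpath (fun x => f (x, a)) x l).
{ intros f l x Hf.
  assert (D : is_Cpath (fun x => f ((0, a) + RtoC x * 1)%C) x (l * 1)).
  { apply Cpath_comp; [rewrite <- EL; exact Hf|apply Cpath_line]. }
  rewrite Cmult_1_r in D. revert D. apply is_derive_ext. intros t. now rewrite <- EL. }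
assert (ER : forall x, Cexp (x, a) = (RtoC (exp x) * Cexp (0, a))%C).
{ intros x. rewrite RtoC_exp, <- Cexp_plus. f_equal. unfold RtoC, Cplus; simpl. f_equal; ring. }
assert (HR : forall x, X <= x -> Re (H (x, a)) <= b - c * (exp x - exp X)).
{ intros x Hx.
  assert (I := Re_increment (fun x => H (x, a)) (fun x => kap (x, a) * Cexp (x, a))%C
    (fun x => - c * exp x) (fun x => - c * exp x) X x Hx).
  cbv beta in I.
  enough (Re (H (x, a)) - Re (H (X, a)) <= - c * exp x - - c * exp X) by lra.
  apply I. intros t Htt. split; [|split].
  - apply (Dline H), HH.
  - auto_derive; [easy|ring].
  - rewrite ER. replace (kap (t, a) * (RtoC (exp t) * Cexp (0%R, a)))%C with (RtoC (exp t) * (Cexp (0%R, a) * kap (t, a)))%C by ring.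
    replace (Re (RtoC (exp t) * (Cexp (0%R, a) * kap (t, a)))%C) with (exp t * Re (Cexp (0, a) * kap (t, a))%C)
      by (unfold RtoC, Cmult, Re; simpl; ring).
    assert (T := Ht t ltac:(lra)). assert (0 < exp t) by apply exp_pos. nra. }
assert (HPx : forall x, X <= x -> Cmod (P (x, a) - P (X, a))%C <= exp (lam * b) / (lam * c)).
{ intros x Hx.
  (* An exact primitive of the majorant, in which the factor e^x of the measure is the derivative of
     e^x in the exponent. *)
  set (psi := fun x => - exp (lam * (b - c * (exp x - exp X))) / (lam * c)).
  apply Rle_trans with (psi x - psi X).
  - apply (path_dominated (fun x => P (x, a)) (fun x => Cexp (RtoC lam * H (x, a)) * Cexp (x, a))%C psi
      (fun x => exp (lam * (b - c * (exp x - exp X))) * exp x)); [easy|].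
    intros t Htt. split; [|split].
    + apply (Dline P), HP.
    + unfold psi. auto_derive; [easy|]. unfold Rminus. field. lra.
    + rewrite Cmod_mult, !Cmod_Cexp. change (Re (t, a)) with t.
      apply Rmult_le_compat_r; [left; apply exp_pos|].
      apply exp_le. replace (Re (RtoC lam * H (t, a))) with (lam * Re (H (t, a))) by (unfold Cmult, RtoC, Re; simpl; ring).
      apply Rmult_le_compat_l; [lra|]. apply HR; lra.
  - unfold psi. replace (lam * (b - c * (exp X - exp X))) with (lam * b) by ring.
    assert (0 < exp (lam * (b - c * (exp x - exp X))) / (lam * c)).
    { apply Rdiv_lt_0_compat; [apply exp_pos|nra]. }
    unfold Rdiv in *. rewrite !Ropp_mult_distr_l_reverse. lra. }
apply le_epsilon. intros e He.
destruct (Hlim e He) as [X' HX'].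
set (x := Rmax X X').
assert (H1 := HX' x (Rmax_r _ _)). assert (H2 := HPx x (Rmax_l _ _)).
rewrite Cmod_sub_sym in H1.
eapply Rle_trans; [apply (Cmod_triangle3 Pp (P (x, a)) (P (X, a)))|]. lra.
Qed.

(* Large enough for [wide a1 * sin a1 >= 2 * PI]. *)
Definition wide (a1 : R) : R := 2 * PI / sin a1 + 1.

(** One number that bounds |e^zeta|, the distance from zeta to i th and the length of every segment
    used in the box |x| <= wide a1. *)
Definition box_bound (a1 : R) : R := exp (wide a1) + 2 * wide a1 + 4 * PI.

Lemma sin_ge_obtuse (a a1 : R) : PI / 2 <= a <= a1 -> a1 < PI -> sin a1 <= sin a.
Proof.
intros Ha Ha1. destruct (Req_dec a a1) as [->|N]; [lra|].
left. apply sin_decreasing_1; lra.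
Qed.

(** The model u (log u - 1 - i th) with u = e^zeta has zeta-derivative (zeta - i th) e^zeta. This
    formula and the next give the sign of its real part along a horizontal and along a vertical
    move. *)
Lemma Re_slope_h (x a th h : R) :
  Re (((x, a) - (0, th)) * Cexp (x, a) * (h, 0))%C = h * (x * cos a - (a - th) * sin a) * exp x.
Proof. unfold Cexp, polar, Cmult, Cminus, Cplus, Copp, Re, Im; simpl; ring. Qed.

Lemma Re_slope_v (x a th h : R) :
  Re (((x, a) - (0, th)) * Cexp (x, a) * (0, h))%C = - h * (x * sin a + (a - th) * cos a) * exp x.
Proof. unfold Cexp, polar, Cmult, Cminus, Cplus, Copp, Re, Im; simpl; ring. Qed.

(* The path from (x0, b0) to the ray at angle a1 consists of segments parallel to
   the axes of the (log |s|, arg s)-plane; along each of them the real part of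
   the model u (log u - 1 - i th) decreases. *)
Lemma path_to_ray (a1 th eta lam B x0 b0 : R) (H kap P : C -> C) :
  PI / 2 < a1 < PI -> 0 <= eta -> 0 <= lam -> - a1 <= th -> th <= b0 <= a1 -> Rabs x0 <= wide a1 ->
  (forall x a, Rabs x <= wide a1 -> Rabs a <= a1 ->
     is_Cder H (x, a) (kap (x, a) * Cexp (x, a))%C /\
     is_Cder P (x, a) (Cexp (RtoC lam * H (x, a)) * Cexp (x, a))%C /\
     Cmod (kap (x, a) - ((x, a) - (0, th)))%C <= eta * Cmod ((x, a) - (0, th))%C) ->
  (b0 <= 0 -> x0 <= 0) -> (PI / 2 <= b0 -> 0 <= x0) ->
  Re (H (x0, b0)) <= B ->
  let A := box_bound a1 in
  let d := eta * (A * A * A) in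
  Re (H (wide a1, a1)) <= B + 7 * d /\
  Cmod (P (wide a1, a1) - P (x0, b0))%C <= 7 * (A * A * exp (lam * (B + 7 * d))).
Proof.
intros Ha1 Heta Hlam Hth Hb0 Hx0 Hbox Hneg Hpos HB A d.
assert (HPI := PI_RGT_0).
set (X := wide a1) in *.
assert (Hs1 : 0 < sin a1) by (apply sin_gt_0; lra).
assert (HX1 : 2 * PI <= X * sin a1).
{ unfold X, wide. replace ((2 * PI / sin a1 + 1) * sin a1) with (2 * PI + sin a1) by (field; lra). lra. }
assert (HX0 : 0 < X) by nra.
assert (HA : X + 2 * PI <= A /\ 2 * X <= A /\ 4 * PI <= A /\ exp X <= A).
{ unfold A, box_bound. fold X. assert (0 < exp X) by apply exp_pos. lra. }
assert (Hd : 0 <= d) by (unfold d; apply Rmult_le_pos; [easy|]; repeat apply Rmult_le_pos; lra).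
set (M := exp (lam * (B + 7 * d))).
(* The number n counts the segments travelled; each of them may cost d in Re H and A^2 M in P. The
   longest route has seven. *)
set (Reach := fun n z => Re (H z) <= B + n * d /\ Cmod (P z - P (x0, b0))%C <= n * (A * A * M)).
assert (HM : 0 <= A * A * M) by (apply Rmult_le_pos; [nra|left; apply exp_pos]).
assert (Mono : forall n n' z, n <= n' -> Reach n z -> Reach n' z).
{ intros n n' z Hn [R1 R2]. split.
  - assert (n * d <= n' * d) by (apply Rmult_le_compat_r; lra). lra.
  - assert (n * (A * A * M) <= n' * (A * A * M)) by (apply Rmult_le_compat_r; lra). lra. }
assert (Step : forall n za v, 0 <= n <= 6 -> Reach n za -> Cmod v <= A ->
  (forall t, 0 <= t <= 1 -> let z := (za + RtoC t * v)%C in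
     Rabs (Re z) <= X /\ Rabs (Im z) <= a1 /\ Re ((z - (0, th)) * Cexp z * v)%C <= 0) ->
  Reach (n + 1) (za + v)%C).
{ intros n za v Hn [R1 R2] Hv Hz.
  destruct (saddle_move th eta lam A H kap P za v Heta Hlam ltac:(lra)) as [S1 S2]; [|exact Hv|].
  - intros t Ht z. destruct (Hz t Ht) as [Z1 [Z2 Z3]]. fold z in Z1, Z2, Z3.
    destruct z as [x a]. change (Re (x, a)) with x in Z1. change (Im (x, a)) with a in Z2.
    destruct (Hbox x a Z1 Z2) as [B1 [B2 B3]].
    split; [exact B1|]. split; [exact B2|]. split; [|split; [|exact Z3]].
    + eapply Rle_trans; [exact B3|]. apply Rmult_le_compat_l; [easy|].
      eapply Rle_trans; [apply Cmod_le_abs|].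
      change (Re ((x, a) - (0, th))%C) with (x - 0). change (Im ((x, a) - (0, th))%C) with (a - th).
      rewrite Rminus_0_r. apply Rabs_le_between in Z2.
      assert (Rabs (a - th) <= 2 * PI) by (apply Rabs_le; lra). lra.
    + rewrite Cmod_Cexp. eapply Rle_trans; [apply exp_le|apply HA].
      eapply Rle_trans; [apply Rle_abs|exact Z1].
  - fold d in S1, S2. split; [lra|].
    replace ((n + 1) * (A * A * M)) with (A * A * M + n * (A * A * M)) by ring.
    eapply Rle_trans; [apply (Cmod_triangle3 _ (P za))|].
    apply Rplus_le_compat; [|exact R2].
    eapply Rle_trans; [exact S2|]. apply Rmult_le_compat_l; [nra|].
    apply exp_le, Rmult_le_compat_l; [easy|].
    assert (n * d <= 6 * d) by (apply Rmult_le_compat_r; lra). lra. }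
assert (StepH : forall n x x' a, 0 <= n <= 6 -> Reach n (x, a) -> Rabs x <= X -> Rabs x' <= X -> Rabs a <= a1 ->
  (forall y, Rmin x x' <= y <= Rmax x x' -> (x' - x) * (y * cos a - (a - th) * sin a) <= 0) -> Reach (n + 1) (x', a)).
{ intros n x x' a Hn HR Hx Hx' Ha Hs.
  replace (x', a) with ((x, a) + ((x' - x)%R, 0))%C by (unfold Cplus, RtoC; simpl; f_equal; ring).
  apply Step; auto.
  - eapply Rle_trans; [apply Cmod_le_abs|]. unfold RtoC, Re, Im; simpl. rewrite Rabs_R0.
    apply Rabs_le_between in Hx, Hx'. assert (Rabs (x' - x) <= 2 * X) by (apply Rabs_le; lra). lra.
  - intros t Ht z.
    assert (Ez : z = ((x + t * (x' - x))%R, a)).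
    { unfold z, RtoC, Cplus, Cmult; simpl. f_equal; ring. }
    rewrite Ez. change (Re ((x + t * (x' - x))%R, a)) with (x + t * (x' - x)).
    change (Im ((x + t * (x' - x))%R, a)) with a.
    assert (Hin : Rmin x x' <= x + t * (x' - x) <= Rmax x x').
    { unfold Rmin, Rmax. destruct (Rle_dec x x'); nra. }
    split; [|split; [exact Ha|]].
    + apply Rabs_le_between in Hx, Hx'. apply Rabs_le. 
      unfold Rmin, Rmax in Hin. destruct (Rle_dec x x'); lra.
    + unfold RtoC. rewrite Re_slope_h. assert (S := Hs _ Hin).
      set (y := x + t * (x' - x)) in *. assert (0 < exp y) by apply exp_pos. nra. }
assert (StepV : forall n x a a', 0 <= n <= 6 -> Reach n (x, a) -> Rabs x <= X -> - a1 <= a -> a <= a' -> a' <= a1 ->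
  (forall y, a <= y <= a' -> 0 <= x * sin y + (y - th) * cos y) -> Reach (n + 1) (x, a')).
{ intros n x a a' Hn HR Hx Ha Haa Ha' Hs.
  replace (x, a') with ((x, a) + (0%R, (a' - a)%R))%C by (unfold Cplus; simpl; f_equal; ring).
  apply Step; auto.
  - eapply Rle_trans; [apply Cmod_le_abs|]. unfold Re, Im; simpl. rewrite Rabs_R0.
    assert (Rabs (a' - a) <= 4 * PI) by (apply Rabs_le; lra). lra.
  - intros t Ht z.
    assert (Ez : z = (x, (a + t * (a' - a))%R)).
    { unfold z, RtoC, Cplus, Cmult; simpl. f_equal; ring. }
    rewrite Ez. change (Re (x, (a + t * (a' - a))%R)) with x.
    change (Im (x, (a + t * (a' - a))%R)) with (a + t * (a' - a)).
    assert (Hin : a <= a + t * (a' - a) <= a') by nra.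
    split; [exact Hx|split].
    + apply Rabs_le; lra.
    + rewrite Re_slope_v. assert (S := Hs _ Hin). assert (0 < exp x) by apply exp_pos.
      assert (0 <= (a' - a) * (x * sin (a + t * (a' - a)) + (a + t * (a' - a) - th) * cos (a + t * (a' - a)))) by (apply Rmult_le_pos; lra).
      nra. }
(* In the upper left quadrant of s: outwards to |x| = X, then up. On the vertical move X sin a1 >= 2
   PI outweighs (y - th) cos y. *)
assert (PA : forall n x a, 0 <= n <= 5 -> 0 <= x <= X -> PI / 2 <= a <= a1 -> th <= a -> Reach n (x, a) -> Reach (n + 2) (X, a1)).
{ intros n x a Hn Hx Ha Hta HR. replace (n + 2) with (n + 1 + 1) by ring.
  apply StepV with (a := a); try lra; [|rewrite Rabs_pos_eq; lra|].
  - apply StepH with (x := x); try lra; auto; try (rewrite Rabs_pos_eq; lra).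
    intros y Hy. rewrite Rmin_left, Rmax_right in Hy by lra.
    assert (cos a <= 0) by (apply cos_le_0; lra).
    assert (0 <= sin a) by (apply sin_ge_0; lra).
    assert (0 <= (a - th) * sin a) by (apply Rmult_le_pos; lra).
    assert (0 <= y * - cos a) by (apply Rmult_le_pos; lra).
    assert (0 <= (X - x) * ((a - th) * sin a + y * - cos a)) by (apply Rmult_le_pos; lra). lra.
  - intros y Hy. assert (S := sin_ge_obtuse y a1 ltac:(lra) ltac:(lra)).
    assert (C := COS_bound y). 
    assert (X * sin a1 <= X * sin y) by (apply Rmult_le_compat_l; lra).
    assert (- (y - th) <= (y - th) * cos y) by nra. lra. }
(* In the upper right quadrant of s: if x < 0, first outwards to x = 0, where turning becomes
   downhill; then up to PI / 2. *)
assert (PB : forall n x a, 0 <= n <= 3 -> Rabs x <= X -> 0 <= a <= PI / 2 -> th <= a -> Reach n (x, a) -> Reach (n + 4) (X, a1)).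
{ assert (PB' : forall n x a, 0 <= n <= 4 -> 0 <= x <= X -> 0 <= a <= PI / 2 -> th <= a -> Reach n (x, a) -> Reach (n + 3) (X, a1)).
  { intros n x a Hn Hx Ha Hta HR. replace (n + 3) with (n + 1 + 2) by ring.
    apply (PA (n + 1) x (PI / 2)); try lra.
    apply StepV with (a := a); try lra; auto; [rewrite Rabs_pos_eq; lra|].
    intros y Hy. assert (0 <= cos y) by (apply cos_ge_0; lra). assert (0 <= sin y) by (apply sin_ge_0; lra).
    assert (0 <= (y - th) * cos y) by (apply Rmult_le_pos; lra).
    assert (0 <= x * sin y) by (apply Rmult_le_pos; lra). lra. }
  intros n x a Hn Hx Ha Hta HR.
  destruct (Rle_lt_dec 0 x) as [Hx'|Hx'].
  - apply Mono with (n := n + 3); [lra|]. apply (PB' n x a); auto; [lra|].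
    rewrite Rabs_pos_eq in Hx; lra.
  - replace (n + 4) with (n + 1 + 3) by ring. apply (PB' (n + 1) 0 a); try lra.
    apply StepH with (x := x); try lra; auto; [rewrite Rabs_R0; lra|rewrite Rabs_pos_eq; lra|].
    intros y Hy. rewrite Rmin_left, Rmax_right in Hy by lra.
    assert (0 <= cos a) by (apply cos_ge_0; lra). assert (0 <= sin a) by (apply sin_ge_0; lra).
    assert (0 <= (a - th) * sin a) by (apply Rmult_le_pos; lra).
    assert (0 <= - y * cos a) by (apply Rmult_le_pos; lra).
    assert (0 <= (0 - x) * ((a - th) * sin a + - y * cos a)) by (apply Rmult_le_pos; lra). lra. }
(* For -PI / 2 <= a <= 0 turning is downhill because x <= 0 and sin <= 0. *)
assert (PC : forall n x a, 0 <= n <= 2 -> Rabs x <= X -> x <= 0 -> - PI / 2 <= a <= 0 -> th <= a -> Reach n (x, a) -> Reach (n + 5) (X, a1)).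
{ intros n x a Hn Hx Hx' Ha Hta HR. replace (n + 5) with (n + 1 + 4) by ring.
  apply (PB (n + 1) x 0); try lra.
  apply StepV with (a := a); try lra; auto.
  intros y Hy. assert (0 <= cos y) by (apply cos_ge_0; lra).
  assert (0 <= sin (- y)) by (apply sin_ge_0; lra). rewrite sin_neg in *.
  assert (0 <= (y - th) * cos y) by (apply Rmult_le_pos; lra).
  assert (0 <= - x * - sin y) by (apply Rmult_le_pos; lra). lra. }
(* Below -PI / 2 the cosine is negative, so turning is downhill only if x sin y is large; since sin
   y < 0, the path first goes inwards to x = -X. *)
assert (PD : forall x a, Rabs x <= X -> x <= 0 -> - a1 <= a <= - PI / 2 -> th <= a -> Reach 0 (x, a) -> Reach 7 (X, a1)).
{ intros x a Hx Hx' Ha Hta HR. replace 7 with (0 + 1 + 1 + 5) by ring.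
  assert (HmX : Rabs (- X) <= X) by (rewrite Rabs_Ropp, Rabs_pos_eq; lra).
  apply (PC _ (- X) (- PI / 2)); try lra; auto.
  apply StepV with (a := a); try lra; auto.
  - apply StepH with (x := x); try lra; auto.
    + apply Rabs_le; lra.
    + intros y Hy. apply Rabs_le_between in Hx. rewrite Rmin_right, Rmax_left in Hy by lra.
      assert (0 <= sin (- a)) by (apply sin_ge_0; lra). rewrite sin_neg in *.
      assert (cos (- a) <= 0) by (apply cos_le_0; lra). rewrite cos_neg in *.
      assert (0 <= (a - th) * (- sin a)) by (apply Rmult_le_pos; lra).
      assert (0 <= - y * - cos a) by (apply Rmult_le_pos; lra).
      assert (0 <= (x - - X) * ((a - th) * - sin a + - y * - cos a)) by (apply Rmult_le_pos; lra). lra.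
  - intros y Hy. assert (S := sin_ge_obtuse (- y) a1 ltac:(lra) ltac:(lra)). rewrite sin_neg in S.
    assert (C := COS_bound y).
    assert (X * sin a1 <= X * - sin y) by (apply Rmult_le_compat_l; lra).
    assert (- (y - th) <= (y - th) * cos y) by nra. lra. }
enough (R7 : Reach 7 (X, a1)) by exact R7.
assert (R0 : Reach 0 (x0, b0)).
{ split; [lra|]. replace (P (x0, b0) - P (x0, b0))%C with (RtoC 0) by ring. rewrite Cmod_0; lra. }
destruct (Rle_lt_dec b0 (- PI / 2)) as [H1|H1]; [apply (PD x0 b0); auto; lra|].
destruct (Rle_lt_dec b0 0) as [H2|H2].
{ apply Mono with (n := 0 + 5); [lra|]. apply (PC 0 x0 b0); auto; lra. }
destruct (Rle_lt_dec b0 (PI / 2)) as [H3|H3].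
{ apply Mono with (n := 0 + 4); [lra|]. apply (PB 0 x0 b0); auto; lra. }
apply Mono with (n := 0 + 2); [lra|]. apply (PA 0 x0 b0); auto; try lra.
assert (0 <= x0) by (apply Hpos; lra). rewrite Rabs_pos_eq in Hx0; lra.
Qed.

(** * The uniform saddle point estimate *)

Lemma exp_opp_le (y : R) : 0 < y -> exp (- y) <= / y.
Proof.
intros Hy. rewrite exp_Ropp. apply Rinv_le_contravar; [easy|].
assert (H := exp_ineq1_le y). lra.
Qed.

(* To be applied, with zeta = log (s / |s_z|) = (x, a) and th = arg s_z, to
   H = h / lam, kap = (Phi - Phi (s_z)) / epsilon (|s_z|) and P = F / |s_z|, where
   h (s) = log gamma (s) - s log z, F' = exp h and lam = |s_z| epsilon (|s_z|). *)
Lemma saddle_upper (b a1 c err : R) :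
  0 <= b < a1 -> PI / 2 < a1 < PI -> 0 < c -> 0 < err ->
  exists eta Lam, 0 < eta /\ 0 < Lam /\
  forall (th lam : R) (H kap P : C -> C) (Pp : C),
  Rabs th <= b -> Lam <= lam ->
  (forall x a, Rabs a <= a1 -> is_Cder H (x, a) (kap (x, a) * Cexp (x, a))%C) ->
  (forall x a, Rabs a <= a1 -> is_Cder P (x, a) (Cexp (RtoC lam * H (x, a)) * Cexp (x, a))%C) ->
  (forall x a, Rabs x <= wide a1 -> Rabs a <= a1 ->
     Cmod (kap (x, a) - ((x, a) - (0, th)))%C <= eta * Cmod ((x, a) - (0, th))%C) ->
  (forall x, 0 <= x -> Re (Cexp (0, a1) * kap (x, a1))%C <= - c) ->
  (forall e, 0 < e -> exists X', forall x, X' <= x -> Cmod (P (x, a1) - Pp)%C <= e) ->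
  Cmod (Pp - P (0, th) - Ci * Cexp (0, (th / 2)%R) * Cexp (RtoC lam * H (0%R, th))
          * RtoC (sqrt PI / 2 / sqrt (lam / 2)))%C
    <= err * (exp (lam * Re (H (0, th))) / sqrt lam).
Proof.
intros Hb Ha1 Hc Herr. assert (HPI := PI_RGT_0).
(* The bound 1/16 is the one of [local_half]; a1 - b keeps the segment within |arg s| <= a1 for all
   |th| <= b. *)
set (t1 := Rmin (/ 16) (a1 - b)).
assert (Ht1 : 0 < t1) by (apply Rmin_glb_lt; lra).
assert (Ht1' : t1 <= / 16) by apply Rmin_l.
assert (Ht1'' : t1 <= a1 - b) by apply Rmin_r.
set (A := box_bound a1).
assert (Hs1 : 0 < sin a1) by (apply sin_gt_0; lra).
assert (HX0 : 1 <= wide a1).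
{ unfold wide. assert (0 < 2 * PI / sin a1) by (apply Rdiv_lt_0_compat; lra). lra. }
assert (HA : 0 < A).
{ unfold A, box_bound. assert (0 < exp (wide a1)) by apply exp_pos. lra. }
assert (HA3 : 0 < A * A * A) by (repeat apply Rmult_lt_0_compat; easy).
(* The bound 1/24 is needed by [local_half], and err / 288 makes its term 144 eta at most err / 2.
   The last bound keeps the loss 7 eta A^3 on the seven segments below t1^2 / 8, half of the drop
   t1^2 / 4. *)
set (eta := Rmin (Rmin (/ 24) (err / 288)) (t1 * t1 / (56 * (A * A * A)))).
assert (Heta : 0 < eta).
{ repeat apply Rmin_glb_lt; [lra|lra|]. apply Rdiv_lt_0_compat; nra. }
assert (Heta1 : eta <= / 24) by (eapply Rle_trans; [apply Rmin_l|apply Rmin_l]).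
assert (Heta2 : eta <= err / 288) by (eapply Rle_trans; [apply Rmin_l|apply Rmin_r]).
assert (Heta3 : 7 * (eta * (A * A * A)) <= t1 * t1 / 8).
{ assert (E : eta <= t1 * t1 / (56 * (A * A * A))) by apply Rmin_r.
  apply Rle_div_r in E; [|lra]. lra. }
(* D collects the path to the ray and the tail. K collects everything of relative size 1 / lam: the
   term 54 / lam, the Gaussian tail and, through exp(-y) <= 1 / y, the part of the path far from the
   saddle point. *)
set (D := 7 * (A * A) + / c).
assert (Hci : 0 < / c) by now apply Rinv_0_lt_compat.
assert (HD : 0 < D) by (unfold D; nra).
set (K := 54 + 8 / (t1 * t1) + 8 * D / (t1 * t1)).
assert (Htt : 0 < t1 * t1) by nra.
assert (HK : 0 < K).
{ unfold K. assert (0 < 8 / (t1 * t1)) by (apply Rdiv_lt_0_compat; lra).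
  assert (0 < 8 * D / (t1 * t1)) by (apply Rdiv_lt_0_compat; lra). lra. }
exists eta, (1 + (2 * K / err) ^ 2). split; [easy|]. split.
{ assert (0 <= (2 * K / err) ^ 2) by apply pow2_ge_0. lra. }
intros th lam H kap P Pp Hth Hlam HH HP Hk Htail Hlim.
assert (Hlam1 : 1 <= lam) by (assert (0 <= (2 * K / err) ^ 2) by apply pow2_ge_0; lra).
apply Rabs_le_between in Hth.
assert (Hdir : Rabs (sin (th / 2)) <= 1 /\ 0 <= cos (th / 2) <= 1).
{ split; [apply Rabs_le, SIN_bound|]. split; [apply cos_ge_0; lra|apply COS_bound]. }
assert (Ez : forall t, ((0, th) + RtoC t * dir th)%C = ((t * sin (th / 2))%R, (th + t * cos (th / 2))%R)).
{ intros t. unfold dir, RtoC, Cplus, Cmult; simpl. f_equal; ring. }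
assert (Hin : forall t, 0 <= t <= t1 -> Rabs (t * sin (th / 2)) <= wide a1 /\ Rabs (th + t * cos (th / 2)) <= a1).
{ intros t Ht. split.
  - rewrite Rabs_mult, Rabs_pos_eq by lra. assert (Q := Rabs_pos (sin (th / 2))). nra.
  - assert (0 <= t * cos (th / 2) <= t1) by nra. apply Rabs_le; lra. }
destruct (local_half th t1 eta lam H kap P) as [L1 L2]; try lra.
{ intros t Ht. rewrite Ez. apply HH, Hin, Ht. }
{ intros t Ht. rewrite Ez. apply HP, Hin, Ht. }
{ intros t Ht. destruct (Hin t Ht) as [I1 I2]. specialize (Hk _ _ I1 I2).
  rewrite <- Ez in Hk. replace ((0, th) + RtoC t * dir th - (0, th))%C with (RtoC t * dir th)%C in Hk by ring.
  rewrite (Cmod_mult (RtoC t)), Cmod_dir, Cmod_R, Rabs_pos_eq, Rmult_1_r in Hk by lra. exact Hk. }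
set (x1 := t1 * sin (th / 2)). set (b1 := th + t1 * cos (th / 2)).
rewrite Ez in L1, L2. fold x1 b1 in L1, L2.
destruct (Hin t1 ltac:(lra)) as [I1 I2]. fold x1 b1 in I1, I2.
set (H0 := Re (H (0, th))) in *.
assert (Hb1 : th <= b1 <= a1).
{ unfold b1. assert (0 <= t1 * cos (th / 2) <= t1) by nra. lra. }
(* The direction of steepest descent leans towards the sign of th, since x1 = t1 sin(th / 2). This
   gives the two sign conditions on the starting point; as t1 <= 1/16, b1 >= PI / 2 forces th >=
   0. *)
destruct (path_to_ray a1 th eta lam (H0 - t1 * t1 / 4) x1 b1 H kap P) as [Q1 Q2]; try lra; auto.
{ intros Hneg. unfold b1, x1 in *. assert (th <= 0) by nra.
  assert (0 <= sin (- (th / 2))) by (apply sin_ge_0; lra). rewrite sin_neg in *. nra. }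
{ intros Hpos. unfold b1, x1 in *. assert (0 <= th) by (assert (t1 * cos (th / 2) <= t1) by nra; assert (PI2 := PI2_1); unfold b1, x1 in *; lra).
  assert (0 <= sin (th / 2)) by (apply sin_ge_0; lra). nra. }
fold A in Q1, Q2.
set (d := eta * (A * A * A)) in *.
assert (T := saddle_tail a1 c lam (H0 - t1 * t1 / 8) (wide a1) H kap P Pp Hc ltac:(lra) ltac:(lra)
  (fun x => HH x a1 ltac:(rewrite Rabs_pos_eq; lra)) (fun x => HP x a1 ltac:(rewrite Rabs_pos_eq; lra)) Htail Hlim ltac:(lra)).
assert (Q3 : Cmod (P (wide a1, a1) - P (x1, b1))%C <= 7 * (A * A) * exp (lam * (H0 - t1 * t1 / 8))).
{ eapply Rle_trans; [exact Q2|].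
  rewrite (Rmult_assoc 7). apply Rmult_le_compat_l; [lra|]. apply Rmult_le_compat_l; [nra|].
  apply exp_le, Rmult_le_compat_l; lra. }
set (S := sqrt lam).
assert (HS : 0 < S) by (apply sqrt_lt_R0; lra).
assert (HSS : S * S = lam) by (apply sqrt_sqrt; lra).
assert (HS1 : 1 <= S) by nra.
set (E0 := exp (lam * H0)) in *.
assert (HE0 : 0 < E0) by apply exp_pos.
assert (Hexp8 : exp (lam * (H0 - t1 * t1 / 8)) <= E0 * (8 / (t1 * t1)) / lam).
{ replace (lam * (H0 - t1 * t1 / 8)) with (lam * H0 + - (lam * (t1 * t1 / 8))) by ring.
  rewrite exp_plus. fold E0. unfold Rdiv at 2. rewrite Rmult_assoc.
  apply Rmult_le_compat_l; [lra|].
  eapply Rle_trans; [apply exp_opp_le; nra|]. right. field. lra. }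
assert (T' : Cmod (Pp - P (wide a1, a1))%C <= / c * exp (lam * (H0 - t1 * t1 / 8))).
{ eapply Rle_trans; [exact T|]. unfold Rdiv. rewrite Rmult_comm. apply Rmult_le_compat_r; [left; apply exp_pos|].
  apply Rinv_le_contravar; nra. }
assert (Far : Cmod (Pp - P (x1, b1))%C <= E0 * (8 * D / (t1 * t1)) / lam).
{ eapply Rle_trans; [apply (Cmod_triangle3 Pp (P (wide a1, a1)) (P (x1, b1)))|].
  apply Rle_trans with (D * exp (lam * (H0 - t1 * t1 / 8))); [unfold D; lra|].
  replace (E0 * (8 * D / (t1 * t1)) / lam) with (D * (E0 * (8 / (t1 * t1)) / lam)) by (field; lra).
  apply Rmult_le_compat_l; lra. }
set (main := (Ci * Cexp (0, (th / 2)%R) * Cexp (RtoC lam * H (0%R, th)) * RtoC (sqrt PI / 2 / sqrt (lam / 2)))%C) in *.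
replace (Pp - P (0%R, th) - main)%C with ((Pp - P (x1, b1)) + (P (x1, b1) - P (0%R, th) - main))%C by ring.
eapply Rle_trans; [apply Cmod_triangle|].
eapply Rle_trans; [apply Rplus_le_compat; [exact Far|exact L1]|].
assert (Hk1 : / sqrt (lam / 2) <= 2 / S).
{ replace (2 / S) with (/ (S / 2)) by (field; lra). apply Rinv_le_contravar; [lra|].
  apply Rsqr_incr_0_var; [|apply sqrt_pos]. rewrite Rsqr_sqrt by lra. unfold Rsqr. rewrite <- HSS. nra. }
assert (Hk2 : / sqrt (lam / 4) = 2 / S).
{ replace (lam / 4) with (S / 2 * (S / 2)) by (rewrite <- HSS; field). rewrite sqrt_square by lra. field. lra. }
assert (Hlami : / lam <= / S) by (apply Rinv_le_contravar; nra).
assert (HSi : 0 < / S) by now apply Rinv_0_lt_compat.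
assert (HlamI : / lam = / S * / S) by (rewrite <- HSS; field; lra).
assert (Hex : exp (- (lam / 2 * (t1 * t1))) <= 2 / (t1 * t1) * / S).
{ eapply Rle_trans; [apply exp_opp_le; nra|].
  replace (/ (lam / 2 * (t1 * t1))) with (2 / (t1 * t1) * / lam) by (field; lra).
  apply Rmult_le_compat_l; [left; apply Rdiv_lt_0_compat; lra|exact Hlami]. }
assert (HKS : K / S <= err / 2).
{ apply Rle_div_l; [lra|].
  assert (2 * K / err <= S).
  { apply Rsqr_incr_0_var; [|lra]. unfold Rsqr. rewrite HSS. simpl in Hlam. lra. }
  assert (2 * K / err * err <= S * err) by (apply Rmult_le_compat_r; lra).
  replace (2 * K / err * err) with (2 * K) in * by (field; lra). lra. }
apply Rle_trans with (E0 * (144 * eta + K / S) / S).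
2:{ replace (err * (E0 / S)) with (E0 * err / S) by (field; lra).
    apply Rmult_le_compat_r; [lra|]. apply Rmult_le_compat_l; lra. }
set (ex := exp (- (lam / 2 * (t1 * t1)))) in *.
assert (Hex0 : 0 < ex) by apply exp_pos.
assert (Hprod : ex * / sqrt (lam / 2) <= 2 / (t1 * t1) * / S * (2 / S)).
{ apply Rmult_le_compat; try lra. left; apply Rinv_0_lt_compat, sqrt_lt_R0; lra. }
unfold Rdiv in *. rewrite Hk2, HlamI.
replace (E0 * (144 * eta + K * / S) * / S) with
  (E0 * (8 * D * / (t1 * t1)) * (/ S * / S) + E0 * (54 * (/ S * / S) + 72 * eta * (2 * / S) + 2 * (2 * / (t1 * t1) * / S * (2 * / S))))
  by (unfold K, Rdiv; ring).
apply Rplus_le_compat_l, Rmult_le_compat_l; [lra|]. apply Rplus_le_compat_l. lra.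
Qed.

Lemma Cder_conj (f : C -> C) (z l : C) :
  is_Cder f (Cconj z) l -> is_Cder (fun w => Cconj (f (Cconj w))) z (Cconj l).
Proof.
intros H. apply Cder_eps. intros e He.
destruct (proj1 (Cder_eps _ _ _) H e He) as [d [Hd Hd']].
exists d; split; [easy|]. intros w Hw.
replace (Cconj (f (Cconj w)) - Cconj (f (Cconj z)) - Cconj l * (w - z))%C
  with (Cconj (f (Cconj w) - f (Cconj z) - l * (Cconj w - Cconj z)))%C.
- rewrite Cmod_conj, <- (Cmod_conj (w - z)), Cminus_conj. apply Hd'.
  now rewrite <- Cminus_conj, Cmod_conj.
- rewrite !Cminus_conj, Cmult_conj, Cminus_conj, !Cconj_conj. reflexivity.
Qed.

Lemma Cexp_conj (z : C) : Cexp (Cconj z) = Cconj (Cexp z).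
Proof.
destruct z as [x y]. unfold Cexp, polar, Cconj, Re, Im; simpl.
rewrite cos_neg, sin_neg. f_equal; ring.
Qed.

Lemma RtoC_conj (x : R) : Cconj (RtoC x) = RtoC x.
Proof. unfold Cconj, RtoC; simpl. f_equal; ring. Qed.

(* The lower half of the contour is the upper half for the conjugate functions. *)
Lemma saddle_both (b a1 c err : R) :
  0 <= b < a1 -> PI / 2 < a1 < PI -> 0 < c -> 0 < err ->
  exists eta Lam, 0 < eta /\ 0 < Lam /\
  forall (th lam : R) (H kap P : C -> C) (Pp Pm : C),
  Rabs th <= b -> Lam <= lam ->
  (forall x a, Rabs a <= a1 -> is_Cder H (x, a) (kap (x, a) * Cexp (x, a))%C) ->
  (forall x a, Rabs a <= a1 -> is_Cder P (x, a) (Cexp (RtoC lam * H (x, a)) * Cexp (x, a))%C) ->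
  (forall x a, Rabs x <= wide a1 -> Rabs a <= a1 ->
     Cmod (kap (x, a) - ((x, a) - (0, th)))%C <= eta * Cmod ((x, a) - (0, th))%C) ->
  (forall x, 0 <= x -> Re (Cexp (0, a1) * kap (x, a1))%C <= - c) ->
  (forall x, 0 <= x -> Re (Cexp (0, (- a1)%R) * kap (x, (- a1)%R))%C <= - c) ->
  (forall e, 0 < e -> exists X', forall x, X' <= x -> Cmod (P (x, a1) - Pp)%C <= e) ->
  (forall e, 0 < e -> exists X', forall x, X' <= x -> Cmod (P (x, (- a1)%R) - Pm)%C <= e) ->
  Cmod (Pp - Pm - Ci * Cexp (0, (th / 2)%R) * Cexp (RtoC lam * H (0%R, th))
          * RtoC (sqrt PI / sqrt (lam / 2)))%C
    <= err * (exp (lam * Re (H (0, th))) / sqrt lam).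
Proof.
intros Hb Ha1 Hc Herr.
destruct (saddle_upper b a1 c (err / 2) Hb Ha1 Hc ltac:(lra)) as [eta [Lam [Heta [HLam Up]]]].
exists eta, Lam. split; [easy|]. split; [easy|].
intros th lam H kap P Pp Pm Hth Hlam HH HP Hk Htp Htm Hlp Hlm.
assert (U1 := Up th lam H kap P Pp Hth Hlam HH HP Hk Htp Hlp).
set (cj := fun f : C -> C => fun z => Cconj (f (Cconj z))).
assert (U2 := Up (- th) lam (cj H) (cj kap) (cj P) (Cconj Pm)).
assert (EC : forall x a, Cconj (x, a) = (x, (- a)%R)) by reflexivity.
assert (Ab : forall a, Rabs a <= a1 -> Rabs (- a) <= a1) by (intros; now rewrite Rabs_Ropp).
assert (U3 := U2 ltac:(now rewrite Rabs_Ropp) Hlam). clear U2.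
assert (D1 : forall x a, Rabs a <= a1 -> is_Cder (cj H) (x, a) (cj kap (x, a) * Cexp (x, a))%C).
{ intros x a Ha. replace (cj kap (x, a) * Cexp (x, a))%C with (Cconj (kap (Cconj (x, a)) * Cexp (Cconj (x, a))))%C.
  - apply Cder_conj, HH, Ab, Ha.
  - rewrite Cmult_conj, Cexp_conj, Cconj_conj. reflexivity. }
assert (D2 : forall x a, Rabs a <= a1 -> is_Cder (cj P) (x, a) (Cexp (RtoC lam * cj H (x, a)) * Cexp (x, a))%C).
{ intros x a Ha.
  replace (Cexp (RtoC lam * cj H (x, a)) * Cexp (x, a))%C
    with (Cconj (Cexp (RtoC lam * H (Cconj (x, a))) * Cexp (Cconj (x, a))))%C.
  - apply Cder_conj, HP, Ab, Ha.
  - rewrite Cmult_conj, <- !Cexp_conj, Cmult_conj, RtoC_conj, Cconj_conj. reflexivity. }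
specialize (U3 D1 D2).
assert (U4 : Cmod (Cconj Pm - cj P (0, (- th)%R) - Ci * Cexp (0, (- th / 2)%R) * Cexp (RtoC lam * cj H (0%R, (- th)%R))
          * RtoC (sqrt PI / 2 / sqrt (lam / 2)))%C
    <= err / 2 * (exp (lam * Re (cj H (0, (- th)%R))) / sqrt lam)).
{ apply U3.
  - intros x a Hx Ha. unfold cj.
    replace (Cconj (kap (Cconj (x, a))) - ((x, a) - (0%R, (- th)%R)))%C
      with (Cconj (kap (x, (- a)%R) - ((x, (- a)%R) - (0%R, th))))%C.
    2:{ rewrite !Cminus_conj, !EC, Ropp_involutive. reflexivity. }
    replace ((x, a) - (0, (- th)%R))%C with (Cconj ((x, (- a)%R) - (0%R, th)))%C.
    2:{ rewrite !Cminus_conj, !EC, Ropp_involutive. reflexivity. }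
    rewrite !Cmod_conj. apply Hk; auto.
  - intros x Hx. unfold cj.
    replace (Cexp (0, a1) * Cconj (kap (Cconj (x, a1))))%C with (Cconj (Cexp (0%R, (- a1)%R) * kap (x, (- a1)%R)))%C.
    2:{ rewrite Cmult_conj, <- Cexp_conj, !EC, Ropp_involutive. reflexivity. }
    rewrite re_conj. apply Htm, Hx.
  - intros e He. destruct (Hlm e He) as [X' HX']. exists X'. intros x Hx.
    unfold cj. rewrite <- Cminus_conj, Cmod_conj. apply HX', Hx. }
unfold cj in U4. rewrite !EC, Ropp_involutive, re_conj in U4.
set (m := (Ci * Cexp (0, (th / 2)%R) * Cexp (RtoC lam * H (0%R, th)) * RtoC (sqrt PI / 2 / sqrt (lam / 2)))%C) in *.
(* Conjugating back changes the sign of the main part, as conj(i) = -i; hence the two halves add up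
   in Pp - Pm. *)
replace (Cconj Pm - Cconj (P (0%R, th)) - Ci * Cexp (0, (- th / 2)%R) * Cexp (RtoC lam * Cconj (H (0%R, th)))
   * RtoC (sqrt PI / 2 / sqrt (lam / 2)))%C with (Cconj (Pm - P (0%R, th) + m))%C in U4.
2:{ unfold m. rewrite Cplus_conj, Cminus_conj, !Cmult_conj, RtoC_conj, <- !Cexp_conj, Cmult_conj, RtoC_conj, EC.
    replace (Cconj Ci) with (- Ci)%C by (unfold Cconj, Ci, Copp; simpl; f_equal; ring).
    replace (- (th / 2)) with (- th / 2) by field. ring. }
rewrite Cmod_conj in U4.
replace (Pp - Pm - Ci * Cexp (0, (th / 2)%R) * Cexp (RtoC lam * H (0%R, th)) * RtoC (sqrt PI / sqrt (lam / 2)))%C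
  with ((Pp - P (0%R, th) - m) + - (Pm - P (0%R, th) + m))%C.
2:{ unfold m. replace (sqrt PI / sqrt (lam / 2)) with (sqrt PI / 2 / sqrt (lam / 2) + sqrt PI / 2 / sqrt (lam / 2)).
    rewrite RtoC_plus. ring. field. apply Rgt_not_eq, sqrt_lt_R0. lra. }
eapply Rle_trans; [apply Cmod_triangle|]. rewrite Cmod_opp. lra.
Qed.

(** * The angle and the logarithm of gamma *)

(** An inequality without arguments: openness, star-shapedness and stability under shifts of the
    sector become consequences of the triangle inequality. *)
Lemma sector_iff (a : R) (z : C) : 0 < a <= PI -> sector a 0 z <-> cos a * Cmod z < Re z.
Proof.
intros Ha. split.
- intros [r [t [Hr [Ht ->]]]]. rewrite Cmod_polar by lra.
  change (Re (polar r t)) with (r * cos t). rewrite (Rmult_comm (cos a)).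
  apply Rmult_lt_compat_l; [easy|].
  replace (cos t) with (cos (Rabs t)).
  + assert (H := Rabs_pos t). apply cos_decreasing_1; lra.
  + unfold Rabs. destruct (Rcase_abs t); [apply cos_neg|easy].
- intros H.
  assert (Hz : z <> 0) by (intros ->; rewrite Cmod_0 in H; unfold RtoC, Re in H; simpl in H; lra).
  assert (Hm : 0 < Cmod z) by now apply Cmod_gt_0.
  set (q := Re z / Cmod z).
  assert (Hq : -1 <= q <= 1).
  { assert (Q := re_le_Cmod z). apply Rabs_le_between in Q. unfold q; split.
    - apply Rle_div_r; lra.
    - apply Rle_div_l; lra. }
  assert (HqE : Re z = Cmod z * q) by (unfold q; field; lra).
  set (t := acos q).
  assert (Ht := acos_bound q). fold t in Ht.
  assert (Hct : cos t = q) by (apply cos_acos; lra).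
  assert (Hta : t < a).
  { destruct (Rlt_le_dec t a) as [G|G]; [easy|exfalso].
    assert (cos t <= cos a).
    { destruct (Req_dec a t) as [->|N]; [lra|]. left; apply cos_decreasing_1; lra. }
    rewrite HqE, Rmult_comm in H. apply Rmult_lt_reg_l in H; lra. }
  assert (Hst : 0 <= sin t) by (apply sin_ge_0; lra).
  assert (Him : Im z * Im z = (Cmod z * sin t) * (Cmod z * sin t)).
  { assert (Q := Cmod2_alt z). assert (S := sin2_cos2 t). unfold Rsqr in S. rewrite Hct in S.
    rewrite HqE in Q.
    replace (Cmod z * sin t * (Cmod z * sin t)) with (Cmod z * Cmod z * (sin t * sin t)) by ring.
    replace (sin t * sin t) with (1 - q * q) by lra.
    replace (Im z * Im z) with (Im z ^ 2) by ring. nra. }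
  assert (Hms : 0 <= Cmod z * sin t) by (apply Rmult_le_pos; lra).
  destruct (Rle_lt_dec 0 (Im z)) as [Hi|Hi].
  + exists (Cmod z), t. split; [easy|]. split; [rewrite Rabs_pos_eq; lra|].
    unfold polar. rewrite Hct, <- HqE. replace (Cmod z * sin t) with (Im z) by nra. now destruct z.
  + exists (Cmod z), (- t). split; [easy|]. split; [rewrite Rabs_Ropp, Rabs_pos_eq; lra|].
    unfold polar. rewrite cos_neg, sin_neg, Hct, <- HqE.
    replace (Cmod z * - sin t) with (Im z) by nra. now destruct z.
Qed.

(** Here a > PI / 2 matters: cos a is negative and at least -1, so Re z gains y while cos a |z|
    gains at most y. *)
Lemma sector_add (a y : R) (z : C) :
  PI / 2 < a <= PI -> 0 <= y -> cos a * Cmod z < Re z ->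
  cos a * Cmod (z + RtoC y) < Re (z + RtoC y)%C.
Proof.
intros Ha Hy H.
assert (Hc : cos a < 0) by (apply cos_lt_0; lra).
assert (Hc1 := COS_bound a).
change (Re (z + RtoC y)%C) with (Re z + y).
assert (T := Cmod_triangle (z + RtoC y) (- RtoC y)).
replace (z + RtoC y + - RtoC y)%C with z in T by ring.
rewrite Cmod_opp, Cmod_R, Rabs_pos_eq in T by easy.
assert (- cos a * (Cmod z - y) <= - cos a * Cmod (z + RtoC y)) by (apply Rmult_le_compat_l; lra).
nra.
Qed.

Lemma angle_iff (a c : R) (z : C) : PI / 2 < a <= PI ->
  angle a c z <-> cos a * Cmod (z + RtoC c) < Re (z + RtoC c)%C.
Proof. intros Ha. apply sector_iff. assert (H := PI_RGT_0). lra. Qed.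

Lemma angle_open (a c : R) : PI / 2 < a <= PI -> Copen (angle a c).
Proof.
intros Ha z Hz. apply angle_iff in Hz; [|easy].
set (u := (z + RtoC c)%C) in *.
exists ((Re u - cos a * Cmod u) / 2). split; [lra|].
intros w Hw. apply angle_iff; [easy|].
replace (w + RtoC c)%C with (u + (w - z))%C by (unfold u; ring).
set (h := (w - z)%C) in *.
change (Re (u + h)%C) with (Re u + Re h).
assert (H1 := re_le_Cmod h). apply Rabs_le_between in H1.
assert (H2 := Cmod_triangle u h).
assert (H3 := Cmod_triangle (u + h) (- h)). replace (u + h + - h)%C with u in H3 by ring. rewrite Cmod_opp in H3.
assert (Hc1 := COS_bound a).
assert (cos a * (Cmod (u + h) - Cmod u) <= Cmod h) by nra.
lra.
Qed.

(** Since x z + c = x (z + c) + (1 - x) c, shrinking towards 0 is scaling towards the vertex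
    followed by a shift to the right. *)
Lemma angle_star (a c : R) : PI / 2 < a <= PI -> 0 < c -> star (angle a c) 0.
Proof.
intros Ha Hc z x Hz Hx. apply angle_iff in Hz; [|easy]. apply angle_iff; [easy|].
assert (Hca : cos a < 0) by (apply cos_lt_0; lra).
destruct (Req_dec x 0) as [->|Hx0].
- replace (0 + 0 * (z - 0) + RtoC c)%C with (RtoC c) by ring.
  rewrite Cmod_R, Rabs_pos_eq by lra. change (Re (RtoC c)) with c. nra.
- replace (0 + RtoC x * (z - 0) + RtoC c)%C with (RtoC x * (z + RtoC c) + RtoC ((1 - x) * c))%C.
  2:{ rewrite RtoC_mult, RtoC_minus. ring. }
  apply sector_add; [easy|apply Rmult_le_pos; lra|].
  rewrite Cmod_mult, Cmod_R, Rabs_pos_eq by lra.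
  replace (Re (RtoC x * (z + RtoC c))%C) with (x * Re (z + RtoC c)%C) by (unfold RtoC, Cmult, Re; simpl; ring).
  replace (cos a * (x * Cmod (z + RtoC c))) with (x * (cos a * Cmod (z + RtoC c))) by ring.
  apply Rmult_lt_compat_l; lra.
Qed.

Lemma angle_polar (a c r t : R) : PI / 2 < a <= PI -> 0 < c -> 0 <= r -> Rabs t < a -> angle a c (polar r t).
Proof.
intros Ha Hc Hr Ht. apply angle_iff; [easy|].
assert (Hca : cos a < 0) by (apply cos_lt_0; lra).
destruct Hr as [Hr|<-].
- apply sector_add; [easy|lra|]. apply sector_iff; [lra|]. now exists r, t.
- replace (polar 0 t + RtoC c)%C with (RtoC c) by (unfold polar, RtoC, Cplus; simpl; f_equal; ring).
  rewrite Cmod_R, Rabs_pos_eq by lra. change (Re (RtoC c)) with c. nra.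
Qed.

(** With k the increment of the logarithm, e^k - 1 is the relative increment of f, which is m h +
    o(h). Continuity makes k small, and e^k - 1 - k = O(k^2) transfers the expansion to k. *)
Lemma log_branch_diff (f lf : C -> C) (s : C) :
  Ccont lf s -> Cdiff f s ->
  (exists d, 0 < d /\ forall w, Cmod (w - s) < d -> Cexp (lf w) = f w) -> Cdiff lf s.
Proof.
intros Hc [l Hl] [d0 [Hd0 HE]].
assert (Es : Cexp (lf s) = f s).
{ apply HE. replace (s - s)%C with (RtoC 0) by ring. now rewrite Cmod_0. }
assert (Hfs : f s <> 0) by (rewrite <- Es; apply Cexp_neq_0).
set (m := (l / f s)%C). exists m.
assert (Hg : is_Cder (fun w => f w * / f s)%C s m).
{ replace m with (l * / f s + f s * 0)%C by (unfold m, Cdiv; ring).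
  apply (Cder_mult f (fun _ => / f s)%C); [exact Hl|apply Cder_const]. }
assert (Hm := Cmod_ge_0 m).
apply Cder_eps. intros e He.
set (e1 := Rmin 1 (e / 2)). assert (He1 : 0 < e1) by (apply Rmin_glb_lt; lra).
assert (He11 : e1 <= 1) by apply Rmin_l. assert (He12 : e1 <= e / 2) by apply Rmin_r.
(* The bound |k| <= 1/6 gives 3 |k|^2 <= |k| / 2, hence |k| <= 2 |e^k - 1|; the second bound makes 3
   |k|^2 at most (e / 2) |h|. *)
set (e2 := Rmin (/ 6) (e / (12 * (Cmod m + 1)))).
assert (He2 : 0 < e2) by (apply Rmin_glb_lt; [lra|apply Rdiv_lt_0_compat; lra]).
destruct (proj1 (Cder_eps _ _ _) Hg e1 He1) as [d1 [Hd1 H1]].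
destruct (Hc e2 He2) as [d2 [Hd2 H2]].
exists (Rmin d0 (Rmin d1 d2)). split; [repeat apply Rmin_glb_lt; easy|].
intros w Hw.
assert (W0 := Rlt_le_trans _ _ _ Hw (Rmin_l _ _)).
assert (W' := Rlt_le_trans _ _ _ Hw (Rmin_r _ _)).
assert (W1 := Rlt_le_trans _ _ _ W' (Rmin_l _ _)).
assert (W2 := Rlt_le_trans _ _ _ W' (Rmin_r _ _)).
specialize (H1 w W1). specialize (H2 w W2).
set (k := (lf w - lf s)%C) in *. set (h := (w - s)%C) in *.
assert (Ek : (f w * / f s - f s * / f s)%C = (Cexp k - 1)%C).
{ rewrite Cinv_r by exact Hfs. f_equal. rewrite <- (HE w W0), <- Es, <- Cexp_opp, <- Cexp_plus. f_equal. }
rewrite Ek in H1.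
assert (K6 : Cmod k <= / 6) by (left; eapply Rlt_le_trans; [exact H2|apply Rmin_l]).
assert (K12 : Cmod k * (12 * (Cmod m + 1)) <= e).
{ apply Rle_div_r; [lra|]. left; eapply Rlt_le_trans; [exact H2|apply Rmin_r]. }
assert (Hk0 := Cmod_ge_0 k). assert (Hh0 := Cmod_ge_0 h).
assert (Ex : Cmod (Cexp k - 1 - k) <= 3 * (Cmod k * Cmod k)).
{ eapply Rle_trans; [apply Cexp_sub_1_sub|].
  assert (exp (Cmod k) <= 3) by (eapply Rle_trans; [|apply exp_le_3]; apply exp_le; lra).
  replace (3 * (Cmod k * Cmod k)) with (Cmod k ^ 2 * 3) by ring. apply Rmult_le_compat_l; [nra|easy]. }
assert (B : Cmod (Cexp k - 1) <= (Cmod m + 1) * Cmod h).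
{ replace (Cexp k - 1)%C with ((Cexp k - 1 - m * h) + m * h)%C by ring.
  eapply Rle_trans; [apply Cmod_triangle|]. rewrite Cmod_mult. nra. }
assert (Kk : Cmod k <= 2 * ((Cmod m + 1) * Cmod h)).
{ assert (T := Cmod_triangle3 k (Cexp k - 1) 0).
  replace (k - 0)%C with k in T by ring. replace (Cexp k - 1 - 0)%C with (Cexp k - 1)%C in T by ring.
  rewrite (Cmod_sub_sym k) in T. nra. }
replace (k - m * h)%C with ((Cexp k - 1 - m * h) + - (Cexp k - 1 - k))%C by ring.
eapply Rle_trans; [apply Cmod_triangle|]. rewrite Cmod_opp.
assert (3 * (Cmod k * Cmod k) <= e / 2 * Cmod h).
{ apply Rle_trans with (3 * (Cmod k * (2 * ((Cmod m + 1) * Cmod h)))).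
  - apply Rmult_le_compat_l; [lra|]. now apply Rmult_le_compat_l.
  - replace (3 * (Cmod k * (2 * ((Cmod m + 1) * Cmod h)))) with (Cmod k * (12 * (Cmod m + 1)) / 2 * Cmod h) by field.
    apply Rmult_le_compat_r; lra. }
assert (e1 * Cmod h <= e / 2 * Cmod h) by (apply Rmult_le_compat_r; lra).
lra.
Qed.

(** * The function epsilon in the coordinate log s *)

Lemma Cdiff_der (f : C -> C) (z : C) : Cdiff f z -> is_Cder f z (C_derive f z).
Proof. intros [l H]. now rewrite (Cder_unique _ _ _ H). Qed.

Lemma lg_der (a c : R) (g lg : C -> C) (s : C) :
  PI / 2 < a <= PI -> admissible a c g lg -> angle a c s -> is_Cder lg s (C_derive lg s).
Proof.
intros Ha [An _ _ [Hc [He _]] _ _ _ _ _] Hs. apply Cdiff_der, (log_branch_diff g).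
- apply Ccont_of_continuous, Hc, Hs.
- apply (An s Hs).
- destruct (angle_open a c Ha s Hs) as [d [Hd H]]. exists d; split; auto.
Qed.

Lemma dlg_diff (a c : R) (g lg : C -> C) (s : C) :
  PI / 2 < a <= PI -> admissible a c g lg -> angle a c s -> Cdiff (C_derive lg) s.
Proof.
intros Ha H Hs. apply (Cdiff_derivative (angle a c) lg); [now apply angle_open| |exact Hs].
intros z Hz. now apply (lg_der a c g).
Qed.

(** This is epsilon = s (log L)' after differentiating log L = (log gamma) / s, so that L itself
    disappears. *)
Definition eps1 (lg : C -> C) (s : C) : C := (C_derive lg s - lg s / s)%C.

Lemma logderiv_L (a c : R) (g lg : C -> C) (s : C) :
  PI / 2 < a <= PI -> admissible a c g lg -> angle a c s -> s <> 0 ->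
  is_Cder (L lg) s (L lg s * (eps1 lg s / s))%C.
Proof.
intros Ha H Hs Hs0.
replace (eps1 lg s / s)%C with ((C_derive lg s - lg s / s * 1) / s)%C by (unfold eps1; field; exact Hs0).
apply (Cder_comp Cexp (logL lg)); [apply Cder_Cexp|].
apply (Cder_div lg (fun s => s)); [now apply (lg_der a c g)|apply Cder_id|exact Hs0].
Qed.

Lemma logderiv_eq (a c : R) (g lg : C -> C) (s : C) :
  PI / 2 < a <= PI -> admissible a c g lg -> angle a c s -> s <> 0 ->
  (C_derive (L lg) s / L lg s)%C = (eps1 lg s / s)%C.
Proof.
intros Ha H Hs Hs0. rewrite (Cder_unique _ _ _ (logderiv_L a c g lg s Ha H Hs Hs0)).
field. split; [exact Hs0|apply Cexp_neq_0].
Qed.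

Lemma epsilon_eq (a c : R) (g lg : C -> C) (s : C) :
  PI / 2 < a <= PI -> admissible a c g lg -> angle a c s -> s <> 0 -> epsilon lg s = eps1 lg s.
Proof.
intros Ha H Hs Hs0. unfold epsilon. rewrite (logderiv_eq a c g) by assumption. field. exact Hs0.
Qed.

Lemma Phi_eq (a c : R) (g lg : C -> C) (s : C) :
  PI / 2 < a <= PI -> admissible a c g lg -> angle a c s -> s <> 0 -> Phi lg s = C_derive lg s.
Proof.
intros Ha H Hs Hs0. unfold Phi. rewrite (logderiv_eq a c g) by assumption.
unfold logL, eps1. field. exact Hs0.
Qed.

(** With zeta = log s, [ell] is log L and its derivative is [eps_log], which is epsilon. A point (x,
    t) stands for |s| = e^x and arg s = t. *)
Definition eps_log (lg : C -> C) (z : C) : C := eps1 lg (Cexp z).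
Definition ell (lg : C -> C) (z : C) : C := logL lg (Cexp z).
Definition epsR (lg : C -> C) (x : R) : R := Re (eps_log lg (x, 0)).

Lemma angle_Cexp (a c x t : R) : PI / 2 < a <= PI -> 0 < c -> Rabs t < a -> angle a c (Cexp (x, t)).
Proof. intros. apply angle_polar; auto. left; apply exp_pos. Qed.

Lemma eps1_diff (a c : R) (g lg : C -> C) (s : C) :
  PI / 2 < a <= PI -> admissible a c g lg -> angle a c s -> s <> 0 -> Cdiff (eps1 lg) s.
Proof.
intros Ha H Hs Hs0. destruct (dlg_diff a c g lg s Ha H Hs) as [l Hl].
eexists. apply Cder_minus; [exact Hl|].
apply (Cder_div lg (fun s => s)); [now apply (lg_der a c g)|apply Cder_id|exact Hs0].
Qed.

Lemma eps_log_der (a c x t : R) (g lg : C -> C) :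
  PI / 2 < a <= PI -> 0 < c -> admissible a c g lg -> Rabs t < a ->
  is_Cder (eps_log lg) (x, t) (C_derive (eps1 lg) (Cexp (x, t)) * Cexp (x, t))%C.
Proof.
intros Ha Hc H Ht. apply (Cder_comp (eps1 lg) Cexp); [|apply Cder_Cexp].
apply Cdiff_der, (eps1_diff a c g); auto; [now apply angle_Cexp|apply Cexp_neq_0].
Qed.

Lemma ell_der (a c x t : R) (g lg : C -> C) :
  PI / 2 < a <= PI -> 0 < c -> admissible a c g lg -> Rabs t < a ->
  is_Cder (ell lg) (x, t) (eps_log lg (x, t)).
Proof.
intros Ha Hc H Ht. set (s := Cexp (x, t)).
assert (Hs0 : s <> 0) by apply Cexp_neq_0.
assert (Hs : angle a c s) by now apply angle_Cexp.
replace (eps_log lg (x, t)) with ((C_derive lg s - lg s / s * 1) / s * s)%C.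
- apply (Cder_comp (logL lg) Cexp); [|apply Cder_Cexp].
  apply (Cder_div lg (fun s => s)); [now apply (lg_der a c g)|apply Cder_id|exact Hs0].
- unfold eps_log, eps1. fold s. field. exact Hs0.
Qed.

Lemma epsR_spec (a c x : R) (g lg : C -> C) :
  PI / 2 < a <= PI -> 0 < c -> admissible a c g lg ->
  0 < epsR lg x /\ eps_log lg (x, 0) = RtoC (epsR lg x) /\
  epsilon lg (RtoC (exp x)) = RtoC (epsR lg x).
Proof.
intros Ha Hc H.
assert (E : epsilon lg (RtoC (exp x)) = eps_log lg (x, 0)).
{ rewrite RtoC_exp. apply (epsilon_eq a c g); auto; [|apply Cexp_neq_0].
  apply (angle_Cexp a c x 0); auto. rewrite Rabs_R0. assert (P := PI_RGT_0). lra. }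
destruct (adm_eps_positive _ _ _ _ H (exp x) (exp_pos x)) as [H1 H2].
rewrite E in *. unfold epsR. split; [exact H2|].
assert (E2 : eps_log lg (x, 0) = RtoC (Re (eps_log lg (x, 0)))).
{ destruct (eps_log lg (x, 0)) as [u v]. unfold Im in H1; simpl in H1. now rewrite H1. }
split; exact E2.
Qed.

Lemma epsR_bounded (a c : R) (g lg : C -> C) :
  PI / 2 < a <= PI -> 0 < c -> admissible a c g lg -> exists M, forall x, epsR lg x <= M.
Proof.
intros Ha Hc H. destruct (adm_eps_bounded _ _ _ _ H) as [M HM]. exists M. intros x.
destruct (epsR_spec a c x g lg Ha Hc H) as [E1 [E2 E3]].
specialize (HM (exp x) (exp_pos x)). rewrite E3, Cmod_R, Rabs_pos_eq in HM; lra.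
Qed.

Lemma eps_log_slow_real (a c : R) (g lg : C -> C) :
  PI / 2 < a <= PI -> 0 < c -> admissible a c g lg ->
  forall eta, 0 < eta -> exists X, forall x, X <= x ->
    Cmod (C_derive (eps1 lg) (Cexp (x, 0)) * Cexp (x, 0))%C <= eta * epsR lg x.
Proof.
intros Ha Hc H eta Heta. destruct (adm_B _ _ _ _ H eta Heta) as [R0 HR0].
(* R0 may be negative; the maximum with 1 keeps the logarithm meaningful, and adding 1 makes the
   inequality strict. *)
exists (ln (Rmax 1 R0) + 1). intros x Hx.
assert (Hr : R0 < exp x).
{ apply Rle_lt_trans with (Rmax 1 R0); [apply Rmax_r|].
  assert (0 < Rmax 1 R0) by (eapply Rlt_le_trans; [apply Rlt_0_1|apply Rmax_l]).
  rewrite <- (exp_ln (Rmax 1 R0)) by easy. apply exp_increasing. lra. }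
specialize (HR0 (exp x) (exp_pos x) Hr).
destruct (epsR_spec a c x g lg Ha Hc H) as [E1 [E2 E3]].
rewrite E3, (Cmod_R (epsR lg x)), Rabs_pos_eq in HR0 by lra.
assert (Hang : angle a c (Cexp (x, 0))).
{ apply (angle_Cexp a c x 0); auto. rewrite Rabs_R0. assert (P := PI_RGT_0). lra. }
(* The two functions agree only at the non-zero points of the angle, so their derivatives are
   compared on a small disc. *)
assert (D : C_derive (epsilon lg) (RtoC (exp x)) = C_derive (eps1 lg) (Cexp (x, 0))).
{ rewrite RtoC_exp. change (RtoC x) with (x, 0). apply Cder_unique.
  apply (Cder_ext_loc (eps1 lg)).
  - destruct (angle_open a c Ha _ Hang) as [d [Hd Hd']].
    exists (Rmin d (exp x)). split; [apply Rmin_glb_lt; [easy|apply exp_pos]|].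
    intros w Hw. symmetry. apply (epsilon_eq a c g); auto.
    + apply Hd'. eapply Rlt_le_trans; [exact Hw|apply Rmin_l].
    + intros ->. assert (W := Rlt_le_trans _ _ _ Hw (Rmin_r _ _)).
      rewrite Cmod_sub_sym in W. replace (Cexp (x, 0) - 0)%C with (Cexp (x, 0)) in W by ring.
      rewrite Cmod_Cexp in W. change (Re (x, 0)) with x in W. lra.
  - apply Cdiff_der, (eps1_diff a c g); auto. apply Cexp_neq_0. }
rewrite D in HR0. rewrite Cmod_mult, Cmod_Cexp, Rmult_comm. exact HR0.
Qed.

Lemma eps_log_near_real (a c : R) (g lg : C -> C) :
  PI / 2 < a <= PI -> 0 < c -> admissible a c g lg ->
  forall a1 eta, a1 < a -> 0 < eta -> exists X, forall x t, X <= x -> Rabs t <= a1 ->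
    Cmod (eps_log lg (x, t) - RtoC (epsR lg x))%C <= eta * epsR lg x.
Proof.
intros Ha Hc H a1 eta Ha1 Heta.
destruct (adm_C _ _ _ _ H (a - a1) ltac:(lra) eta Heta) as [R0 HR0].
exists (ln (Rmax 1 R0) + 1). intros x t Hx Ht.
assert (Hr : R0 < exp x).
{ apply Rle_lt_trans with (Rmax 1 R0); [apply Rmax_r|].
  assert (0 < Rmax 1 R0) by (eapply Rlt_le_trans; [apply Rlt_0_1|apply Rmax_l]).
  rewrite <- (exp_ln (Rmax 1 R0)) by easy. apply exp_increasing. lra. }
specialize (HR0 (exp x) t (exp_pos x) Hr ltac:(lra)).
destruct (epsR_spec a c x g lg Ha Hc H) as [E1 [E2 E3]].
rewrite E3, (Cmod_R (epsR lg x)), Rabs_pos_eq in HR0 by lra.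
change (polar (exp x) t) with (Cexp (x, t)) in HR0.
rewrite (epsilon_eq a c g lg _ Ha H) in HR0; [exact HR0|apply angle_Cexp; auto; lra|apply Cexp_neq_0].
Qed.

Lemma pair_line_h (x t y : R) : ((x, t) + RtoC y * 1)%C = ((x + y)%R, t).
Proof. unfold RtoC, Cplus, Cmult; simpl. f_equal; ring. Qed.

Lemma Cpath_h (f : C -> C) (x t : R) (l : C) : is_Cder f (x, t) l -> is_Cpath (fun x => f (x, t)) x l.
Proof.
intros Hf. rewrite <- (Cmult_1_r l).
assert (D : is_Cpath (fun x => f ((0, t) + RtoC x * 1)%C) x (l * 1)).
{ apply Cpath_comp; [rewrite pair_line_h, Rplus_0_l; exact Hf|apply Cpath_line]. }
revert D. apply is_derive_ext. intros u. now rewrite pair_line_h, Rplus_0_l.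
Qed.

Lemma ell_real_der (a c x : R) (g lg : C -> C) :
  PI / 2 < a <= PI -> 0 < c -> admissible a c g lg ->
  is_derive (fun x => Re (ell lg (x, 0))) x (epsR lg x).
Proof.
intros Ha Hc H.
assert (D := ell_der a c x 0 g lg Ha Hc H ltac:(rewrite Rabs_R0; assert (P := PI_RGT_0); lra)).
apply Cpath_h in D. apply Cpath_iff in D. apply D.
Qed.

Lemma epsR_der (a c x : R) (g lg : C -> C) :
  PI / 2 < a <= PI -> 0 < c -> admissible a c g lg ->
  is_derive (epsR lg) x (Re (C_derive (eps1 lg) (Cexp (x, 0)) * Cexp (x, 0))%C).
Proof.
intros Ha Hc H.
assert (D := eps_log_der a c x 0 g lg Ha Hc H ltac:(rewrite Rabs_R0; assert (P := PI_RGT_0); lra)).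
apply Cpath_h in D. apply Cpath_iff in D. apply D.
Qed.

(** Under rho = e^x the integral in (A) is an increment of log L on the half-line. *)
Lemma ell_real_infty (a c : R) (g lg : C -> C) :
  PI / 2 < a <= PI -> 0 < c -> admissible a c g lg ->
  forall M, exists X, forall x, X <= x -> M <= Re (ell lg (x, 0)).
Proof.
intros Ha Hc H M.
set (f := fun rho => Re (ell lg (ln rho, 0))).
assert (D : forall rho, 0 < rho -> is_derive f rho (Re (epsilon lg (RtoC rho)) / rho)).
{ intros rho Hr. destruct (epsR_spec a c (ln rho) g lg Ha Hc H) as [_ [_ E3]].
  rewrite exp_ln in E3 by easy. rewrite E3. change (Re (RtoC (epsR lg (ln rho)))) with (epsR lg (ln rho)).
  replace (epsR lg (ln rho) / rho) with (/ rho * epsR lg (ln rho)) by (unfold Rdiv; ring).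
  apply (is_derive_comp (V := R_NormedModule) (fun x => Re (ell lg (x, 0))) ln).
  - now apply (ell_real_der a c _ g).
  - now apply is_derive_ln. }
assert (Cn : forall rho, 0 < rho -> continuous (fun rho => Re (epsilon lg (RtoC rho)) / rho) rho).
{ intros rho Hr. apply (continuous_ext_loc _ (fun r => epsR lg (ln r) / r)).
  - exists (mkposreal rho Hr). intros y Hy.
    assert (Hy0 : 0 < y).
    { assert (Q : Rabs (y - rho) < rho) by exact Hy. apply Rabs_lt_between in Q. lra. }
    destruct (epsR_spec a c (ln y) g lg Ha Hc H) as [_ [_ E3]].
    rewrite exp_ln in E3 by easy. now rewrite E3.
  - apply (ex_derive_continuous (V := R_NormedModule) (fun r => epsR lg (ln r) / r)).
    eexists. apply (is_derive_div (fun r => epsR lg (ln r)) (fun r => r)); [|apply (is_derive_id (K := R_AbsRing))|lra].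
    apply (is_derive_comp (V := R_NormedModule) (epsR lg) ln); [now apply (epsR_der a c _ g)|now apply is_derive_ln]. }
assert (I : forall X, 1 <= X -> RInt (fun rho => Re (epsilon lg (RtoC rho)) / rho) 1 X = f X - f 1).
{ intros X HX. apply is_RInt_unique. apply (is_RInt_derive (V := R_CompleteNormedModule) f);
    intros r Hr; rewrite Rmin_left, Rmax_right in Hr by lra; [apply D|apply Cn]; lra. }
assert (A := adm_A _ _ _ _ H).
apply is_lim_spec in A. destruct (A (M - f 1)) as [N HN].
exists (ln (Rmax 1 N) + 1). intros x Hx.
assert (P : 0 < Rmax 1 N) by (eapply Rlt_le_trans; [apply Rlt_0_1|apply Rmax_l]).
assert (Hr : Rmax 1 N < exp x).
{ rewrite <- (exp_ln (Rmax 1 N)) by easy. apply exp_increasing. lra. }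
assert (P1 := Rmax_l 1 N). assert (P2 := Rmax_r 1 N).
specialize (HN (exp x) ltac:(lra)). rewrite I in HN by lra.
assert (F : f (exp x) = Re (ell lg (x, 0))) by (unfold f; now rewrite ln_exp). lra.
Qed.

(** * Estimates for epsilon and log L *)

Lemma R_increment (f f' g g' : R -> R) (a b : R) :
  a <= b ->
  (forall t, a <= t <= b -> is_derive f t (f' t) /\ is_derive g t (g' t) /\ f' t <= g' t) ->
  f b - f a <= g b - g a.
Proof.
intros Hab H.
apply (Re_increment (fun t => RtoC (f t)) (fun t => RtoC (f' t)) g g' a b Hab).
intros t Ht. destruct (H t Ht) as [H1 H2]. split; [now apply Cpath_real|exact H2].
Qed.

(** The zeta-derivative of [eps_log], that is, s epsilon'(s). *)
Definition deps (lg : C -> C) (z : C) : C := (C_derive (eps1 lg) (Cexp z) * Cexp z)%C.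

(** The logarithmic derivative of [epsR] is Re [deps] / [epsR], which (B) makes smaller than any k
    far out. *)
Lemma epsR_log_lipschitz (a c : R) (g lg : C -> C) :
  PI / 2 < a <= PI -> 0 < c -> admissible a c g lg ->
  forall k, 0 < k -> exists X, forall x y, X <= x <= y ->
    - k * (y - x) <= ln (epsR lg y) - ln (epsR lg x) <= k * (y - x).
Proof.
intros Ha Hc H k Hk. destruct (eps_log_slow_real a c g lg Ha Hc H k Hk) as [X HX].
exists X. intros x y Hxy.
assert (D : forall t, x <= t <= y -> exists d,
   is_derive (fun t => ln (epsR lg t)) t d /\ - k <= d <= k).
{ intros t Ht. destruct (epsR_spec a c t g lg Ha Hc H) as [P _].
  exists (Re (deps lg (t, 0)) * / epsR lg t). split.
  - apply (is_derive_comp (V := R_NormedModule) ln (epsR lg)); [now apply is_derive_ln|now apply (epsR_der a c _ g)].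
  - assert (Q := HX t ltac:(lra)). fold (deps lg (t, 0)) in Q.
    assert (Q' := Rle_trans _ _ _ (re_le_Cmod _) Q). apply Rabs_le_between in Q'.
    split; [apply Rle_div_r|apply Rle_div_l]; lra. }
assert (D' : forall t, x <= t <= y -> is_derive (fun t => ln (epsR lg t)) t (Derive (fun t => ln (epsR lg t)) t)
  /\ - k <= Derive (fun t => ln (epsR lg t)) t <= k).
{ intros t Ht. destruct (D t Ht) as [d [D1 D2]]. 
  assert (Eq : Derive (fun t => ln (epsR lg t)) t = d) by exact (is_derive_unique _ _ _ D1).
  rewrite Eq. now split. }
assert (Lin : forall q t, is_derive (fun t => q * t) t q).
{ intros q t. auto_derive; [easy|ring]. }
split.
- assert (I := R_increment (fun t => - k * t) (fun _ => - k) (fun t => ln (epsR lg t)) (Derive (fun t => ln (epsR lg t))) x y ltac:(lra)).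
  cbv beta in I. enough (- k * y - - k * x <= ln (epsR lg y) - ln (epsR lg x)) by lra.
  apply I. intros t Ht. destruct (D' t Ht) as [D1 D2]. split; [apply Lin|split; [exact D1|lra]].
- assert (I := R_increment (fun t => ln (epsR lg t)) (Derive (fun t => ln (epsR lg t))) (fun t => k * t) (fun _ => k) x y ltac:(lra)).
  cbv beta in I. enough (ln (epsR lg y) - ln (epsR lg x) <= k * y - k * x) by lra.
  apply I. intros t Ht. destruct (D' t Ht) as [D1 D2]. split; [exact D1|split; [apply Lin|lra]].
Qed.

(** A Lipschitz constant k with k X0 <= ln(1 + eta) bounds the quotient of the two values by 1 + eta
    in both directions. The threshold is X + X0 because y may lie to the left of x. *)
Lemma epsR_slow (a c : R) (g lg : C -> C) :
  PI / 2 < a <= PI -> 0 < c -> admissible a c g lg ->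
  forall X0 eta, 0 <= X0 -> 0 < eta -> exists X, forall x y, X <= x -> Rabs (y - x) <= X0 ->
    Rabs (epsR lg y - epsR lg x) <= eta * epsR lg x.
Proof.
intros Ha Hc H X0 eta HX0 Heta.
assert (Hl : 0 < ln (1 + eta)) by (rewrite <- ln_1; apply ln_increasing; lra).
set (k := ln (1 + eta) / (X0 + 1)).
assert (Hk : 0 < k) by (apply Rdiv_lt_0_compat; lra).
destruct (epsR_log_lipschitz a c g lg Ha Hc H k Hk) as [X HX].
exists (X + X0). intros x y Hx Hy.
assert (B : Rabs (ln (epsR lg y) - ln (epsR lg x)) <= ln (1 + eta)).
{ assert (Hkk : k * X0 <= ln (1 + eta)).
  { unfold k. replace (ln (1 + eta) / (X0 + 1) * X0) with (ln (1 + eta) * (X0 / (X0 + 1))) by (field; lra).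
    rewrite <- (Rmult_1_r (ln (1 + eta))) at 2. apply Rmult_le_compat_l; [lra|].
    apply Rle_div_l; lra. }
  apply Rabs_le_between in Hy. apply Rabs_le.
  destruct (Rle_lt_dec x y) as [L|L].
  - assert (Q := HX x y ltac:(lra)). assert (k * (y - x) <= k * X0) by (apply Rmult_le_compat_l; lra). lra.
  - assert (Q := HX y x ltac:(lra)). assert (k * (x - y) <= k * X0) by (apply Rmult_le_compat_l; lra). lra. }
destruct (epsR_spec a c x g lg Ha Hc H) as [Px _]. destruct (epsR_spec a c y g lg Ha Hc H) as [Py _].
apply Rabs_le_between in B.
assert (U : epsR lg y <= (1 + eta) * epsR lg x).
{ rewrite <- (exp_ln (epsR lg y)), <- (exp_ln (epsR lg x)), <- (exp_ln (1 + eta)) by lra.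
  rewrite <- exp_plus. apply exp_le. lra. }
assert (V : epsR lg x <= (1 + eta) * epsR lg y).
{ rewrite <- (exp_ln (epsR lg y)), <- (exp_ln (epsR lg x)), <- (exp_ln (1 + eta)) by lra.
  rewrite <- exp_plus. apply exp_le. lra. }
apply Rabs_le. split; [|lra]. nra.
Qed.

(** Over long intervals epsilon may change by a large factor. By (B) the change is still a small
    part of the growth of log L, since [epsR] is the derivative of Re [ell]. *)
Lemma epsR_vs_ell (a c : R) (g lg : C -> C) :
  PI / 2 < a <= PI -> 0 < c -> admissible a c g lg ->
  forall eta, 0 < eta -> exists X, forall x y, X <= x <= y ->
    0 <= Re (ell lg (y, 0)) - Re (ell lg (x, 0)) /\
    Rabs (epsR lg y - epsR lg x) <= eta * (Re (ell lg (y, 0)) - Re (ell lg (x, 0))).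
Proof.
intros Ha Hc H eta Heta. destruct (eps_log_slow_real a c g lg Ha Hc H eta Heta) as [X HX].
exists X. intros x y Hxy.
set (f := fun x => Re (ell lg (x, 0))).
assert (Df : forall t, is_derive f t (epsR lg t)) by (intros; now apply (ell_real_der a c _ g)).
assert (De : forall t, is_derive (epsR lg) t (Re (deps lg (t, 0)))) by (intros; now apply (epsR_der a c _ g)).
assert (B : forall t, x <= t -> - (eta * epsR lg t) <= Re (deps lg (t, 0)) <= eta * epsR lg t).
{ intros t Ht. assert (Q := HX t ltac:(lra)). fold (deps lg (t, 0)) in Q.
  apply Rabs_le_between. exact (Rle_trans _ _ _ (re_le_Cmod _) Q). }
assert (Z : forall t, is_derive (fun _ : R => 0) t 0) by (intros; apply (is_derive_const (V := R_NormedModule))).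
fold (f x) (f y). split.
- replace 0 with (0 - 0) by ring.
  apply (R_increment (fun _ => 0) (fun _ => 0) f (epsR lg)); [lra|].
  intros t _. split; [apply Z|split; [apply Df|]]. left. apply (epsR_spec a c t g lg Ha Hc H).
- apply Rabs_le. split.
  + assert (I := R_increment (fun t => - eta * f t) (fun t => - eta * epsR lg t) (epsR lg) (fun t => Re (deps lg (t, 0))) x y ltac:(lra)).
    cbv beta in I. enough (- eta * f y - - eta * f x <= epsR lg y - epsR lg x) by lra.
    apply I. intros t Ht. split; [apply is_derive_scal, Df|split; [apply De|]]. assert (Q := B t ltac:(lra)). lra.
  + assert (I := R_increment (epsR lg) (fun t => Re (deps lg (t, 0))) (fun t => eta * f t) (fun t => eta * epsR lg t) x y ltac:(lra)).
    cbv beta in I. enough (epsR lg y - epsR lg x <= eta * f y - eta * f x) by lra.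
    apply I. intros t Ht. split; [apply De|split; [apply is_derive_scal, Df|]]. assert (Q := B t ltac:(lra)). lra.
Qed.

(** A Lipschitz constant 1/2 for ln epsilon gives x + ln epsilon >= x / 2 + const, so that lam tends
    to infinity even if epsilon tends to 0. *)
Lemma exp_epsR_infty (a c : R) (g lg : C -> C) :
  PI / 2 < a <= PI -> 0 < c -> admissible a c g lg ->
  forall M, exists X, forall x, X <= x -> M <= exp x * epsR lg x.
Proof.
intros Ha Hc H M. destruct (epsR_log_lipschitz a c g lg Ha Hc H (/ 2) ltac:(lra)) as [X HX].
set (Y := Rmax 1 M). assert (HY : 1 <= Y) by apply Rmax_l. assert (HYM : M <= Y) by apply Rmax_r.
exists (Rmax X (2 * (ln Y - ln (epsR lg X) - / 2 * X))). intros x Hx.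
assert (L1 := Rle_trans _ _ _ (Rmax_l _ _) Hx). assert (L2 := Rle_trans _ _ _ (Rmax_r _ _) Hx).
assert (Q := HX X x ltac:(lra)).
destruct (epsR_spec a c x g lg Ha Hc H) as [Px _].
apply Rle_trans with (1 := HYM). rewrite <- (exp_ln Y), <- (exp_ln (epsR lg x)), <- exp_plus by lra.
apply exp_le. lra.
Qed.

(** Cauchy's estimate in the strip, on discs of the fixed radius r = (a - a1) / 2. There [eps_log]
    deviates from [epsR] x by at most 2 e1 + e1 in relative size: the first part by (C), as [epsR]
    at most doubles, the second by slow variation. *)
Lemma deps_small (a c : R) (g lg : C -> C) :
  PI / 2 < a <= PI -> 0 < c -> admissible a c g lg ->
  forall a1 eta, a1 < a -> 0 < eta -> exists X, forall x t, X <= x -> Rabs t <= a1 ->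
    Cmod (deps lg (x, t)) <= eta * epsR lg x.
Proof.
intros Ha Hc H a1 eta Ha1 Heta.
set (r := (a - a1) / 2). assert (Hr : 0 < r) by (unfold r; lra).
set (e1 := Rmin 1 (eta * r / 3)).
assert (He1 : 0 < e1) by (apply Rmin_glb_lt; [lra|apply Rdiv_lt_0_compat; nra]).
assert (He1a : e1 <= 1) by apply Rmin_l. assert (He1b : e1 <= eta * r / 3) by apply Rmin_r.
destruct (eps_log_near_real a c g lg Ha Hc H (a1 + r) e1 ltac:(unfold r; lra) He1) as [X1 HX1].
destruct (epsR_slow a c g lg Ha Hc H r e1 ltac:(lra) He1) as [X2 HX2].
exists (Rmax (X1 + r) X2). intros x t Hx Ht.
assert (L1 := Rle_trans _ _ _ (Rmax_l _ _) Hx). assert (L2 := Rle_trans _ _ _ (Rmax_r _ _) Hx).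
destruct (epsR_spec a c x g lg Ha Hc H) as [Px _].
apply Rle_trans with (3 * e1 * epsR lg x / r).
2:{ apply Rle_div_l; [lra|]. assert (3 * e1 <= eta * r) by lra. nra. }
apply (cauchy_estimate (eps_log lg) (x, t) (deps lg (x, t)) (RtoC (epsR lg x)) r (a - a1)).
- intros [y s] Hw. eexists. apply (eps_log_der a c _ _ g); auto.
  assert (Q := Rle_lt_trans _ _ _ (Im_le_Cmod _) Hw). change (Im ((y, s) - (x, t))%C) with (s - t) in Q.
  apply Rabs_le_between in Ht. apply Rabs_lt_between in Q. apply Rabs_def1; lra.
- unfold r; lra.
- apply (eps_log_der a c _ _ g); auto. lra.
- intros [y s] Hw.
  assert (Q1 := Im_le_Cmod ((y, s) - (x, t))). change (Im ((y, s) - (x, t))%C) with (s - t) in Q1.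
  assert (Q2 := re_le_Cmod ((y, s) - (x, t))). change (Re ((y, s) - (x, t))%C) with (y - x) in Q2.
  rewrite Hw in Q1, Q2.
  assert (S := HX2 x y ltac:(lra) Q2).
  assert (Hs : Rabs s <= a1 + r).
  { apply Rabs_le_between in Ht. apply Rabs_le_between in Q1. apply Rabs_le; lra. }
  apply Rabs_le_between in Q2.
  assert (N := HX1 y s ltac:(lra) Hs).
  eapply Rle_trans; [apply (Cmod_triangle3 _ (RtoC (epsR lg y)))|].
  rewrite <- RtoC_minus, Cmod_R.
  apply Rabs_le_between in S.
  assert (e1 * epsR lg y <= e1 * (2 * epsR lg x)) by (apply Rmult_le_compat_l; nra).
  assert (Rabs (epsR lg y - epsR lg x) <= e1 * epsR lg x) by (apply Rabs_le; lra). lra.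
Qed.

(** The function Phi in the coordinate log s: at the non-zero points of the angle Phi is the
    derivative of log gamma. *)
Definition dlg (lg : C -> C) (z : C) : C := C_derive lg (Cexp z).

Lemma dlg_split (lg : C -> C) (z : C) : dlg lg z = (ell lg z + eps_log lg z)%C.
Proof. unfold dlg, ell, eps_log, eps1, logL. ring. Qed.

Lemma dlg_der (a c x t : R) (g lg : C -> C) :
  PI / 2 < a <= PI -> 0 < c -> admissible a c g lg -> Rabs t < a ->
  is_Cder (dlg lg) (x, t) (eps_log lg (x, t) + deps lg (x, t))%C.
Proof.
intros Ha Hc H Ht. apply (Cder_ext_loc (fun z => ell lg z + eps_log lg z)%C).
- exists 1; split; [lra|]. intros; symmetry; apply dlg_split.
- apply Cder_plus; [now apply (ell_der a c x t g)|now apply (eps_log_der a c x t g)].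
Qed.

(** The derivative [eps_log] + [deps] stays within 5 e1 [epsR] x of [epsR] x on the segment: twice
    e1 for each of (C) and [deps], once for slow variation. The error is proportional to the
    distance, as required near the saddle point. *)
Lemma dlg_linear (a c : R) (g lg : C -> C) :
  PI / 2 < a <= PI -> 0 < c -> admissible a c g lg ->
  forall a1 X0 eta, a1 < a -> 0 <= X0 -> 0 < eta -> exists X, forall x t0 y t, X <= x ->
    Rabs t0 <= a1 -> Rabs t <= a1 -> Rabs (y - x) <= X0 ->
    Cmod (dlg lg (y, t) - dlg lg (x, t0) - RtoC (epsR lg x) * ((y, t) - (x, t0)))%C
      <= eta * epsR lg x * Cmod ((y, t) - (x, t0))%C.
Proof.
intros Ha Hc H a1 X0 eta Ha1 HX0 Heta.
set (e1 := Rmin 1 (eta / 5)).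
assert (He1 : 0 < e1) by (apply Rmin_glb_lt; lra).
assert (He1a : e1 <= 1) by apply Rmin_l. assert (He1b : e1 <= eta / 5) by apply Rmin_r.
destruct (eps_log_near_real a c g lg Ha Hc H a1 e1 Ha1 He1) as [X1 HX1].
destruct (epsR_slow a c g lg Ha Hc H X0 e1 HX0 He1) as [X2 HX2].
destruct (deps_small a c g lg Ha Hc H a1 e1 Ha1 He1) as [X3 HX3].
exists (Rmax (Rmax X1 X3 + X0) X2). intros x t0 y t Hx Ht0 Ht Hy.
assert (L1 := Rle_trans _ _ _ (Rmax_l _ _) Hx). assert (L2 := Rle_trans _ _ _ (Rmax_r _ _) Hx).
assert (M1 := Rmax_l X1 X3). assert (M3 := Rmax_r X1 X3).
destruct (epsR_spec a c x g lg Ha Hc H) as [Px _].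
apply Rabs_le_between in Ht0, Ht, Hy.
assert (EL : forall s, ((x, t0) + RtoC s * ((y, t) - (x, t0)))%C = ((x + s * (y - x))%R, (t0 + s * (t - t0))%R)).
{ intros s. unfold RtoC, Cplus, Cmult, Cminus, Copp; simpl. f_equal; ring. }
assert (In : forall s, 0 <= s <= 1 -> Rabs (s * (y - x)) <= X0 /\ Rabs (t0 + s * (t - t0)) <= a1).
{ intros s Hs. split; apply Rabs_le; split; nra. }
replace (y, t) with ((x, t0) + ((y, t) - (x, t0)))%C at 1 by ring.
apply (Cder_segment (dlg lg) (fun z => eps_log lg z + deps lg z)%C).
- intros s Hs. rewrite EL. destruct (In s Hs) as [I1 I2]. apply (dlg_der a c _ _ g); auto. lra.
- intros s Hs. rewrite EL. destruct (In s Hs) as [I1 I2].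
  set (y' := x + s * (y - x)). set (t' := t0 + s * (t - t0)) in *.
  assert (I3 : Rabs (y' - x) <= X0) by (unfold y'; replace (x + s * (y - x) - x) with (s * (y - x)) by ring; exact I1).
  assert (S := HX2 x y' ltac:(lra) I3). apply Rabs_le_between in I3.
  assert (N := HX1 y' t' ltac:(lra) I2). assert (D := HX3 y' t' ltac:(lra) I2).
  replace (eps_log lg (y', t') + deps lg (y', t') - RtoC (epsR lg x))%C
    with (eps_log lg (y', t') - RtoC (epsR lg y') + (deps lg (y', t') + RtoC (epsR lg y' - epsR lg x)))%C
    by (rewrite RtoC_minus; ring).
  eapply Rle_trans; [apply Cmod_triangle|].
  assert (T := Cmod_triangle (deps lg (y', t')) (RtoC (epsR lg y' - epsR lg x))). rewrite Cmod_R in T.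
  assert (S' := S). apply Rabs_le_between in S'.
  assert (e1 * epsR lg y' <= e1 * (2 * epsR lg x)) by (apply Rmult_le_compat_l; nra).
  assert (5 * e1 * epsR lg x <= eta * epsR lg x) by (apply Rmult_le_compat_r; lra). lra.
Qed.

(** Integrates [eps_log] along the vertical segment from the real axis, where log L is real by the
    choice of the branch. *)
Lemma ell_vertical (a c : R) (g lg : C -> C) (x t e : R) :
  PI / 2 < a <= PI -> 0 < c -> admissible a c g lg -> Rabs t < a ->
  (forall s, Rabs s <= Rabs t -> Cmod (eps_log lg (x, s) - RtoC (epsR lg x))%C <= e) ->
  Cmod (ell lg (x, t) - RtoC (Re (ell lg (x, 0))) - RtoC (epsR lg x) * (0, t))%C <= e * Rabs t.
Proof.
intros Ha Hc H Ht He.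
assert (Ereal : RtoC (Re (ell lg (x, 0))) = ell lg (x, 0)).
{ destruct (adm_log _ _ _ _ H) as [_ [_ Him]].
  assert (I := Him (exp x) ltac:(assert (P := exp_pos x); lra)).
  unfold ell. replace (Cexp (x, 0)) with (RtoC (exp x)) by apply RtoC_exp.
  unfold logL. destruct (lg (RtoC (exp x))) as [u v]. unfold Im in I; simpl in I. rewrite I.
  replace (u, 0) with (RtoC u) by reflexivity. rewrite <- RtoC_div by (apply Rgt_not_eq, exp_pos). reflexivity. }
rewrite Ereal.
replace (Rabs t) with (Cmod (0, t)).
2:{ unfold Cmod; simpl. replace (0 * (0 * 1) + t * (t * 1)) with (Rsqr t) by (unfold Rsqr; ring). apply sqrt_Rsqr_abs. }
replace (x, t) with ((x, 0) + (0, t))%C at 1 by (unfold Cplus; simpl; f_equal; ring).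
assert (EL : forall s, ((x, 0) + RtoC s * (0, t))%C = (x, (s * t)%R)).
{ intros s. unfold RtoC, Cplus, Cmult; simpl. f_equal; ring. }
assert (In : forall s, 0 <= s <= 1 -> Rabs (s * t) <= Rabs t).
{ intros s Hs. rewrite Rabs_mult, (Rabs_pos_eq s) by lra. assert (P := Rabs_pos t). nra. }
apply (Cder_segment (ell lg) (eps_log lg)).
- intros s Hs. rewrite EL. apply (ell_der a c _ _ g); auto. specialize (In s Hs). lra.
- intros s Hs. rewrite EL. apply He, In, Hs.
Qed.

Lemma Re_Cexp_mult (t : R) (z : C) : Re (Cexp (0, t) * z)%C = cos t * Re z - sin t * Im z.
Proof. destruct z. unfold Cexp, polar, Cmult, Re, Im; simpl. rewrite exp_0. ring. Qed.

(* Since h' = Phi - Phi (s_z), this bounds the slope of h along the rays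
   arg s = +-a1 from |s| = |s_z| on. *)
Lemma dlg_ray (a c : R) (g lg : C -> C) :
  PI / 2 < a <= PI -> 0 < c -> admissible a c g lg ->
  forall a1 b, PI / 2 < a1 < a -> 0 <= b < a1 -> exists c0 X, 0 < c0 /\
    forall x t0 y t1, X <= x <= y -> Rabs t0 <= b -> Rabs t1 = a1 ->
    Re (Cexp (0, t1) * (dlg lg (y, t1) - dlg lg (x, t0)))%C <= - c0 * epsR lg x.
Proof.
intros Ha Hc H a1 b Ha1 Hb. assert (HPI := PI_4). assert (HPI2 := PI2_1).
set (Cc := - cos a1). set (S := sin a1).
assert (HC : 0 < Cc) by (assert (cos a1 < 0) by (apply cos_lt_0; lra); unfold Cc; lra).
assert (HC1 : Cc <= 1) by (unfold Cc; assert (Q := COS_bound a1); lra).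
assert (HS : 0 < S) by (apply sin_gt_0; lra).
assert (HS1 : S <= 1) by apply SIN_bound.
set (k := S * (a1 - b)).
assert (Hk : 0 < k) by (apply Rmult_lt_0_compat; lra).
(* In the final sum Cc / 10 lets Cc * I absorb ten terms eta * I, and k / 20 leaves half of k *
   Ex. *)
set (eta := Rmin (Rmin 1 (Cc / 10)) (k / 20)).
assert (Heta : 0 < eta) by (repeat apply Rmin_glb_lt; lra).
assert (Heta1 : eta <= 1) by (eapply Rle_trans; [apply Rmin_l|apply Rmin_l]).
assert (Heta2 : eta <= Cc / 10) by (eapply Rle_trans; [apply Rmin_l|apply Rmin_r]).
assert (Heta3 : eta <= k / 20) by apply Rmin_r.
destruct (eps_log_near_real a c g lg Ha Hc H a1 eta ltac:(lra) Heta) as [X1 HX1].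
destruct (epsR_vs_ell a c g lg Ha Hc H eta Heta) as [X2 HX2].
exists (k / 2), (Rmax X1 X2). split; [lra|].
intros x t0 y t1 Hxy Ht0 Ht1.
assert (M1 := Rmax_l X1 X2). assert (M2 := Rmax_r X1 X2).
destruct (epsR_spec a c x g lg Ha Hc H) as [Px _]. destruct (epsR_spec a c y g lg Ha Hc H) as [Py _].
destruct (HX2 x y ltac:(lra)) as [I0 I1].
set (I := Re (ell lg (y, 0)) - Re (ell lg (x, 0))) in *.
set (Ex := epsR lg x) in *. set (Ey := epsR lg y) in *.
assert (V1 := ell_vertical a c g lg y t1 (eta * Ey) Ha Hc H ltac:(lra) (fun s Hs => HX1 y s ltac:(lra) ltac:(lra))).
assert (V0 := ell_vertical a c g lg x t0 (eta * Ex) Ha Hc H ltac:(lra) (fun s Hs => HX1 x s ltac:(lra) ltac:(lra))).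
assert (N1 := HX1 y t1 ltac:(lra) ltac:(lra)). assert (N0 := HX1 x t0 ltac:(lra) ltac:(lra)).
fold Ex in V0, N0. fold Ey in V1, N1.
assert (V1' : eta * Ey * Rabs t1 <= 4 * (eta * Ey)) by (rewrite Ht1, (Rmult_comm _ a1); apply Rmult_le_compat_r; [apply Rmult_le_pos|]; lra).
assert (V0' : eta * Ex * Rabs t0 <= 4 * (eta * Ex)).
{ rewrite (Rmult_comm _ (Rabs t0)). apply Rmult_le_compat_r; [apply Rmult_le_pos|]; lra. }
(* The model of Phi(y, t1) - Phi(x, t0): the increment of log |L|, the change of epsilon, and the
   arguments epsilon t of L. Far from x the gain -Cc * I dominates; near x, where Ey is close to Ex,
   the gain is k * Ex, from the gap a1 - b between the arguments. *)
set (p := (((I + (Ey - Ex))%R, (t1 * Ey - t0 * Ex)%R) : C)).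
set (r := (dlg lg (y, t1) - dlg lg (x, t0) - p)%C).
assert (Hr : Cmod r <= 5 * eta * (Ey + Ex)).
{ replace r with ((ell lg (y, t1) - RtoC (Re (ell lg (y, 0))) - RtoC Ey * (0, t1))
    + (eps_log lg (y, t1) - RtoC Ey) + - ((ell lg (x, t0) - RtoC (Re (ell lg (x, 0))) - RtoC Ex * (0, t0))
    + (eps_log lg (x, t0) - RtoC Ex)))%C.
  - eapply Rle_trans; [apply Cmod_triangle|]. rewrite Cmod_opp.
    eapply Rle_trans; [apply Rplus_le_compat; apply Cmod_triangle|]. lra.
  - unfold r, p, I. rewrite !dlg_split.
    generalize (Re (ell lg (y, 0))) (Re (ell lg (x, 0))). intros ly lx.
    destruct (ell lg (y, t1)), (ell lg (x, t0)), (eps_log lg (y, t1)), (eps_log lg (x, t0)).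
    unfold RtoC, Cplus, Cminus, Copp, Cmult; simpl. apply (f_equal2 (@pair R R)); simpl; ring. }
replace (dlg lg (y, t1) - dlg lg (x, t0))%C with (p + r)%C by (unfold r; ring).
rewrite Cmult_plus_distr_l.
change (Re (Cexp (0, t1) * p + Cexp (0, t1) * r)%C)
  with (Re (Cexp (0, t1) * p)%C + Re (Cexp (0, t1) * r)%C).
assert (R1 : Re (Cexp (0, t1) * r)%C <= 5 * eta * (Ey + Ex)).
{ eapply Rle_trans; [apply Rle_abs|]. eapply Rle_trans; [apply re_le_Cmod|].
  rewrite Cmod_mult, Cmod_Cexp. change (Re (0, t1)) with 0. rewrite exp_0. lra. }
rewrite Re_Cexp_mult. change (Re p) with (I + (Ey - Ex)).
change (Im p) with (t1 * Ey - t0 * Ex).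
(* The sign of t1 drops out, so both rays are treated together. *)
assert (Hcs : cos t1 = - Cc /\ S * (a1 * Ey - b * Ex) <= sin t1 * (t1 * Ey - t0 * Ex)).
{ apply Rabs_le_between in Ht0. unfold Rabs in Ht1. destruct (Rcase_abs t1).
  - replace t1 with (- a1) by lra. rewrite cos_neg, sin_neg. fold S. split; [unfold Cc; ring|].
    replace (- S * (- a1 * Ey - t0 * Ex)) with (S * (a1 * Ey + t0 * Ex)) by ring.
    apply Rmult_le_compat_l; [lra|]. nra.
  - replace t1 with a1 by lra. fold S. split; [unfold Cc; ring|].
    apply Rmult_le_compat_l; [lra|]. nra. }
destruct Hcs as [-> Hsn].
apply Rabs_le_between in I1.
assert (A1 : S * (a1 * (Ex - eta * I) - b * Ex) <= S * (a1 * Ey - b * Ex)).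
{ apply Rmult_le_compat_l; [lra|]. assert (a1 * (Ex - eta * I) <= a1 * Ey) by (apply Rmult_le_compat_l; lra). lra. }
assert (A2 : S * (a1 * (Ex - eta * I) - b * Ex) = k * Ex - S * a1 * (eta * I)) by (unfold k; ring).
assert (HetaI : 0 <= eta * I) by nra.
assert (A3 : S * a1 * (eta * I) <= 4 * (eta * I)) by (apply Rmult_le_compat_r; nra).
assert (A4 : - Cc * (I + (Ey - Ex)) <= - Cc * I + eta * I) by nra.
assert (A5 : 5 * eta * (Ey + Ex) <= 10 * eta * Ex + 5 * (eta * I)).
{ assert (eta * (eta * I) <= 1 * (eta * I)) by (apply Rmult_le_compat_r; lra).
  assert (eta * Ey <= eta * (Ex + eta * I)) by (apply Rmult_le_compat_l; lra). lra. }
assert (A6 : 10 * (eta * I) <= Cc * I).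
{ replace (10 * (eta * I)) with (10 * eta * I) by ring. apply Rmult_le_compat_r; lra. }
assert (A7 : 10 * eta * Ex <= k / 2 * Ex) by (apply Rmult_le_compat_r; lra).
lra.
Qed.

(** The exponent is s (log L(s) - w). On these rays log L(s) - w is the real number l plus a bounded
    term, because epsilon is bounded; l tends to infinity by (A), and cos t stays below a negative
    constant. *)
Lemma integrand_decay (a c : R) (g lg : C -> C) :
  PI / 2 < a <= PI -> 0 < c -> admissible a c g lg ->
  forall a0 a1 w, PI / 2 < a0 -> a1 < a -> exists X, forall x t, X <= x -> a0 <= Rabs t <= a1 ->
    Cmod (Cexp (lg (Cexp (x, t)) - Cexp (x, t) * w)) <= exp (- exp x).
Proof.
intros Ha Hc H a0 a1 w Ha0 Ha1. assert (HPI := PI_4). assert (HPI2 := PI2_1).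
destruct (Rlt_le_dec a1 a0) as [E|Ha01].
{ exists 0. intros x t _ Ht. lra. }
destruct (epsR_bounded a c g lg Ha Hc H) as [M HM].
destruct (eps_log_near_real a c g lg Ha Hc H a1 1 Ha1 Rlt_0_1) as [X1 HX1].
set (Cc := - cos a0).
assert (HC : 0 < Cc) by (assert (cos a0 < 0) by (apply cos_lt_0; lra); unfold Cc; lra).
(* The two terms i t epsilon and the error of [ell_vertical] are at most 4 M each, as |t| < 4. *)
set (K := 8 * M + Cmod w).
destruct (ell_real_infty a c g lg Ha Hc H ((K + 1) / Cc)) as [X2 HX2].
exists (Rmax X1 X2). intros x t Hx Ht.
assert (L1 := Rle_trans _ _ _ (Rmax_l _ _) Hx). assert (L2 := Rle_trans _ _ _ (Rmax_r _ _) Hx).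
specialize (HX2 x L2). set (l := Re (ell lg (x, 0))) in *.
apply Rle_div_l in HX2; [|lra].
destruct (epsR_spec a c x g lg Ha Hc H) as [Px _]. specialize (HM x).
assert (V := ell_vertical a c g lg x t (1 * epsR lg x) Ha Hc H ltac:(lra) (fun s Hs => HX1 x s ltac:(lra) ltac:(lra))).
fold l in V. set (E := epsR lg x) in *.
rewrite Cmod_Cexp. apply exp_le.
set (r := (ell lg (x, t) - RtoC l - w)%C).
assert (Hr : Cmod r <= K).
{ replace r with ((ell lg (x, t) - RtoC l - RtoC E * (0, t)) + (RtoC E * (0, t) + - w))%C by (unfold r; ring).
  eapply Rle_trans; [apply Cmod_triangle|].
  assert (T := Cmod_triangle (RtoC E * (0, t)) (- w)).
  rewrite Cmod_opp, Cmod_mult, Cmod_R, (Rabs_pos_eq E) in T by lra.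
  assert (B : Cmod (0, t) <= Rabs t).
  { eapply Rle_trans; [apply Cmod_le_abs|]. unfold Re, Im; simpl. rewrite Rabs_R0. lra. }
  assert (E * Cmod (0, t) <= M * 4) by (apply Rmult_le_compat; try lra; apply Cmod_ge_0).
  assert (E * Rabs t <= M * 4) by (apply Rmult_le_compat; lra).
  unfold K. lra. }
replace (lg (Cexp (x, t)) - Cexp (x, t) * w)%C with (Cexp (x, t) * (RtoC l + r))%C.
2:{ unfold r, ell, logL. field. apply Cexp_neq_0. }
assert (Eexp : Cexp (x, t) = (RtoC (exp x) * Cexp (0%R, t))%C).
{ rewrite RtoC_exp, <- Cexp_plus. f_equal. unfold RtoC, Cplus; simpl. f_equal; ring. }
rewrite Eexp, <- Cmult_assoc.
replace (Re (RtoC (exp x) * (Cexp (0%R, t) * (RtoC l + r)))%C) with (exp x * Re (Cexp (0, t) * (RtoC l + r))%C)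
  by (unfold RtoC, Cmult, Re; simpl; ring).
rewrite Cmult_plus_distr_l.
change (Re (Cexp (0, t) * RtoC l + Cexp (0, t) * r)%C) with (Re (Cexp (0, t) * RtoC l)%C + Re (Cexp (0, t) * r)%C).
rewrite Re_Cexp_mult. change (Re (RtoC l)) with l. change (Im (RtoC l)) with 0.
assert (R1 : Re (Cexp (0, t) * r)%C <= K).
{ eapply Rle_trans; [apply Rle_abs|]. eapply Rle_trans; [apply re_le_Cmod|].
  rewrite Cmod_mult, Cmod_Cexp. change (Re (0, t)) with 0. rewrite exp_0. lra. }
assert (Hct : cos t <= - Cc).
{ replace (cos t) with (cos (Rabs t)) by (unfold Rabs; destruct (Rcase_abs t); [apply cos_neg|easy]).
  unfold Cc. rewrite Ropp_involutive.
  destruct (Req_dec a0 (Rabs t)) as [<-|N]; [lra|]. left; apply cos_decreasing_1; lra. }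
assert (HK : 0 <= K) by (eapply Rle_trans; [apply Cmod_ge_0|exact Hr]).
assert (Hl : 0 < l) by nra.
assert (cos t * l <= - Cc * l) by (apply Rmult_le_compat_r; lra).
assert (0 < exp x) by apply exp_pos. nra.
Qed.

(** The limit is found for each component along the integers, where completeness is available for
    sequences. *)
Lemma Cauchy_limit (f : R -> C) :
  (forall e, 0 < e -> exists X, forall x y, X <= x <= y -> Cmod (f y - f x)%C <= e) ->
  exists l, forall e, 0 < e -> exists X, forall x, X <= x -> Cmod (f x - l)%C <= e.
Proof.
intros H.
assert (Cv : forall h : C -> R, (forall z w, Rabs (h z - h w) <= Cmod (z - w)%C) ->
  exists l, forall e, 0 < e -> exists X, forall x, X <= x -> Rabs (h (f x) - l) <= e).
{ intros h Hh.
  assert (Cr : ex_finite_lim_seq (fun n => h (f (INR n)))).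
  { apply ex_lim_seq_cauchy_corr. intros e.
    destruct (H (e / 2)) as [X HX]; [assert (P := cond_pos e); lra|].
    destruct (INR_unbounded X) as [N HN]. exists N.
    assert (Sym : forall n m, (N <= n)%nat -> (n <= m)%nat -> Rabs (h (f (INR n)) - h (f (INR m))) < e).
    { intros n m Hn Hm. apply le_INR in Hn, Hm. rewrite Rabs_minus_sym.
      eapply Rle_lt_trans; [apply Hh|]. eapply Rle_lt_trans; [apply HX; lra|].
      assert (P := cond_pos e). lra. }
    intros n m Hn Hm. destruct (Nat.le_ge_cases n m) as [L|L]; [now apply Sym|].
    rewrite Rabs_minus_sym. now apply Sym. }
  destruct Cr as [l Hl]. exists l. intros e He.
  destruct (H (e / 2)) as [X HX]; [lra|]. exists X. intros x Hx.
  apply is_lim_seq_spec in Hl. destruct (Hl (mkposreal (e / 2) ltac:(lra))) as [N HN]. simpl in HN.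
  destruct (INR_unbounded (Rmax x (INR N))) as [n Hn].
  assert (M1 := Rmax_l x (INR N)). assert (M2 := Rmax_r x (INR N)).
  assert (HnN : (N <= n)%nat) by (apply INR_le; lra).
  specialize (HN n HnN). assert (Q := HX x (INR n) ltac:(lra)).
  assert (Q' := Rle_trans _ _ _ (Hh (f (INR n)) (f x)) Q).
  replace (h (f x) - l) with (- (h (f (INR n)) - h (f x)) + (h (f (INR n)) - l)) by ring.
  eapply Rle_trans; [apply Rabs_triang|]. rewrite Rabs_Ropp. lra. }
destruct (Cv Re) as [l1 H1]; [intros; apply (re_le_Cmod (z - w))|].
destruct (Cv Im) as [l2 H2]; [intros; apply (Im_le_Cmod (z - w))|].
exists (l1, l2). intros e He.
destruct (H1 (e / 2)) as [X1 HX1]; [lra|]. destruct (H2 (e / 2)) as [X2 HX2]; [lra|].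
exists (Rmax X1 X2). intros x Hx.
assert (L1 := Rle_trans _ _ _ (Rmax_l _ _) Hx). assert (L2 := Rle_trans _ _ _ (Rmax_r _ _) Hx).
eapply Rle_trans; [apply Cmod_le_abs|].
change (Re (f x - (l1, l2))%C) with (Re (f x) - l1). change (Im (f x - (l1, l2))%C) with (Im (f x) - l2).
specialize (HX1 x L1). specialize (HX2 x L2). lra.
Qed.

(** * The function K and the square root *)

(** A compactness argument: finitely many points have neighbourhoods that cover the rectangle and on
    which f varies by less than 1. *)
Lemma rectangle_bounded (f : C -> C) (x0 x1 t0 t1 : R) :
  (forall x t, x0 <= x <= x1 -> t0 <= t <= t1 -> Ccont f (x, t)) ->
  exists M, forall x t, x0 <= x <= x1 -> t0 <= t <= t1 -> Cmod (f (x, t)) <= M.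
Proof.
intros H.
(* Points outside the rectangle get the default radius 1. The factor 2 passes from coordinatewise
   distance to the modulus. *)
assert (D : forall p : C, {d : posreal | x0 <= fst p <= x1 -> t0 <= snd p <= t1 ->
   forall w, Cmod (w - p) < 2 * d -> Cmod (f w - f p)%C < 1}).
{ intros p. apply constructive_indefinite_description.
  destruct (classic ((x0 <= fst p <= x1) /\ (t0 <= snd p <= t1))) as [[I1 I2]|N].
  - destruct p as [x t]. destruct (H x t I1 I2 1 Rlt_0_1) as [d [Hd Hd']].
    assert (Hd2 : 0 < d / 2) by lra. exists (mkposreal _ Hd2). simpl. intros _ _ w Hw. apply Hd'. lra.
  - exists (mkposreal 1 Rlt_0_1). intros I1 I2. exfalso. now apply N. }
assert (L := Compactness.compactness_list 2 (x0, (t0, tt)) (x1, (t1, tt))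
  (fun p => proj1_sig (D (fst p, fst (snd p))))).
apply NNPP in L. destruct L as [l Hl].
assert (B : exists M, forall p, In p l -> Cmod (f (fst p, fst (snd p))) <= M).
{ clear Hl. induction l as [|p l [M HM]].
  - exists 0. intros p [].
  - exists (Rmax M (Cmod (f (fst p, fst (snd p))))). intros p' [<-|Hp]; [apply Rmax_r|].
    eapply Rle_trans; [now apply HM|apply Rmax_l]. }
destruct B as [M HM]. exists (M + 1). intros x t Hx Ht.
destruct (Hl (x, (t, tt))) as [[u [v []]] [Hin [Hb Hc]]].
{ simpl. tauto. }
simpl in Hb, Hc. destruct Hb as [Hu [Hv _]]. destruct Hc as [Hcu [Hcv _]].
specialize (HM _ Hin). simpl in HM.
destruct (D (u, v)) as [d Hd]. simpl in *.
assert (Q := Hd Hu Hv (x, t)).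
assert (Q' : Cmod (f (x, t) - f (u, v))%C < 1).
{ apply Q. eapply Rle_lt_trans; [apply Cmod_le_abs|].
  change (Re ((x, t) - (u, v))%C) with (x - u). change (Im ((x, t) - (u, v))%C) with (t - v). lra. }
assert (T := Cmod_sub_ge (f (x, t)) (f (u, v))). lra.
Qed.

Lemma polar_line (r t : R) : polar r t = (0 + RtoC r * polar 1 t)%C.
Proof. unfold polar, RtoC, Cplus, Cmult; simpl. f_equal; ring. Qed.

Lemma polar_Cexp (r t : R) : 0 < r -> polar r t = Cexp (ln r, t).
Proof. intros Hr. unfold Cexp, Re, Im; simpl. now rewrite exp_ln. Qed.

(** Along each ray the integral is the limit of F minus F 0; the start value is common to all rays
    and cancels in K. *)
Lemma ray_integral_primitive (f F : C -> C) (t : R) (l : C) :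
  (forall r, 0 <= r -> is_Cder F (polar r t) (f (polar r t)) /\ Cdiff f (polar r t)) ->
  (forall e, 0 < e -> exists X, forall x, X <= x -> Cmod (F (Cexp (x, t)) - l)%C <= e) ->
  ray_integral f t = (l - F 0)%C.
Proof.
intros HF Hl. unfold ray_integral.
apply (is_RInt_gen_unique (V := C_R_CompleteNormedModule)).
intros Q [e He].
assert (He2 : 0 < e / 2) by (assert (P := cond_pos e); lra).
destruct (Hl (e / 2) He2) as [X HX].
exists (fun x => x = 0) (fun r => Rmax 1 (exp X) < r); [reflexivity|now exists (Rmax 1 (exp X))|].
intros x r -> Hr. simpl.
assert (M1 := Rmax_l 1 (exp X)). assert (M2 := Rmax_r 1 (exp X)).
exists (F (polar r t) - F 0)%C. split.
- replace (F 0) with (F (polar 0 t)) by (f_equal; unfold polar, RtoC; f_equal; ring).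
  apply (is_RInt_derive (V := C_R_CompleteNormedModule) (fun r => F (polar r t)));
    intros y Hy; rewrite Rmin_left, Rmax_right in Hy by lra.
  + destruct (HF y ltac:(lra)) as [D _]. rewrite polar_line in D.
    assert (D' : is_Cpath (fun u => F (0 + RtoC u * polar 1 t)%C) y (f (polar y t) * polar 1 t)%C).
    { apply (Cpath_comp F (fun u => 0 + RtoC u * polar 1 t)%C); [|apply Cpath_line].
      rewrite (polar_line y t) at 1. exact D. }
    revert D'. apply is_derive_ext. intros u. now rewrite <- polar_line.
  + destruct (HF y ltac:(lra)) as [_ D]. apply Rcont_continuous.
    rewrite polar_line in D. assert (C1 := Rcont_edge f 0 (polar 1 t) y D).
    intros e' He'. destruct (C1 e' He') as [d [Hd Hd']]. exists d; split; [easy|].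
    intros u Hu. rewrite (polar_line u t), (polar_line y t). apply Hd', Hu.
- apply He. apply Cball_intro.
  replace (F (polar r t) - F 0 - (l - F 0))%C with (F (polar r t) - l)%C by ring.
  rewrite polar_Cexp by lra. eapply Rle_lt_trans; [apply HX|lra].
  rewrite <- (ln_exp X). left. apply ln_increasing; [apply exp_pos|lra].
Qed.

Lemma exp_exp_small (e : R) : 0 < e -> exists X, forall x, X <= x ->
  exp (- exp x) <= e /\ exp x * exp (- exp x) <= e.
Proof.
intros He. exists (Rmax 0 (ln (4 / e))). intros x Hx.
assert (M1 := Rle_trans _ _ _ (Rmax_l _ _) Hx). assert (M2 := Rle_trans _ _ _ (Rmax_r _ _) Hx).
assert (Hx1 : 1 <= exp x) by (rewrite <- exp_0; now apply exp_le).
assert (P4 : 0 < 4 / e) by (apply Rdiv_lt_0_compat; lra).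
assert (Hx2 : 4 / e <= exp x) by (rewrite <- (exp_ln (4 / e)) by easy; now apply exp_le).
apply Rle_div_l in Hx2; [|easy].
set (y := exp x) in *.
assert (E : exp (- y) = exp (- (y / 2)) * exp (- (y / 2))) by (rewrite <- exp_plus; f_equal; field).
assert (B := exp_opp_le (y / 2) ltac:(lra)).
assert (P := exp_pos (- (y / 2))).
assert (B2 : exp (- y) <= / (y / 2) * / (y / 2)) by (rewrite E; apply Rmult_le_compat; lra).
assert (B3 : y * exp (- y) <= e).
{ apply Rle_trans with (y * (/ (y / 2) * / (y / 2))); [apply Rmult_le_compat_l; lra|].
  replace (y * (/ (y / 2) * / (y / 2))) with (4 / y) by (field; lra).
  apply Rle_div_l; lra. }
split; [|exact B3]. assert (0 < exp (- y)) by apply exp_pos. nra.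
Qed.

(** The arc |s| = e^x between the angles al and a1 contributes O(e^x exp(-e^x)), so F has the same
    limit along both rays. This allows the rays of K to be turned from al to a1. *)
Lemma K_primitive (a c : R) (g lg : C -> C) (al a1 : R) (z : log_surface) :
  PI / 2 < a <= PI -> 0 < c -> admissible a c g lg -> PI / 2 < al <= a1 -> a1 < a ->
  exists F Fp Fm : _,
    (forall s, angle a c s -> is_Cder F s (Cexp (lg s - s * Log z))) /\
    (forall e, 0 < e -> exists X, forall x, X <= x -> Cmod (F (Cexp (x, a1)) - Fp)%C <= e) /\
    (forall e, 0 < e -> exists X, forall x, X <= x -> Cmod (F (Cexp (x, (- a1)%R)) - Fm)%C <= e) /\
    K g al z = ((Fp - Fm) / (RtoC (2 * PI) * Ci))%C.
Proof.
intros Ha Hc H Hal Ha1. assert (HPI := PI_4).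
set (w := Log z). set (f := (fun s => Cexp (lg s - s * w))%C).
assert (Hf : forall s, angle a c s -> Cdiff f s).
{ intros s Hs. eexists. apply (Cder_comp Cexp (fun s => lg s - s * w)%C); [apply Cder_Cexp|].
  apply Cder_minus; [now apply (lg_der a c g)|].
  apply (Cder_mult (fun s => s) (fun _ => w)); [apply Cder_id|apply Cder_const]. }
assert (Hfg : forall s, angle a c s -> (pow_opp z s * g s)%C = f s).
{ intros s Hs. destruct (adm_log _ _ _ _ H) as [_ [He _]]. rewrite <- (He s Hs).
  unfold pow_opp, f. rewrite <- Cexp_plus. f_equal. fold w. ring. }
destruct (star_primitive (angle a c) f 0 (angle_open a c Ha) (angle_star a c Ha Hc) Hf) as [F HF].
destruct (integrand_decay a c g lg Ha Hc H al a1 w ltac:(lra) Ha1) as [X0 HX0].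
assert (Rad : forall t, al <= Rabs t <= a1 -> forall x y, X0 <= x <= y ->
  Cmod (F (Cexp (y, t)) - F (Cexp (x, t)))%C <= exp (- exp x)).
{ intros t Ht x y Hxy.
  apply Rle_trans with (- exp (- exp y) - - exp (- exp x)).
  - apply (path_dominated (fun x => F (Cexp (x, t))) (fun x => f (Cexp (x, t)) * Cexp (x, t))%C
      (fun u => - exp (- exp u)) (fun u => exp (- exp u) * exp u)); [lra|].
    intros u Hu. split; [|split].
    + apply (Cpath_h (fun z => F (Cexp z)) u t). apply (Cder_comp F Cexp); [|apply Cder_Cexp].
      apply HF, angle_Cexp; auto; lra.
    + auto_derive; [easy|ring].
    + rewrite Cmod_mult. rewrite (Cmod_Cexp (u, t)). change (Re (u, t)) with u.
      apply Rmult_le_compat_r; [left; apply exp_pos|]. apply HX0; lra.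
  - assert (0 < exp (- exp y)) by apply exp_pos. lra. }
assert (Lim : forall sg, (sg = 1 \/ sg = -1) -> exists l,
  (forall e, 0 < e -> exists X, forall x, X <= x -> Cmod (F (Cexp (x, (sg * al)%R)) - l)%C <= e) /\
  (forall e, 0 < e -> exists X, forall x, X <= x -> Cmod (F (Cexp (x, (sg * a1)%R)) - l)%C <= e)).
{ intros sg Hsg.
  assert (Habs : forall t, al <= t <= a1 -> al <= Rabs (sg * t) <= a1).
  { intros t Ht. destruct Hsg as [-> | ->].
    - rewrite Rmult_1_l, Rabs_pos_eq; lra.
    - replace (-1 * t) with (- t) by ring. rewrite Rabs_Ropp, Rabs_pos_eq; lra. }
  destruct (Cauchy_limit (fun x => F (Cexp (x, (sg * al)%R)))) as [l Hl].
  { intros e He. destruct (exp_exp_small e He) as [X HX]. exists (Rmax X X0). intros x y Hxy.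
    assert (M1 := Rmax_l X X0). assert (M2 := Rmax_r X X0).
    eapply Rle_trans; [apply Rad; [apply Habs; lra|lra]|]. apply HX; lra. }
  exists l. split; [exact Hl|]. intros e He.
  destruct (Hl (e / 2)) as [X1 HX1]; [lra|].
  destruct (exp_exp_small (e / 8)) as [X2 HX2]; [lra|].
  exists (Rmax X1 (Rmax X2 X0)). intros x Hx.
  assert (L1 := Rle_trans _ _ _ (Rmax_l _ _) Hx). assert (L' := Rle_trans _ _ _ (Rmax_r _ _) Hx).
  assert (L2 := Rle_trans _ _ _ (Rmax_l _ _) L'). assert (L3 := Rle_trans _ _ _ (Rmax_r _ _) L').
  specialize (HX1 x L1). destruct (HX2 x L2) as [_ B].
  eapply Rle_trans; [apply (Cmod_triangle3 _ (F (Cexp (x, (sg * al)%R))))|].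
  (* The arc has angular width below 4 and costs at most m <= e / 8 per unit of angle. *)
  enough (Cmod (F (Cexp (x, (sg * a1)%R)) - F (Cexp (x, (sg * al)%R)))%C <= 4 * (e / 8)) by lra.
  set (m := exp x * exp (- exp x)) in *.
  apply Rle_trans with (a1 * m - al * m).
  - apply (path_dominated (fun t => F (Cexp (x, (sg * t)%R))) (fun t => f (Cexp (x, (sg * t)%R)) * Cexp (x, (sg * t)%R) * (Ci * RtoC sg))%C
      (fun t => t * m) (fun _ => m)); [lra|].
    intros t Ht. specialize (Habs t Ht). split; [|split].
    + assert (D : is_Cpath (fun t => F (Cexp ((x, 0) + RtoC t * (Ci * RtoC sg)))) t
          (f (Cexp (x, (sg * t)%R)) * Cexp (x, (sg * t)%R) * (Ci * RtoC sg))%C).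
      { apply (Cpath_comp (fun z => F (Cexp z)) (fun t => (x, 0) + RtoC t * (Ci * RtoC sg))%C); [|apply Cpath_line].
        replace ((x, 0) + RtoC t * (Ci * RtoC sg))%C with (x, (sg * t)%R).
        2:{ unfold RtoC, Ci, Cplus, Cmult; simpl. f_equal; ring. }
        apply (Cder_comp F Cexp); [|apply Cder_Cexp]. apply HF, angle_Cexp; auto; lra. }
      revert D. apply is_derive_ext. intros u. f_equal. f_equal.
      unfold RtoC, Ci, Cplus, Cmult; simpl. f_equal; ring.
    + auto_derive; [easy|ring].
    + rewrite !Cmod_mult, Cmod_Ci, (Cmod_Cexp (x, _)), Cmod_R. change (Re (x, (sg * t)%R)) with x.
      replace (Rabs sg) with 1.
      2:{ destruct Hsg as [-> | ->]; [rewrite Rabs_pos_eq; lra|]. rewrite Rabs_left; lra. }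
      unfold m. rewrite !Rmult_1_r, (Rmult_comm (exp x)). apply Rmult_le_compat_r; [left; apply exp_pos|].
      apply HX0; lra.
  - assert (0 < m) by (apply Rmult_lt_0_compat; apply exp_pos). nra. }
destruct (Lim 1 (or_introl eq_refl)) as [Fp [Lp1 Lp2]].
destruct (Lim (-1) (or_intror eq_refl)) as [Fm [Lm1 Lm2]].
rewrite Rmult_1_l in Lp1, Lp2.
replace (-1 * al) with (- al) in Lm1 by ring. replace (-1 * a1) with (- a1) in Lm2 by ring.
exists F, Fp, Fm. split; [exact HF|]. split; [exact Lp2|]. split; [exact Lm2|].
assert (Ray : forall t l, Rabs t < a ->
  (forall e, 0 < e -> exists X, forall x, X <= x -> Cmod (F (Cexp (x, t)) - l)%C <= e) ->
  ray_integral (fun s => pow_opp z s * g s)%C t = (l - F 0)%C).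
{ intros t l Ht Hl. apply ray_integral_primitive; [|exact Hl].
  intros r Hr. assert (An : angle a c (polar r t)) by now apply angle_polar.
  split; [rewrite Hfg by exact An; now apply HF|].
  destruct (Hf _ An) as [l' Hl']. exists l'. apply (Cder_ext_loc f); [|exact Hl'].
  destruct (angle_open a c Ha _ An) as [d [Hd Hd']]. exists d; split; [easy|].
  intros v Hv. symmetry. apply Hfg, Hd', Hv. }
unfold K.
rewrite (Ray al Fp); [|rewrite Rabs_pos_eq; lra|exact Lp1].
rewrite (Ray (- al) Fm); [|rewrite Rabs_Ropp, Rabs_pos_eq; lra|exact Lm1].
unfold Cdiv. ring.
Qed.

(** * The branch of the square root *)

Lemma Csqr_near_one (k : C) (e : R) :
  0 < Re k -> Cmod (k * k - 1) <= e -> Cmod (k - 1) <= e.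
Proof.
intros Hk He. replace (k * k - 1)%C with ((k + 1) * (k - 1))%C in He by ring.
rewrite Cmod_mult in He.
assert (H1 : 1 <= Cmod (k + 1)).
{ assert (Q := Rle_trans _ _ _ (Rle_abs _) (re_le_Cmod (k + 1))).
  change (Re (k + 1)%C) with (Re k + 1) in Q. lra. }
assert (H0 := Cmod_ge_0 (k - 1)). nra.
Qed.

(* A square root that stays near 1 or -1 cannot change sign along a path. *)
Lemma sqrt_near_one (k : R -> C) (e : R) :
  e < 1 -> (forall t, 0 <= t <= 1 -> Rcont k t) -> 0 < Re (k 0) ->
  (forall t, 0 <= t <= 1 -> Cmod (k t * k t - 1)%C <= e) -> Cmod (k 1 - 1)%C <= e.
Proof.
intros He Hc H0 Hk. apply Csqr_near_one; [|apply Hk; lra].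
(* The square of an imaginary number is at distance at least 1 from 1. *)
assert (NZ : forall t, 0 <= t <= 1 -> Re (k t) <> 0).
{ intros t Ht E. specialize (Hk t Ht).
  assert (Q := re_le_Cmod (k t * k t - 1)). apply Rabs_le_between in Q.
  replace (Re (k t * k t - 1)%C) with (Re (k t) * Re (k t) - Im (k t) * Im (k t) - 1) in Q
    by (unfold Cminus, Cplus, Copp, Cmult, RtoC, Re, Im; simpl; ring).
  rewrite E in Q. assert (0 <= Im (k t) * Im (k t)) by nra. lra. }
destruct (Rtotal_order 0 (Re (k 1))) as [G|[G|G]]; [exact G| |].
- exfalso. apply (NZ 1); [lra|easy].
- exfalso.
  destruct (IVT_interv (fun t => - Re (k t)) 0 1) as [t [Ht E]]; try lra.
  + intros t Ht. apply continuity_pt_filterlim. intros P [ep Hep].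
    destruct (Hc t Ht ep (cond_pos ep)) as [d [Hd Hd']].
    exists (mkposreal d Hd). intros u Hu. apply Hep.
    assert (Q := Hd' u Hu).
    assert (Q' := Rle_lt_trans _ _ _ (re_le_Cmod _) Q).
    change (Rabs (- Re (k u) - - Re (k t)) < ep).
    replace (- Re (k u) - - Re (k t)) with (- (Re (k u - k t)%C)) by (unfold Cminus, Cplus, Copp, Re; simpl; ring).
    now rewrite Rabs_Ropp.
  + apply (NZ t Ht). lra.
Qed.

(** The radicand is s / (2 pi epsilon(s)). The quotient of q by its expected value is followed along
    the arc from |s| to s: it is positive at the start, and its square is epsilon(|s|) / epsilon(s),
    which lies within 2 e of 1. *)
Lemma sqrt_branch_near (a c b rho1 x th e : R) (g lg q : C -> C) :
  PI / 2 < a <= PI -> 0 < c -> admissible a c g lg -> b < a -> rho1 < exp x -> Rabs th < b ->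
  0 < e <= / 4 ->
  (forall t, Rabs t <= Rabs th -> Cmod (eps_log lg (x, t) - RtoC (epsR lg x))%C <= e * epsR lg x) ->
  sqrt_branch (sector b rho1) (fun s => L lg s / (RtoC (2 * PI) * C_derive (L lg) s))%C q ->
  Cmod (q (Cexp (x, th)) - RtoC (sqrt (exp x / (2 * PI * epsR lg x))) * Cexp (0, (th / 2)%R))%C
    <= 2 * e * sqrt (exp x / (2 * PI * epsR lg x)).
Proof.
intros Ha Hc H Hb Hr Hth He Heps [Qc [Qs Qp]]. assert (HPI := PI_RGT_0).
destruct (epsR_spec a c x g lg Ha Hc H) as [PE _]. set (E := epsR lg x) in *.
assert (Pexp := exp_pos x).
assert (PG2 : 0 < exp x / (2 * PI * E)) by (apply Rdiv_lt_0_compat; nra).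
set (G := sqrt (exp x / (2 * PI * E))).
assert (PG : 0 < G) by now apply sqrt_lt_R0.
assert (GG : G * G = exp x / (2 * PI * E)) by (apply sqrt_sqrt; lra).
assert (Hsec : forall t, Rabs t <= Rabs th -> sector b rho1 (Cexp (x, t))).
{ intros t Ht. exists (exp x), t. split; [exact Hr|]. split; [lra|reflexivity]. }
set (k := fun t => (q (Cexp (x, (t * th)%R)) * (Cexp (0%R, (- (t * th) / 2)%R) * RtoC (/ G)))%C).
assert (In : forall t, 0 <= t <= 1 -> Rabs (t * th) <= Rabs th).
{ intros t Ht. rewrite Rabs_mult, (Rabs_pos_eq t) by lra. assert (P := Rabs_pos th). nra. }
assert (GC : RtoC G <> 0) by (intros Z; apply RtoC_inj in Z; lra).
assert (Line : forall y v t, is_Cpath (fun t => Cexp (y, (t * v)%R)) t (Cexp (y, (t * v)%R) * (Ci * RtoC v))%C).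
{ intros y v t.
  assert (D : is_Cpath (fun t => Cexp ((y, 0) + RtoC t * (Ci * RtoC v))) t (Cexp (y, (t * v)%R) * (Ci * RtoC v))%C).
  { apply (Cpath_comp Cexp (fun t => (y, 0) + RtoC t * (Ci * RtoC v))%C); [|apply Cpath_line].
    replace ((y, 0) + RtoC t * (Ci * RtoC v))%C with (y, (t * v)%R); [apply Cder_Cexp|].
    unfold RtoC, Ci, Cplus, Cmult; simpl. f_equal; ring. }
  revert D. apply is_derive_ext. intros u. f_equal.
  unfold RtoC, Ci, Cplus, Cmult; simpl. f_equal; ring. }
assert (K1 : Cmod (k 1 - 1)%C <= 2 * e).
{ apply sqrt_near_one; [lra| | |].
  - intros t Ht. apply Rcont_mult; [|apply Rcont_mult].
    + apply (Rcont_comp q (fun t => Cexp (x, (t * th)%R))).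
      * apply Ccont_of_continuous, Qc, Hsec, In, Ht.
      * eapply Cpath_Rcont, Line.
    + intros e' He'. destruct (Cpath_Rcont _ _ _ (Line 0 (- th / 2) t) e' He') as [d [Hd Hd']].
      exists d; split; [easy|]. intros u Hu.
      replace (- (u * th) / 2) with (u * (- th / 2)) by field.
      replace (- (t * th) / 2) with (t * (- th / 2)) by field. now apply Hd'.
    + intros e' He'. exists 1; split; [lra|]. intros u _.
      replace (RtoC (/ G) - RtoC (/ G))%C with (RtoC 0) by ring. now rewrite Cmod_0.
  - unfold k. rewrite Rmult_0_l. replace (- 0 / 2) with 0 by field.
    assert (E0 : Cexp (x, 0) = RtoC (exp x)) by (symmetry; apply RtoC_exp).
    replace (Cexp (0, 0)) with (RtoC 1) by (symmetry; apply Cexp_0).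
    rewrite E0, Cmult_1_l.
    destruct (Qp (exp x) Pexp) as [_ Q].
    { rewrite <- E0. apply Hsec. rewrite Rabs_R0. apply Rabs_pos. }
    replace (Re (q (RtoC (exp x)) * RtoC (/ G))%C) with (Re (q (RtoC (exp x))) * / G)
      by (unfold Cmult, RtoC, Re; simpl; ring).
    apply Rmult_lt_0_compat; [exact Q|now apply Rinv_0_lt_compat].
  - intros t Ht. set (y := t * th). set (s := Cexp (x, y)).
    assert (Hs0 : s <> 0) by apply Cexp_neq_0.
    assert (Hy := In t Ht). fold y in Hy.
    assert (Hs : angle a c s) by (apply angle_Cexp; auto; lra).
    specialize (Heps y Hy). fold E in Heps. set (ep := eps_log lg (x, y)) in *.
    assert (Hep : (1 - e) * E <= Cmod ep).
    { assert (T := Cmod_sub_ge (RtoC E) ep).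
      rewrite (Cmod_sub_sym (RtoC E) ep), Cmod_R, Rabs_pos_eq in T by lra. lra. }
    assert (Hep0 : 0 < Cmod ep) by nra.
    assert (Hepn : ep <> 0) by now apply Cmod_gt_0.
    assert (Hder := Cder_unique _ _ _ (logderiv_L a c g lg s Ha H Hs Hs0)).
    assert (H2PI : RtoC (2 * PI) <> 0) by (intros Z; apply RtoC_inj in Z; lra).
    assert (Qq : (q s * q s)%C = (s / (RtoC (2 * PI) * ep))%C).
    { rewrite Qs by (apply Hsec, Hy). rewrite Hder. change (eps1 lg s) with ep.
      field. repeat split; auto. apply Cexp_neq_0. }
    assert (Kk : (k t * k t)%C = (RtoC E / ep)%C).
    { unfold k. fold y. fold s.
      replace (q s * (Cexp (0%R, (- y / 2)%R) * RtoC (/ G)) * (q s * (Cexp (0%R, (- y / 2)%R) * RtoC (/ G))))%C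
        with ((q s * q s) * (Cexp (0%R, (- y / 2)%R) * Cexp (0%R, (- y / 2)%R)) * (RtoC (/ G) * RtoC (/ G)))%C by ring.
      rewrite Qq, <- Cexp_plus, <- RtoC_mult.
      replace ((0%R, (- y / 2)%R) + (0%R, (- y / 2)%R))%C with (- (0, y))%C.
      2:{ unfold Cplus, Copp; simpl. f_equal; field. }
      rewrite Cexp_opp.
      assert (Es : s = (RtoC (exp x) * Cexp (0%R, y))%C).
      { rewrite RtoC_exp, <- Cexp_plus. unfold s. f_equal. unfold RtoC, Cplus; simpl. f_equal; ring. }
      rewrite Es.
      replace (/ G * / G) with (2 * PI * E / exp x).
      2:{ rewrite <- Rinv_mult, GG. field. lra. }
      rewrite RtoC_div by lra. rewrite (RtoC_mult (2 * PI)).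
      assert (RtoC (exp x) <> 0) by (intros Z; apply RtoC_inj in Z; lra).
      field. repeat split; auto. apply Cexp_neq_0. }
    rewrite Kk. replace (RtoC E / ep - 1)%C with ((RtoC E - ep) / ep)%C by (field; exact Hepn).
    rewrite Cmod_div by exact Hepn. apply Rle_div_l; [lra|].
    rewrite Cmod_sub_sym. assert (Eh : E / 2 <= Cmod ep) by nra. assert (2 * e * (E / 2) <= 2 * e * Cmod ep) by (apply Rmult_le_compat_l; lra). lra. }
unfold k in K1. rewrite Rmult_1_l in K1.
set (s := Cexp (x, th)) in *. set (u := Cexp (0, (th / 2)%R)).
assert (Hu : Cexp (0%R, (- th / 2)%R) = (/ u)%C).
{ unfold u. rewrite <- Cexp_opp. f_equal. unfold Copp; simpl. f_equal; field. }
assert (Hu0 : u <> 0) by apply Cexp_neq_0.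
assert (Hum : Cmod u = 1) by (unfold u; rewrite Cmod_Cexp; apply exp_0).
rewrite Hu, RtoC_inv in K1 by lra.
replace (q s - RtoC G * u)%C with ((q s * (/ u * / RtoC G) - 1) * (RtoC G * u))%C by (field; auto).
rewrite !Cmod_mult, Hum, Cmod_R, (Rabs_pos_eq G) by lra. rewrite Rmult_1_r.
apply Rmult_le_compat_r; lra.
Qed.

(** Since log |z| = Re Phi(s_z), boundedness of Phi on truncated sectors turns |z| -> infinity into
    |s_z| -> infinity. *)
Lemma Phi_bounded (a c b r0 r1 : R) (g lg : C -> C) :
  PI / 2 < a <= PI -> 0 < c -> admissible a c g lg -> b < a -> 0 < r0 ->
  exists M, forall r t, r0 <= r <= r1 -> Rabs t <= b -> Cmod (Phi lg (polar r t)) <= M.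
Proof.
intros Ha Hc H Hb Hr0.
destruct (rectangle_bounded (dlg lg) (ln r0) (ln r1) (- b) b) as [M HM].
- intros x t _ Ht. eapply Cder_cont, (dlg_der a c x t g); auto. apply Rabs_def1; lra.
- exists M. intros r t Hr Ht.
  assert (An : angle a c (polar r t)) by (apply angle_polar; auto; lra).
  assert (N0 : polar r t <> 0).
  { intros Z. assert (Q := f_equal Cmod Z). rewrite Cmod_polar, Cmod_0 in Q; lra. }
  rewrite (Phi_eq a c g lg _ Ha H An N0), polar_Cexp by lra.
  apply Rabs_le_between in Ht. apply HM; [|lra].
  split; apply ln_le; lra.
Qed.

(** * The asymptotic formula *)

Lemma Rmax4_elim (A B C' D x : R) : Rmax (Rmax A B) (Rmax C' D) <= x -> A <= x /\ B <= x /\ C' <= x /\ D <= x.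
Proof.
intros H.
assert (H1 := Rle_trans _ _ _ (Rmax_l _ _) H). assert (H2 := Rle_trans _ _ _ (Rmax_r _ _) H).
assert (H3 := Rmax_l A B). assert (H4 := Rmax_r A B). assert (H5 := Rmax_l C' D). assert (H6 := Rmax_r C' D).
lra.
Qed.

(* G is the modulus of the square root in the main term. *)
Lemma K_asymptotic (a c b al e : R) (g lg : C -> C) :
  PI / 2 < a <= PI -> 0 < c -> admissible a c g lg -> PI / 2 < al <= b -> b < a -> 0 < e ->
  exists X, forall x th z, X <= x -> Rabs th <= b -> Log z = dlg lg (x, th) ->
    let s := Cexp (x, th) in
    let G := sqrt (exp x / (2 * PI * epsR lg x)) in
    Cmod (K g al z - RtoC G * Cexp (0, (th / 2)%R) * Cexp (lg s - s * Log z))%C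
      <= e * G * Cmod (Cexp (lg s - s * Log z)).
Proof.
intros Ha Hc H Hal Hb He. assert (HPI := PI_RGT_0). assert (HPI2 := PI2_1).
(* The rays lie strictly outside |arg s| <= b, which contains the saddle points, and strictly inside
   the angle where (C) is uniform. *)
set (a1 := (a + b) / 2).
assert (Ha1 : b < a1 < a) by (unfold a1; lra).
destruct (dlg_ray a c g lg Ha Hc H a1 b ltac:(lra) ltac:(lra)) as [c0 [X1 [Hc0 HX1]]].
destruct (saddle_both b a1 c0 e ltac:(lra) ltac:(lra) Hc0 He) as [eta [Lam [Heta [HLam HS]]]].
assert (HW : 0 <= wide a1).
{ unfold wide. assert (0 < sin a1) by (apply sin_gt_0; lra).
  assert (0 < 2 * PI / sin a1) by (apply Rdiv_lt_0_compat; lra). lra. }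
destruct (dlg_linear a c g lg Ha Hc H a1 (wide a1) eta ltac:(lra) HW Heta) as [X2 HX2].
destruct (exp_epsR_infty a c g lg Ha Hc H Lam) as [X3 HX3].
exists (Rmax (Rmax X1 X2) (Rmax X3 X3)). intros x th z Hx Hth Hz s G.
apply Rmax4_elim in Hx. destruct Hx as [L1 [L2 [L3 _]]].
destruct (epsR_spec a c x g lg Ha Hc H) as [PE _]. specialize (HX3 x L3).
set (E := epsR lg x) in *. set (rho := exp x) in *.
assert (Prho : 0 < rho) by apply exp_pos.
set (lam := rho * E) in *.
assert (Plam : 0 < lam) by lra.
destruct (K_primitive a c g lg al a1 z Ha Hc H ltac:(lra) ltac:(lra)) as [F [Fp [Fm [HF [HFp [HFm HK]]]]]].
set (w := Log z) in *.
assert (Nlam : RtoC lam <> 0) by (intros Q; apply RtoC_inj in Q; lra).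
assert (Nrho : RtoC rho <> 0) by (intros Q; apply RtoC_inj in Q; lra).
assert (NE : RtoC E <> 0) by (intros Q; apply RtoC_inj in Q; lra).
set (sh := fun v : C => (v + (x, 0))%C).
assert (Esh : forall y t, sh (y, t) = ((y + x)%R, t)) by (intros; unfold sh, Cplus; simpl; f_equal; ring).
assert (Eexp : forall v, Cexp (sh v) = (RtoC rho * Cexp v)%C).
{ intros v. unfold sh, rho. rewrite RtoC_exp, <- Cexp_plus. f_equal. unfold RtoC; ring. }
(* The shift by x scales s by 1 / rho. The divisors lam, E and rho fit together: lam = rho * E gives
   Hf' = kap * e^zeta. *)
set (Hf := fun v => ((lg (Cexp (sh v)) - Cexp (sh v) * w) / RtoC lam)%C).
set (kap := fun v => ((dlg lg (sh v) - w) / RtoC E)%C).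
set (P := fun v => (F (Cexp (sh v)) / RtoC rho)%C).
assert (An : forall y t, Rabs t <= a1 -> angle a c (Cexp (sh (y, t)))).
{ intros y t Ht. rewrite Esh. apply angle_Cexp; auto; lra. }
assert (Dexp : forall v, is_Cder (fun v => Cexp (sh v)) v (Cexp (sh v))).
{ intros v. rewrite <- (Cmult_1_r (Cexp (sh v))). apply (Cder_comp Cexp sh); [apply Cder_Cexp|].
  replace (RtoC 1) with (1 + 0)%C by ring. apply Cder_plus; [apply Cder_id|apply Cder_const]. }
assert (Hlam : forall v, (RtoC lam * Hf v)%C = (lg (Cexp (sh v)) - Cexp (sh v) * w)%C).
{ intros v. unfold Hf. field. exact Nlam. }
assert (U := HS th lam Hf kap P (Fp / RtoC rho)%C (Fm / RtoC rho)%C Hth HX3).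
assert (S0 : sh (0, th) = (x, th)) by (rewrite Esh; f_equal; ring).
assert (V : Cmod (Fp / RtoC rho - Fm / RtoC rho - Ci * Cexp (0, (th / 2)%R) * Cexp (RtoC lam * Hf (0%R, th))
          * RtoC (sqrt PI / sqrt (lam / 2)))%C <= e * (exp (lam * Re (Hf (0, th))) / sqrt lam)).
{ apply U; clear U.
  - intros y t Ht. set (v := (y, t)).
    replace (kap v * Cexp v)%C with ((C_derive lg (Cexp (sh v)) * Cexp (sh v) - (Cexp (sh v) * w + Cexp (sh v) * 0)) * / RtoC lam
       + (lg (Cexp (sh v)) - Cexp (sh v) * w) * 0)%C.
    2:{ unfold kap, dlg. rewrite Eexp. unfold lam. rewrite RtoC_mult. field. auto. }
    apply (Cder_mult (fun v => lg (Cexp (sh v)) - Cexp (sh v) * w)%C (fun _ => / RtoC lam)%C); [|apply Cder_const].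
    apply Cder_minus.
    + apply (Cder_comp lg (fun v => Cexp (sh v))); [|apply Dexp]. apply (lg_der a c g); auto. now apply An.
    + apply (Cder_mult (fun v => Cexp (sh v)) (fun _ => w)); [apply Dexp|apply Cder_const].
  - intros y t Ht. set (v := (y, t)). rewrite Hlam.
    replace (Cexp (lg (Cexp (sh v)) - Cexp (sh v) * w) * Cexp v)%C
      with (Cexp (lg (Cexp (sh v)) - Cexp (sh v) * w) * Cexp (sh v) * / RtoC rho + F (Cexp (sh v)) * 0)%C.
    2:{ rewrite (Eexp v) at 3. field. exact Nrho. }
    apply (Cder_mult (fun v => F (Cexp (sh v))) (fun _ => / RtoC rho)%C); [|apply Cder_const].
    apply (Cder_comp F (fun v => Cexp (sh v))); [|apply Dexp]. now apply HF, An.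
  - intros y t Hy Ht.
    replace (kap (y, t) - ((y, t) - (0%R, th)))%C
      with ((dlg lg ((y + x)%R, t) - dlg lg (x, th) - RtoC E * (((y + x)%R, t) - (x, th))) / RtoC E)%C.
    2:{ unfold kap. rewrite Esh, Hz.
        replace ((y, t) - (0%R, th))%C with (((y + x)%R, t) - (x, th))%C.
        field. exact NE. unfold Cminus, Cplus, Copp; simpl. f_equal; ring. }
    rewrite Cmod_div, Cmod_R, (Rabs_pos_eq E) by (exact NE || lra).
    apply Rle_div_l; [lra|].
    assert (Q := HX2 x th (y + x) t L2 ltac:(lra) Ht). fold E in Q.
    replace ((y, t) - (0, th))%C with (((y + x)%R, t) - (x, th))%C.
    2:{ unfold Cminus, Cplus, Copp; simpl. f_equal; ring. }
    replace (eta * Cmod (((y + x)%R, t) - (x, th)) * E) with (eta * E * Cmod (((y + x)%R, t) - (x, th))) by ring.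
    apply Q. now replace (y + x - x) with y by ring.
  - intros y Hy. unfold kap. rewrite Esh, Hz.
    assert (Q := HX1 x th (y + x) a1 ltac:(lra) Hth (Rabs_pos_eq a1 ltac:(lra))). fold E in Q.
    replace (Cexp (0, a1) * ((dlg lg ((y + x)%R, a1) - dlg lg (x, th)) / RtoC E))%C
      with (RtoC (/ E) * (Cexp (0, a1) * (dlg lg ((y + x)%R, a1) - dlg lg (x, th))))%C
      by (rewrite RtoC_inv by lra; unfold Cdiv; ring).
    match goal with |- Re (_ * ?v)%C <= _ =>
      replace (Re (RtoC (/ E) * v)%C) with (Re v / E) by (unfold Cmult, RtoC, Re, Rdiv; simpl; ring) end.
    apply Rle_div_l; [lra|exact Q].
  - intros y Hy. unfold kap. rewrite Esh, Hz.
    assert (Q := HX1 x th (y + x) (- a1) ltac:(lra) Hth ltac:(rewrite Rabs_Ropp; apply Rabs_pos_eq; lra)). fold E in Q.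
    replace (Cexp (0, (- a1)%R) * ((dlg lg ((y + x)%R, (- a1)%R) - dlg lg (x, th)) / RtoC E))%C
      with (RtoC (/ E) * (Cexp (0, (- a1)%R) * (dlg lg ((y + x)%R, (- a1)%R) - dlg lg (x, th))))%C
      by (rewrite RtoC_inv by lra; unfold Cdiv; ring).
    match goal with |- Re (_ * ?v)%C <= _ =>
      replace (Re (RtoC (/ E) * v)%C) with (Re v / E) by (unfold Cmult, RtoC, Re, Rdiv; simpl; ring) end.
    apply Rle_div_l; [lra|exact Q].
  - intros e' He'. destruct (HFp (e' * rho)) as [X' HX']; [now apply Rmult_lt_0_compat|].
    exists (X' - x). intros y Hy. unfold P. rewrite Esh.
    replace (F (Cexp ((y + x)%R, a1)) / RtoC rho - Fp / RtoC rho)%C with ((F (Cexp ((y + x)%R, a1)) - Fp) / RtoC rho)%C by (field; exact Nrho).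
    rewrite Cmod_div, Cmod_R, (Rabs_pos_eq rho) by (exact Nrho || lra).
    apply Rle_div_l; [lra|]. apply HX'; lra.
  - intros e' He'. destruct (HFm (e' * rho)) as [X' HX']; [now apply Rmult_lt_0_compat|].
    exists (X' - x). intros y Hy. unfold P. rewrite Esh.
    replace (F (Cexp ((y + x)%R, (- a1)%R)) / RtoC rho - Fm / RtoC rho)%C with ((F (Cexp ((y + x)%R, (- a1)%R)) - Fm) / RtoC rho)%C by (field; exact Nrho).
    rewrite Cmod_div, Cmod_R, (Rabs_pos_eq rho) by (exact Nrho || lra).
    apply Rle_div_l; [lra|]. apply HX'; lra. }
replace (exp (lam * Re (Hf (0, th)))) with (Cmod (Cexp (RtoC lam * Hf (0, th)))) in V.
2:{ rewrite Cmod_Cexp. f_equal. unfold Cmult, RtoC, Re; simpl; ring. }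
rewrite Hlam, S0 in V. fold s in V.
set (T := Cexp (lg s - s * w)) in *.
assert (Hsl : 0 < sqrt lam) by now apply sqrt_lt_R0.
assert (Hsl2 : 0 < sqrt (lam / 2)) by (apply sqrt_lt_R0; lra).
assert (HsP : 0 < sqrt PI) by (apply sqrt_lt_R0; lra).
(* The Gaussian constant sqrt(PI) / sqrt(lam / 2), times rho from P = F / rho and 1 / (2 PI) from
   the definition of K, is exactly sqrt(rho / (2 PI E)). *)
assert (HG : G = rho / (2 * PI) * (sqrt PI / sqrt (lam / 2))).
{ unfold G. apply sqrt_lem_1.
  - apply Rlt_le, Rdiv_lt_0_compat; [easy|]. apply Rmult_lt_0_compat; lra.
  - apply Rlt_le, Rmult_lt_0_compat; apply Rdiv_lt_0_compat; lra.
  - replace (rho / (2 * PI) * (sqrt PI / sqrt (lam / 2)) * (rho / (2 * PI) * (sqrt PI / sqrt (lam / 2))))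
      with (rho * rho / (4 * PI * PI) * (sqrt PI * sqrt PI) / (sqrt (lam / 2) * sqrt (lam / 2))) by (field; lra).
    rewrite !sqrt_sqrt by lra. unfold lam. field. lra. }
assert (HG2 : rho / (2 * PI) / sqrt lam <= G).
{ rewrite HG. unfold Rdiv at 1. apply Rmult_le_compat_l; [apply Rlt_le, Rdiv_lt_0_compat; lra|].
  apply Rle_div_r; [easy|]. rewrite Rmult_comm. apply Rle_div_l; [easy|].
  rewrite <- sqrt_mult by lra. apply sqrt_le_1_alt. nra. }
rewrite HK.
assert (H2pi : RtoC (2 * PI) <> 0) by (intros Q; apply RtoC_inj in Q; lra).
assert (HCi : Ci <> 0) by (intros Q; assert (Q' := f_equal Cmod Q); rewrite Cmod_Ci, Cmod_0 in Q'; lra).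
match type of V with Cmod ?v <= _ => set (vv := v) in * end.
replace ((Fp - Fm) / (RtoC (2 * PI) * Ci) - RtoC G * Cexp (0, (th / 2)%R) * T)%C with (RtoC rho / (RtoC (2 * PI) * Ci) * vv)%C.
2:{ unfold vv. rewrite HG, (RtoC_mult (rho / (2 * PI))), (RtoC_div rho) by lra. field. auto. }
rewrite Cmod_mult, Cmod_div by (apply Cmult_neq_0; auto).
rewrite Cmod_mult, Cmod_Ci, !Cmod_R, Rmult_1_r, !Rabs_pos_eq by lra.
assert (T0 := Cmod_ge_0 T).
apply Rle_trans with (rho / (2 * PI) * (e * (Cmod T / sqrt lam))).
- apply Rmult_le_compat_l; [apply Rlt_le, Rdiv_lt_0_compat; lra|exact V].
- replace (rho / (2 * PI) * (e * (Cmod T / sqrt lam))) with (e * Cmod T * (rho / (2 * PI) / sqrt lam)) by (field; lra).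
  replace (e * G * Cmod T) with (e * Cmod T * G) by ring.
  apply Rmult_le_compat_l; [nra|exact HG2].
Qed.

Theorem theorem1 (alpha0 c : R) (gamma lg : C -> C)
  (Halpha0 : PI / 2 < alpha0 <= PI) (Hc : 0 < c)
  (Hgamma : admissible alpha0 c gamma lg)
  (alpha : R) (Halpha : PI / 2 < alpha < alpha0)
  (delta : R) (Hdelta : 0 < delta)
  (rho0 : R) (Hrho0 : 0 < rho0)
  (Hunivalent : univalent_on (sector (alpha0 - delta) rho0) (Phi lg))
  (rho1 : R) (Hrho1 : rho0 <= rho1) (q : C -> C)
  (Hq : sqrt_branch (sector (alpha0 - delta) rho1)
          (fun s => L lg s / (RtoC (2 * PI) * C_derive (L lg) s))%C q) :
  forall eta : R, 0 < eta ->
  exists R0 : R, forall (z : log_surface) (s : C),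
    Omega lg (alpha0 - delta) rho0 z ->
    saddle_point lg (alpha0 - delta) rho0 z s ->
    R0 < modulus z ->
    Cmod (K gamma alpha z - main_term lg q s)%C <= eta * Cmod (main_term lg q s).
Proof.
intros eta Heta. assert (HPI := PI_RGT_0).
(* One bound for the arguments of the saddle points and for the angle of the contour. *)
set (b := Rmax (alpha0 - delta) alpha).
assert (Hb1 : alpha0 - delta <= b) by apply Rmax_l.
assert (Hb2 : alpha <= b) by apply Rmax_r.
assert (Hb3 : b < alpha0) by (apply Rmax_lub_lt; lra).
(* The estimate for K costs e and the one for the square root 2 e, relative to G; with e <= 1/4 the
   modulus of q s is at least G / 2, so 3 e <= eta / 2 is enough. *)
set (e := Rmin (/ 4) (eta / 8)).
assert (He : 0 < e) by (apply Rmin_glb_lt; lra).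
assert (He1 : e <= / 4) by apply Rmin_l. assert (He2 : e <= eta / 8) by apply Rmin_r.
destruct (K_asymptotic alpha0 c b alpha e gamma lg Halpha0 Hc Hgamma ltac:(lra) Hb3 He) as [X1 HX1].
destruct (eps_log_near_real alpha0 c gamma lg Halpha0 Hc Hgamma b e Hb3 He) as [X2 HX2].
(* The entry rho1 + 1 places s in the sector where q is defined. *)
set (X := Rmax (Rmax X1 X2) (Rmax (ln rho0) (ln (rho1 + 1)))).
destruct (Phi_bounded alpha0 c b rho0 (exp X) gamma lg Halpha0 Hc Hgamma Hb3 Hrho0) as [M HM].
(* If log |z| = Re Phi(s) exceeds M, then |s| > exp X. *)
exists (exp M). intros z s _ [[r [th [Hr [Hth Es]]]] Hz] Hmod.
unfold modulus in Hmod. apply exp_lt_inv in Hmod.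
assert (HrX : exp X < r).
{ destruct (Rlt_le_dec (exp X) r) as [G|G]; [exact G|exfalso].
  assert (Q := HM r th ltac:(lra) ltac:(lra)). rewrite <- Es, Hz in Q.
  assert (Q' := Rle_trans _ _ _ (Rle_abs _) (re_le_Cmod (Log z))). lra. }
assert (Pr : 0 < r) by lra.
set (x := ln r).
assert (Hx : X <= x).
{ unfold x. rewrite <- (ln_exp X). left. apply ln_increasing; [apply exp_pos|exact HrX]. }
assert (Ex : exp x = r) by (apply exp_ln, Pr).
assert (Esx : s = Cexp (x, th)) by (rewrite Es; apply polar_Cexp, Pr).
apply Rmax4_elim in Hx. destruct Hx as [L1 [L2 [_ L4]]].
assert (Hrho1x : rho1 < exp x).
{ apply exp_le in L4. rewrite exp_ln in L4; lra. }
assert (An : angle alpha0 c s) by (rewrite Esx; apply angle_Cexp; auto; lra).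
assert (Ns : s <> 0) by (rewrite Esx; apply Cexp_neq_0).
assert (Hlog : Log z = dlg lg (x, th)).
{ rewrite <- Hz, (Phi_eq alpha0 c gamma lg s Halpha0 Hgamma An Ns), Esx. reflexivity. }
assert (HK := HX1 x th z L1 ltac:(lra) Hlog). cbv zeta in HK. rewrite <- Esx in HK.
assert (HQ := sqrt_branch_near alpha0 c (alpha0 - delta) rho1 x th e gamma lg q Halpha0 Hc Hgamma
  ltac:(lra) Hrho1x Hth ltac:(lra) (fun t Ht => HX2 x t L2 ltac:(lra)) Hq).
rewrite <- Esx in HQ.
destruct (epsR_spec alpha0 c x gamma lg Halpha0 Hc Hgamma) as [PE _].
set (G := sqrt (exp x / (2 * PI * epsR lg x))) in *.
assert (PG : 0 < G).
{ apply sqrt_lt_R0, Rdiv_lt_0_compat; [apply exp_pos|]. apply Rmult_lt_0_compat; lra. }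
set (v := (RtoC G * Cexp (0, (th / 2)%R))%C) in *.
assert (Hv : Cmod v = G).
{ unfold v. rewrite Cmod_mult, Cmod_R, Rabs_pos_eq, Cmod_Cexp by lra. change (Re (0, th / 2)) with 0.
  rewrite exp_0. ring. }
(* At the saddle point log z = (log gamma)'(s), whence -s epsilon(s) = log gamma(s) - s log z. *)
assert (Hmain : main_term lg q s = (q s * Cexp (lg s - s * Log z))%C).
{ unfold main_term. rewrite (logderiv_eq alpha0 c gamma lg s Halpha0 Hgamma An Ns). f_equal. f_equal.
  rewrite <- Hz, (Phi_eq alpha0 c gamma lg s Halpha0 Hgamma An Ns). unfold eps1. field. exact Ns. }
rewrite Hmain. set (T := Cexp (lg s - s * Log z)) in *.
assert (T0 := Cmod_ge_0 T).
replace (K gamma alpha z - q s * T)%C with ((K gamma alpha z - v * T) + - ((q s - v) * T))%C by ring.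
eapply Rle_trans; [apply Cmod_triangle|]. rewrite Cmod_opp, !Cmod_mult.
assert (Hqs : G / 2 <= Cmod (q s)).
{ assert (Q := Cmod_sub_ge v (q s)). rewrite Cmod_sub_sym, Hv in Q. nra. }
assert (A1 : Cmod (q s - v) * Cmod T <= 2 * e * G * Cmod T) by (apply Rmult_le_compat_r; lra).
assert (A2 : eta * (G / 2 * Cmod T) <= eta * (Cmod (q s) * Cmod T)).
{ apply Rmult_le_compat_l; [lra|]. apply Rmult_le_compat_r; lra. }
assert (A3 : 3 * e * (G * Cmod T) <= eta / 2 * (G * Cmod T)).
{ apply Rmult_le_compat_r; [apply Rmult_le_pos; lra|lra]. }
lra.
Qed.
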